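(* Assume the Ketonen order on \(\mathrm{Un}\) is linear. Then for any \(U,W\in\mathrm{Un}\), \(U\oplus t_U(W)=W\oplus t_W(U)\).
   Context: A uniform ultrafilter on an ordinal \(\alpha\) is an ultrafilter on \(\alpha\) containing \(\alpha\setminus\beta\) for all \(\beta<\alpha\); its space \(\mathrm{sp}(U)\) is \(\alpha\). \(\mathrm{Un}\) is the class of countably complete uniform ultrafilters on ordinals; \(\mathrm{Un}^M\), \(\lhd_E^M\) are computed in an inner model \(M\). Ketonen order: \(U\lhd_E W\) iff there are countably complete ultrafilters \(U_\alpha\) on \(\alpha\) for \(0<\alpha<\mathrm{sp}(W)\) such that for all \(X\subseteq\mathrm{sp}(U)\), \(X\in U\) iff \(\{\alpha<\mathrm{sp}(W): X\cap\alpha\in U_\alpha\}\in W\); it is a strict wellfounded partial order, and ''linear'' means any two distinct elements of \(\mathrm{Un}\) are comparable. For a countably complete ultrafilter \(U\), \(j_U:V\to M_U\) is the ultrapower embedding into the transitive collapse and \([\mathrm{id}]_U\) the element represented by the identity; \(j^M_W\), \([\mathrm{id}]^M_W\) are the analogues for an inner model \(M\) and \(M\)-ultrafilter \(W\). Limit: for \(W'\in\mathrm{Un}^{M_U}\) with space \(\delta'\), \(U^-(W')=\{X\subseteq\delta: j_U(X)\cap\delta'\in W'\}\), \(\delta\) least with \(\delta'\leq j_U(\delta)\). Translation (under linearity of the Ketonen order): \(t_U(W)\) is the \(\lhd_E^{M_U}\)-least \(W_*\in\mathrm{Un}^{M_U}\) with \(U^-(W_* )=W\). For ordinals, \(\alpha\oplus\beta\)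 is the natural (Hessenberg) sum, adding Cantor normal forms coefficientwise. The uniform ultrafilter derived from an elementary \(j:V\to M\) using an ordinal \(a\) of \(M\) is \(\{X\subseteq\delta: a\in j(X)\}\), \(\delta\) least with \(a<j(\delta)\). For \(U\in\mathrm{Un}\), \(W_*\in\mathrm{Un}^{M_U}\), \(U\oplus W_*\) is the uniform ultrafilter derived from \(j^{M_U}_{W_*}\circ j_U\) using \([\mathrm{id}]^{M_U}_{W_*}\oplus j^{M_U}_{W_*}([\mathrm{id}]_U)\). *)

(* Defs.v *)
(* The ambient theory is first-order ZFC: results are stated for an arbitrary
   model (V, ∈) of ZFC, given as a Rocq type with a binary relation.  Only the
   two axiom schemes mention formulas; every other set-theoretic notion is a
   predicate on an arbitrary membership structure, quantifying over its
   elements only, so that "computed in the inner model M" means the same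
   predicate for the structure M. *)
From Stdlib Require Import Utf8.

Set Implicit Arguments.
Unset Strict Implicit.

Record SetStr := { car :> Type; mem : car -> car -> Prop }.

Arguments mem {_} _ _.
Notation "x ∈ y" := (mem x y) (at level 70, no associativity).
Notation "x ⊆ y" := (∀ z, z ∈ x → z ∈ y) (at level 70, no associativity).

Definition sub (V : SetStr) (M : V → Prop) : SetStr :=
  {| car := {x : V | M x}; mem := fun x y => proj1_sig x ∈ proj1_sig y |}.

Definition val (V : SetStr) (M : V → Prop) (x : sub M) : V := proj1_sig x.

(** * The axioms of ZFC *)

(* Formulas of the language of set theory, variables being de Bruijn indices. *)
Inductive form : Type :=
| FMem (i j : nat)
| FEq (i j : nat)
| FNot (p : form)
| FAnd (p q : form)
| FAll (p : form).

Definition scons (V : Type) (x : V) (e : nat → V) (n : nat) : V :=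
  match n with O => x | S m => e m end.

Fixpoint sat (V : SetStr) (e : nat → V) (p : form) : Prop :=
  match p with
  | FMem i j => e i ∈ e j
  | FEq i j => e i = e j
  | FNot q => ¬ sat e q
  | FAnd q r => sat e q ∧ sat e r
  | FAll q => ∀ x : V, sat (scons x e) q
  end.

Section Basic.
Variable V : SetStr.
Implicit Types a b c d e f g h n p s u v w x y z k l m : V.

Definition is_empty x := ∀ z, ¬ z ∈ x.
Definition nonempty x := ∃ z, z ∈ x.
Definition is_upair x y p := ∀ z, z ∈ p ↔ z = x ∨ z = y.
Definition is_succ x y := ∀ z, z ∈ y ↔ z ∈ x ∨ z = x.
Definition is_inter x y i := ∀ z : V, z ∈ i ↔ z ∈ x ∧ z ∈ y.
Definition is_diff x y d := ∀ z, z ∈ d ↔ z ∈ x ∧ ¬ z ∈ y.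

Record ZFC : Prop := {
  zfc_extensionality : ∀ x y, (∀ z, z ∈ x ↔ z ∈ y) → x = y;
  zfc_foundation : ∀ x, nonempty x → ∃ y, y ∈ x ∧ ∀ z, z ∈ y → ¬ z ∈ x;
  zfc_pairing : ∀ x y, ∃ p, is_upair x y p;
  zfc_union : ∀ x, ∃ u, ∀ z, z ∈ u ↔ ∃ y, y ∈ x ∧ z ∈ y;
  zfc_powerset : ∀ x, ∃ p, ∀ z, z ∈ p ↔ z ⊆ x;
  zfc_infinity : ∃ x, (∃ y, is_empty y ∧ y ∈ x) ∧
                      ∀ y, y ∈ x → ∃ z, is_succ y z ∧ z ∈ x;
  zfc_separation : ∀ (phi : form) (env : nat → V) a,
    ∃ b, ∀ x, x ∈ b ↔ x ∈ a ∧ sat (scons x env) phi;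
  zfc_replacement : ∀ (phi : form) (env : nat → V) a,
    (∀ x, x ∈ a → ∀ y z, sat (scons y (scons x env)) phi →
                         sat (scons z (scons x env)) phi → y = z) →
    ∃ b, ∀ y, y ∈ b ↔ ∃ x, x ∈ a ∧ sat (scons y (scons x env)) phi;
  zfc_choice : ∀ a, (∀ x, x ∈ a → nonempty x) →
    (∀ x y, x ∈ a → y ∈ a → (∃ z, z ∈ x ∧ z ∈ y) → x = y) →
    ∃ c, ∀ x, x ∈ a → exists! z, z ∈ x ∧ z ∈ c
}.

(** * Functions and ordinals *)

Definition is_opair x y p := ∀ z, z ∈ p ↔ is_upair x x z ∨ is_upair x y z.

(* f(x) = y *)
Definition app f x y := ∃ p, is_opair x y p ∧ p ∈ f.

(* f is a function with domain d *)
Definition is_fun f d :=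
  (∀ p, p ∈ f → ∃ x y, is_opair x y p) ∧
  (∀ x, x ∈ d ↔ ∃ y, app f x y) ∧
  (∀ x y z, app f x y → app f x z → y = z).

Definition transitive x := ∀ y z, z ∈ y → y ∈ x → z ∈ x.

Definition ordinal x :=
  transitive x ∧ ∀ y z, y ∈ x → z ∈ x → y ∈ z ∨ y = z ∨ z ∈ y.

Definition ole a b := a ∈ b ∨ a = b.

Definition least (P : V → Prop) a :=
  ordinal a ∧ P a ∧ ∀ b, b ∈ a → ¬ P b.

Definition limit_ordinal x :=
  ordinal x ∧ nonempty x ∧ ∀ y, y ∈ x → ∃ z, is_succ y z ∧ z ∈ x.

Definition is_omega x := limit_ordinal x ∧ ∀ y, y ∈ x → ¬ limit_ordinal y.

(** * Ordinal arithmetic and the natural sum *)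

(* y is the value at b of the continuous sequence on the ordinals that starts
   with z and proceeds by step at successors. *)
Definition ordrec z (step : V → V → Prop) b y :=
  ∃ d f, is_succ b d ∧ is_fun f d ∧ app f b y ∧
    ∀ x v, app f x v →
      (is_empty x → v = z) ∧
      (∀ w, is_succ w x → ∃ u, app f w u ∧ step u v) ∧
      (limit_ordinal x → ∀ t : V, t ∈ v ↔ ∃ w u, w ∈ x ∧ app f w u ∧ t ∈ u).

Definition oadd a b c := ordrec a is_succ b c.
Definition omul a b c :=
  ∃ z, is_empty z ∧ ordrec z (fun u v => oadd u a v) b c.
Definition oexp a b c :=
  ∃ z i : V, is_empty z ∧ is_succ z i ∧ ordrec i (fun u v => omul u a v) b c.

(* a = ω^e(0)·c(0) + ... + ω^e(n-1)·c(n-1), where e(0) > ... > e(n-1) are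
   ordinals and the c(i) are nonzero natural numbers; s is the sequence of
   partial sums. *)
Definition cnf a n e c :=
  ∃ w s n', is_omega w ∧ n ∈ w ∧ is_succ n n' ∧
    is_fun e n ∧ is_fun c n ∧ is_fun s n' ∧
    (∀ i g : V, app e i g → ordinal g) ∧
    (∀ i j x y : V, app e i x → app e j y → i ∈ j → y ∈ x) ∧
    (∀ i k : V, app c i k → k ∈ w ∧ nonempty k) ∧
    (∀ z x, is_empty z → app s z x → is_empty x) ∧
    (∀ i i' x y : V, i ∈ n → is_succ i i' → app s i x → app s i' y →
       ∃ g k p t : V, app e i g ∧ app c i k ∧
         oexp w g p ∧ omul p k t ∧ oadd x t y) ∧
    app s n a.

(* k is the coefficient of ω^g in the Cantor normal form of a *)
Definition coefficient a g k :=
  ∃ n e c, cnf a n e c ∧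
    ((∃ i : V, app e i g ∧ app c i k) ∨
     (is_empty k ∧ ¬ ∃ i : V, app e i g)).

Definition natural_sum a b c :=
  ordinal a ∧ ordinal b ∧ ordinal c ∧
  ∀ g, ordinal g →
    ∃ k l m, coefficient a g k ∧ coefficient b g l ∧ coefficient c g m ∧
             oadd k l m.

(** * Ultrafilters and the Ketonen order *)

Definition ultrafilter (U : V) d :=
  (∀ X : V, X ∈ U → X ⊆ d) ∧
  d ∈ U ∧
  (∀ X : V, X ∈ U → nonempty X) ∧
  (∀ X Y : V, X ∈ U → X ⊆ Y → Y ⊆ d → Y ∈ U) ∧
  (∀ X Y I : V, X ∈ U → Y ∈ U → is_inter X Y I → I ∈ U) ∧
  (∀ X Y : V, X ⊆ d → is_diff d X Y → X ∈ U ∨ Y ∈ U).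

Definition countably_complete (U : V) d :=
  ∀ w f I : V, is_omega w → is_fun f w →
    (∀ n X : V, app f n X → X ∈ U) →
    (∀ x, x ∈ I ↔ x ∈ d ∧ ∀ n X : V, app f n X → x ∈ X) →
    I ∈ U.

Definition cc_ultrafilter (U : V) d := ultrafilter U d ∧ countably_complete U d.

Definition Un_on (U : V) d :=
  ordinal d ∧ cc_ultrafilter U d ∧
  ∀ b Y : V, b ∈ d → is_diff d b Y → Y ∈ U.

Definition Un (U : V) := ∃ d, Un_on U d.

(* The sequence F of ultrafilters is indexed by D = {α : 0 < α < sp(W)}. *)
Definition ketonen (U W : V) :=
  ∃ dU dW D F : V, Un_on U dU ∧ Un_on W dW ∧
    (∀ a, a ∈ D ↔ a ∈ dW ∧ nonempty a) ∧
    is_fun F D ∧ (∀ a Ua : V, app F a Ua → cc_ultrafilter Ua a) ∧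
    ∀ X : V, X ⊆ dU →
      (X ∈ U ↔ ∃ A : V, A ∈ W ∧
         ∀ a, a ∈ A ↔ a ∈ dW ∧ ∃ Ua I : V, app F a Ua ∧ is_inter X a I ∧ I ∈ Ua).

Definition ketonen_linear :=
  ∀ U W : V, Un U → Un W → U = W ∨ ketonen U W ∨ ketonen W U.

(** * Ultrapowers *)

(* {a ∈ d : R (f a) (g a)} belongs to U *)
Definition almost (U : V) d (R : V → V → Prop) f g :=
  ∃ A : V, A ∈ U ∧
    ∀ a, a ∈ A ↔ a ∈ d ∧ ∃ x y, app f a x ∧ app g a y ∧ R x y.

(* x is the image of (the class of) f under the transitive collapse of the
   ultrapower of the universe by the ultrafilter U on d.  The collapsing map
   is the proper class given by π(h) = {π(g) : g ∈_U h}; it is described here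
   through its set-sized approximations c, whose domain C contains,
   up to equality modulo U, all ∈_U-predecessors of its elements. *)
Definition collapse (U : V) d f x :=
  is_fun f d ∧
  ∃ C c : V, is_fun c C ∧
    (∀ h, h ∈ C → is_fun h d) ∧
    (∀ g h, h ∈ C → is_fun g d → almost U d mem g h →
       ∃ g', g' ∈ C ∧ almost U d eq g g') ∧
    (∀ h y, app c h y →
       ∀ z, z ∈ y ↔ ∃ g, almost U d mem g h ∧ app c g z) ∧
    app c f x.

Definition is_const d x f := is_fun f d ∧ ∀ a y, app f a y → y = x.
Definition is_id d f := is_fun f d ∧ ∀ a y, app f a y → y = a.

(* The transitive class M_U *)
Definition in_Ult (U x : V) := ∃ d f, Un_on U d ∧ collapse U d f x.

(* Z is the uniform ultrafilter derived from j using a; j : V → V is the graph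
   of an elementary embedding into some transitive class. *)
Definition derived (j : V → V → Prop) a (Z : V) :=
  ∃ d, least (fun b => ∃ y, j b y ∧ a ∈ y) d ∧
    ∀ X : V, X ∈ Z ↔ X ⊆ d ∧ ∃ y, j X y ∧ a ∈ y.

End Basic.

Arguments ZFC V : clear implicits.
Arguments ketonen_linear V : clear implicits.

Definition Ult (V : SetStr) (U : V) : SetStr := sub (in_Ult U).

Section Ultrapower.
Variables (V : SetStr) (U : V).

(* j_U(x) = y *)
Definition ult_embed (x : V) (y : Ult U) :=
  ∃ d f : V, Un_on U d ∧ is_const d x f ∧ collapse U d f (val y).

(* [id]_U = y *)
Definition ult_id (y : Ult U) :=
  ∃ d f : V, Un_on U d ∧ is_id d f ∧ collapse U d f (val y).

(* U^-(W') = Z *)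
Definition ult_limit (W' : Ult U) (Z : V) :=
  ∃ (d' : Ult U) (d : V), Un_on W' d' ∧
    least (fun b => ∃ y, ult_embed b y ∧ ole d' y) d ∧
    ∀ X : V, X ∈ Z ↔
      X ⊆ d ∧ ∃ y I : Ult U, ult_embed X y ∧ is_inter y d' I ∧ I ∈ W'.

(* t_U(W) = W' *)
Definition translation (W : V) (W' : Ult U) :=
  Un W' ∧ ult_limit W' W ∧
  ∀ W'' : Ult U, Un W'' → ult_limit W'' W → W' = W'' ∨ ketonen W' W''.

End Ultrapower.

Section UltrafilterSum.
Variables (V : SetStr) (U : V) (W' : Ult U).

(* The composite of j_U and of the ultrapower of M_U by W', as a map to V *)
Definition iter_embed (x z : V) :=
  ∃ (y : Ult U) (t : Ult W'), ult_embed x y ∧ ult_embed y t ∧ z = val (val t).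

(* U ⊕ W' = Z *)
Definition ultrafilter_sum (Z : V) :=
  ∃ (u : Ult U) (i t : Ult W') (a : V),
    ult_id u ∧ ult_id i ∧ ult_embed u t ∧
    natural_sum (val (val i)) (val (val t)) a ∧
    derived iter_embed a Z.

End UltrafilterSum.

Arguments translation {V} U W W'.
Arguments ultrafilter_sum {V} U W' Z.

(* Main.v *)
(* By Łoś's theorem everything reduces to V: an ultrafilter of M_U is
   represented by a sequence g of ultrafilters g(b), b < sp(U), and U ⊕ [g] is
   the set of X such that a ⊕ b ∈ X for U-almost all b and g(b)-almost all a.

   Let Z0 = U ⊕ t_U(W) and Z1 = W ⊕ t_W(U).  By linearity and symmetry it
   suffices to refute that Z1 lies below Z0, as witnessed by ultrafilters F_c
   on c < sp(Z0).  A larger right summand of c forces a smaller left summand,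
   so c has only finitely many decompositions as a natural sum; by countable
   completeness there are functions p and q recovering the two coordinates on
   a large set, and they push Z1 forward to W and to U.  If c < a ⊕ b then
   p(c) < a or q(c) < b, and one of the two alternatives holds for almost all
   b, a and F_{a ⊕ b}-almost all c.  In the first case the images of the
   F_{a ⊕ b} under p form an ultrafilter of M_U with limit W that lies below
   t_U(W), against minimality; in the second their images under q show that U
   lies below itself, against the wellfoundedness of the Ketonen order.

   Wellfoundedness, of the Ketonen order as well as of ultrapowers, comes from
   the fact that an ultraproduct of wellfounded relations by a countably
   complete ultrafilter is wellfounded.  The natural sum is handled through the
   coefficients obtained by dividing by powers of ω. *)
From Stdlib Require Import Utf8 Arith ClassicalEpsilon FunctionalExtensionality PropExtensionality.
Require Import Defs.
Set Implicit Arguments.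
Unset Strict Implicit.


(** * Definability *)

(** Separation and replacement are available for formulas only, and a Rocq predicate on [V] need not
    be a class of the model, so each class they are applied to is shown definable with parameters.
    Łoś's theorem asks for more, one formula expressing the notion in every structure; hence the
    separate notion of uniformity. Wellfoundedness is always meant inside the model, which may be
    illfounded from outside.

    What shapes the comparison is that the natural sum is commutative and strictly increasing in
    each summand. In Z0 the right summands are distributed by U and the left ones by ultrafilters
    with limit W; in Z1 the roles are exchanged. Commutativity allows the coordinates of c to be
    compared crosswise with those of a ⊕ b, W-coordinate with W-coordinate and U-coordinate with
    U-coordinate.

    Linearity enters twice: to compare Z0 with Z1, and, carried to M_U by Łoś's theorem, to make a
    minimal ultrafilter with limit W the least one. The ultrafilters built against the minimality of
    t_U(W) need not be uniform; each is cut down to the least ordinal that it contains. *)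

Section Definability.
Variable V : SetStr.
Implicit Types (P Q : (nat → V) → Prop) (s t : (nat → V) → V) (e : nat → V).

Fixpoint ren (r : nat → nat) (p : form) : form :=
  match p with
  | FMem i j => FMem (r i) (r j)
  | FEq i j => FEq (r i) (r j)
  | FNot q => FNot (ren r q)
  | FAnd q q' => FAnd (ren r q) (ren r q')
  | FAll q => FAll (ren (fun n => match n with O => O | S m => S (r m) end) q)
  end.

Lemma sat_ren p : ∀ r e, sat e (ren r p) ↔ sat (fun n => e (r n)) p.
Proof.
induction p as [| |p IH|p IHp q IHq|p IH]; intros r e; simpl; try tauto.
- now rewrite IH.
- now rewrite IHp, IHq.
- split; intros H x; specialize (H x); rewrite IH in *;
    match goal with
    | H : sat ?e1 p |- sat ?e2 p => replace e2 with e1; [exact H|]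
    end; apply functional_extensionality; intros [|n]; reflexivity.
Qed.

Definition evterm (a : nat + V) e : V := match a with inl n => e n | inr c => c end.

(* Definability with parameters: every variable of the formula is sent either
   to a coordinate of the environment or to a parameter. *)
Definition definable P :=
  ∃ (p : form) (T : nat → nat + V), ∀ e, P e ↔ sat (fun n => evterm (T n) e) p.

Definition definable_term t := definable (fun e => e 0 = t (fun n => e (S n))).

Lemma definable_iff P Q : definable P → (∀ e, P e ↔ Q e) → definable Q.
Proof.
intros [p [T H]] HPQ; exists p, T; intros e; rewrite <- HPQ; apply H.
Qed.

Lemma definable_not P : definable P → definable (fun e => ¬ P e).
Proof.
intros [p [T H]]; exists (FNot p), T; intros e; simpl; now rewrite H.
Qed.

(** The two formulas come with unrelated assignments of their variables. Giving one the even
    variables and the other the odd ones lets a single assignment serve both. *)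
Lemma definable_and P Q : definable P → definable Q → definable (fun e => P e ∧ Q e).
Proof.
intros [p [T H]] [q [T' H']].
exists (FAnd (ren (fun n => 2 * n) p) (ren (fun n => S (2 * n)) q)),
  (fun n => if Nat.even n then T (Nat.div2 n) else T' (Nat.div2 n)).
intros e; cbn [sat]; rewrite !sat_ren, H, H'.
assert (E1 : (fun n => evterm (if Nat.even (2 * n) then T (Nat.div2 (2 * n)) else T' (Nat.div2 (2 * n))) e)
  = fun n => evterm (T n) e).
{ apply functional_extensionality; intros n.
  now rewrite Nat.even_even, Nat.div2_double. }
assert (E2 : (fun n => evterm (if Nat.even (S (2 * n)) then T (Nat.div2 (S (2 * n))) else T' (Nat.div2 (S (2 * n)))) e)
  = fun n => evterm (T' n) e).
{ apply functional_extensionality; intros n.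
  now rewrite Nat.even_succ, Nat.odd_even, Nat.div2_succ_double. }
now rewrite E1, E2.
Qed.

Lemma definable_all (P : (nat → V) → V → Prop) :
  definable (fun e => P (fun n => e (S n)) (e 0)) → definable (fun e => ∀ x, P e x).
Proof.
intros [p [T H]].
(* The variables that [T] sends to coordinate 0 become the bound variable. Every other variable [n]
   becomes [S n], so that under the quantifier it is again looked up at [n], with its coordinate
   lowered by one. *)
exists (FAll (ren (fun n => match T n with inl O => O | _ => S n end) p)),
  (fun n => match T n with inl (S m) => inl m | a => a end).
intros e; simpl; split; intros K x; specialize (K x);
  specialize (H (scons x e)); simpl in H; rewrite sat_ren in *.
- replace (fun n => scons _ _ _) with (fun n => evterm (T n) (scons x e)); [now apply H|].
  apply functional_extensionality; intros n; destruct (T n) as [[|m]|c] eqn:E;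
    simpl; rewrite ?E; reflexivity.
- apply H; match goal with
    | H : sat ?e1 p |- sat ?e2 p => replace e2 with e1; [exact H|]
    end.
  apply functional_extensionality; intros n; destruct (T n) as [[|m]|c] eqn:E;
    simpl; rewrite ?E; reflexivity.
Qed.

Lemma definable_or P Q : definable P → definable Q → definable (fun e => P e ∨ Q e).
Proof.
intros HP HQ.
apply (definable_iff (definable_not (definable_and (definable_not HP) (definable_not HQ)))).
intros e; tauto.
Qed.

Lemma definable_imp P Q : definable P → definable Q → definable (fun e => P e → Q e).
Proof.
intros HP HQ.
apply (definable_iff (definable_or (definable_not HP) HQ)).
intros e; tauto.
Qed.

Lemma definable_equiv P Q : definable P → definable Q → definable (fun e => P e ↔ Q e).
Proof. intros HP HQ; apply definable_and; now apply definable_imp. Qed.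

Lemma definable_ex (P : (nat → V) → V → Prop) :
  definable (fun e => P (fun n => e (S n)) (e 0)) → definable (fun e => ∃ x, P e x).
Proof.
intros H.
apply (definable_iff (definable_not (definable_all (P := fun e x => ¬ P e x) (definable_not H)))).
intros e; split; [apply not_all_not_ex|]; firstorder.
Qed.

Lemma definable_ren P (r : nat → nat) : definable P → definable (fun e => P (fun n => e (r n))).
Proof.
intros [p [T H]]; exists p, (fun n => match T n with inl m => inl (r m) | inr c => inr c end).
intros e; rewrite H.
replace (fun n => evterm (T n) _) with
  (fun n => evterm match T n with inl m => inl (r m) | inr c => inr c end e); [tauto|].
apply functional_extensionality; intros n; now destruct (T n).
Qed.

Lemma definable_term_var n : definable_term (fun e => e n).
Proof.
exists (FEq 0 1), (fun i => inl (match i with O => O | S _ => S n end)); simpl; tauto.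
Qed.

Lemma definable_term_const c : definable_term (fun _ => c).
Proof.
exists (FEq 0 1), (fun i => match i with O => inl O | S _ => inr c end); simpl; tauto.
Qed.

(** Definable terms are functions without a syntax, so there is nothing to substitute literally. In
    an atomic formula they are replaced by existentially quantified values, and the connectives and
    quantifiers follow by induction. *)
Lemma definable_sat p : ∀ t : nat → (nat → V) → V,
  (∀ n, definable_term (t n)) → definable (fun e => sat (fun n => t n e) p).
Proof.
assert (bin : ∀ (R : V → V → Prop) s t, definable (fun e => R (e 0) (e 1)) →
  definable_term s → definable_term t → definable (fun e => R (s e) (t e))).
{ intros R s t HR Hs Ht.
  apply (@definable_iff (fun e => ∃ x, x = s e ∧ ∃ y, y = t e ∧ R x y)).
  - apply definable_ex, definable_and; [exact Hs|].
    apply definable_ex, definable_and.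
    + exact (definable_ren (fun n => match n with O => O | S m => S (S m) end) Ht).
    + exact (definable_ren (fun n => match n with O => 1 | _ => 0 end) HR).
  - intros e; split; [|eauto 6]. intros [x [-> [y [-> H]]]]; exact H. }
induction p as [i j|i j|p IH|p IHp q IHq|p IH]; intros t Ht; simpl.
- apply (bin (fun x y => x ∈ y)); auto.
  now exists (FMem 0 1), (fun n => inl n).
- apply (bin (fun x y => x = y)); auto.
  now exists (FEq 0 1), (fun n => inl n).
- apply definable_not; auto.
- apply definable_and; auto.
- apply definable_all.
  apply (@definable_iff (fun e => sat (fun n =>
    (match n with O => fun e => e 0 | S m => fun e => t m (fun n => e (S n)) end) e) p)).
  + apply IH; intros [|n]; [apply definable_term_var|].
    exact (definable_ren (fun n => match n with O => O | S m => S (S m) end) (Ht n)).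
  + intros e; replace (fun n => _) with (scons (e 0) (fun n => t n (fun n => e (S n))));
      [tauto|].
    apply functional_extensionality; now intros [|n].
Qed.

Lemma definable_subst P (t : nat → (nat → V) → V) :
  definable P → (∀ n, definable_term (t n)) → definable (fun e => P (fun n => t n e)).
Proof.
intros [p [T H]] Ht.
apply (@definable_iff (fun e => sat (fun n => evterm (T n) (fun n => t n e)) p));
  [|intros e; now rewrite H].
apply definable_sat; intros n; destruct (T n) as [m|c]; simpl;
  [apply Ht|apply definable_term_const].
Qed.

Lemma definable_app3 (R : V → V → V → Prop) s t u :
  definable (fun e => R (e 0) (e 1) (e 2)) →
  definable_term s → definable_term t → definable_term u →
  definable (fun e => R (s e) (t e) (u e)).
Proof.
intros HR Hs Ht Hu.
apply (definable_subst (t := fun n e => match n with 0 => s e | 1 => t e | _ => u e end) HR).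
intros [|[|n]]; assumption.
Qed.

Lemma definable_app2 (R : V → V → Prop) s t :
  definable (fun e => R (e 0) (e 1)) →
  definable_term s → definable_term t → definable (fun e => R (s e) (t e)).
Proof.
intros HR Hs Ht; now apply (@definable_app3 (fun x y _ => R x y) s t t).
Qed.

Lemma definable_app1 (R : V → Prop) s :
  definable (fun e => R (e 0)) → definable_term s → definable (fun e => R (s e)).
Proof.
intros HR Hs; now apply (@definable_app3 (fun x _ _ => R x) s s s).
Qed.

Lemma definable_mem s t :
  definable_term s → definable_term t → definable (fun e => s e ∈ t e).
Proof.
apply (@definable_app2 (fun x y => x ∈ y)); now exists (FMem 0 1), (fun n => inl n).
Qed.

Lemma definable_eq s t :
  definable_term s → definable_term t → definable (fun e => s e = t e).
Proof.
apply (@definable_app2 (fun x y => x = y)); now exists (FEq 0 1), (fun n => inl n).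
Qed.

Lemma definable_term_app2 (G : V → V → V) s t :
  definable_term (fun e => G (e 0) (e 1)) →
  definable_term s → definable_term t → definable_term (fun e => G (s e) (t e)).
Proof.
intros HG Hs Ht.
refine (@definable_app3 (fun z x y => z = G x y) (fun e => e 0)
  (fun e => s (fun n => e (S n))) (fun e => t (fun n => e (S n))) HG _ _ _).
- apply definable_term_var.
- exact (definable_ren (fun n => match n with O => O | S m => S (S m) end) Hs).
- exact (definable_ren (fun n => match n with O => O | S m => S (S m) end) Ht).
Qed.

Lemma definable_term_app1 (G : V → V) s :
  definable_term (fun e => G (e 0)) → definable_term s → definable_term (fun e => G (s e)).
Proof.
intros HG Hs; now apply (@definable_term_app2 (fun x _ => G x) s s).
Qed.

End Definability.

(* A notion defined by one formula in every structure; this is what Łoś's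
   theorem transfers. *)
Definition uniform (P : ∀ M : SetStr, (nat → M) → Prop) :=
  ∃ p : form, ∀ (M : SetStr) (e : nat → M), sat e p ↔ P M e.

Section Uniform.
Implicit Types P Q : ∀ M : SetStr, (nat → M) → Prop.

Lemma uniform_iff P Q : uniform P → (∀ M e, P M e ↔ Q M e) → uniform Q.
Proof. intros [p H] HPQ; exists p; intros M e; now rewrite H. Qed.

Lemma uniform_mem i j : uniform (fun M e => e i ∈ e j).
Proof. now exists (FMem i j). Qed.

Lemma uniform_eq i j : uniform (fun M e => e i = e j).
Proof. now exists (FEq i j). Qed.

Lemma uniform_not P : uniform P → uniform (fun M e => ¬ P M e).
Proof. intros [p H]; exists (FNot p); intros M e; simpl; now rewrite H. Qed.

Lemma uniform_and P Q : uniform P → uniform Q → uniform (fun M e => P M e ∧ Q M e).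
Proof. intros [p H] [q K]; exists (FAnd p q); intros M e; simpl; now rewrite H, K. Qed.

Lemma uniform_all (P : ∀ M : SetStr, (nat → M) → M → Prop) :
  uniform (fun M e => P M (fun n => e (S n)) (e 0)) → uniform (fun M e => ∀ x, P M e x).
Proof.
intros [p H]; exists (FAll p); intros M e; simpl.
split; intros K x; apply (H M (scons x e)); apply K.
Qed.

Lemma uniform_or P Q : uniform P → uniform Q → uniform (fun M e => P M e ∨ Q M e).
Proof.
intros HP HQ.
apply (uniform_iff (uniform_not (uniform_and (uniform_not HP) (uniform_not HQ)))).
intros M e; tauto.
Qed.

Lemma uniform_imp P Q : uniform P → uniform Q → uniform (fun M e => P M e → Q M e).
Proof.
intros HP HQ; apply (uniform_iff (uniform_or (uniform_not HP) HQ)).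
intros M e; tauto.
Qed.

Lemma uniform_equiv P Q : uniform P → uniform Q → uniform (fun M e => P M e ↔ Q M e).
Proof. intros HP HQ; apply uniform_and; now apply uniform_imp. Qed.

Lemma uniform_ex (P : ∀ M : SetStr, (nat → M) → M → Prop) :
  uniform (fun M e => P M (fun n => e (S n)) (e 0)) → uniform (fun M e => ∃ x, P M e x).
Proof.
intros H.
apply (uniform_iff (uniform_not (uniform_all (P := fun M e x => ¬ P M e x) (uniform_not H)))).
intros M e; split; [apply not_all_not_ex|]; firstorder.
Qed.

Lemma uniform_sat (p : form) (r : nat → nat) : uniform (fun M e => sat (fun n => e (r n)) p).
Proof. exists (ren r p); intros M e; apply sat_ren. Qed.

(** By this lemma and the next one, an instance of separation or of replacement is itself a uniform
    notion; this is how the two schemes reach the ultrapower. *)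
Lemma uniform_sat_scons (p : form) (r : nat → nat) i :
  uniform (fun M e => sat (scons (e i) (fun n => e (r n))) p).
Proof.
apply (uniform_iff (uniform_sat p (fun n => match n with O => i | S m => r m end))).
intros M e.
replace (scons _ _) with (fun n => e match n with O => i | S m => r m end); [tauto|].
apply functional_extensionality; now intros [|n].
Qed.

Lemma uniform_sat_scons2 (p : form) (r : nat → nat) i j :
  uniform (fun M e => sat (scons (e i) (scons (e j) (fun n => e (r n)))) p).
Proof.
apply (uniform_iff (uniform_sat_scons p (fun n => match n with O => j | S m => r m end) i)).
intros M e.
replace (scons (e j) _) with (fun n => e match n with O => j | S m => r m end); [tauto|].
apply functional_extensionality; now intros [|n].
Qed.

End Uniform.

(* Uniformity of the notions of the theorem *)
Create HintDb uniform discriminated.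
#[export] Hint Constants Opaque : uniform.
#[export] Hint Variables Opaque : uniform.
#[export] Hint Resolve uniform_mem uniform_eq uniform_not uniform_and uniform_or
  uniform_imp uniform_equiv uniform_all uniform_ex : uniform.
#[export] Hint Extern 0 (uniform _) => progress cbv beta : uniform.
Ltac uniform := intros; cbv beta; solve [auto 200 with uniform nocore].

Lemma uniform_is_empty i : uniform (fun M e => is_empty (e i)).
Proof. unfold is_empty; uniform. Qed.
Lemma uniform_nonempty i : uniform (fun M e => nonempty (e i)).
Proof. unfold nonempty; uniform. Qed.
Lemma uniform_is_upair i j k : uniform (fun M e => is_upair (e i) (e j) (e k)).
Proof. unfold is_upair; uniform. Qed.
#[export] Hint Resolve uniform_is_empty uniform_nonempty uniform_is_upair : uniform.
Lemma uniform_is_opair i j k : uniform (fun M e => is_opair (e i) (e j) (e k)).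
Proof. unfold is_opair; uniform. Qed.
#[export] Hint Resolve uniform_is_opair : uniform.
Lemma uniform_is_succ i j : uniform (fun M e => is_succ (e i) (e j)).
Proof. unfold is_succ; uniform. Qed.
Lemma uniform_is_inter i j k : uniform (fun M e => is_inter (e i) (e j) (e k)).
Proof. unfold is_inter; uniform. Qed.
Lemma uniform_is_diff i j k : uniform (fun M e => is_diff (e i) (e j) (e k)).
Proof. unfold is_diff; uniform. Qed.
Lemma uniform_app i j k : uniform (fun M e => app (e i) (e j) (e k)).
Proof. unfold app; uniform. Qed.
Lemma uniform_transitive i : uniform (fun M e => transitive (e i)).
Proof. unfold transitive; uniform. Qed.
#[export] Hint Resolve uniform_is_succ uniform_is_inter uniform_is_diff uniform_app
  uniform_transitive : uniform.
Lemma uniform_is_fun i j : uniform (fun M e => is_fun (e i) (e j)).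
Proof. unfold is_fun; uniform. Qed.
Lemma uniform_ordinal i : uniform (fun M e => ordinal (e i)).
Proof. unfold ordinal; uniform. Qed.
Lemma uniform_ole i j : uniform (fun M e => ole (e i) (e j)).
Proof. unfold ole; uniform. Qed.
#[export] Hint Resolve uniform_is_fun uniform_ordinal uniform_ole : uniform.
Lemma uniform_limit_ordinal i : uniform (fun M e => limit_ordinal (e i)).
Proof. unfold limit_ordinal; uniform. Qed.
#[export] Hint Resolve uniform_limit_ordinal : uniform.
Lemma uniform_is_omega i : uniform (fun M e => is_omega (e i)).
Proof. unfold is_omega; uniform. Qed.
#[export] Hint Resolve uniform_is_omega : uniform.
(** The step relation is a parameter that may depend on the environment. Its formula is renamed to
    the positions where the quantifiers of [ordrec] put its two arguments. *)
Lemma uniform_ordrec (step : ∀ M : SetStr, (nat → M) → M → M → Prop) i j k :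
  uniform (fun M e => step M (fun n => e (S (S n))) (e 1) (e 0)) →
  uniform (fun M e => ordrec (e i) (step M e) (e j) (e k)).
Proof.
intros [p H]; unfold ordrec.
assert (K : ∀ (r : nat → nat) m n,
  uniform (fun M e => step M (fun n => e (r n)) (e m) (e n))).
{ intros r m n.
  exists (ren (fun q => match q with 0 => n | 1 => m | S (S q) => r q end) p).
  intros M e; rewrite sat_ren; apply (H M). }
pose proof (K (fun n => S (S (S (S (S (S n))))))); auto 200 with uniform nocore.
Qed.
Lemma uniform_oadd i j k : uniform (fun M e => oadd (e i) (e j) (e k)).
Proof. apply (uniform_ordrec (step := fun M e => is_succ (V:=M))); uniform. Qed.
#[export] Hint Resolve uniform_oadd : uniform.
Lemma uniform_omul i j k : uniform (fun M e => omul (e i) (e j) (e k)).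
Proof.
apply uniform_ex, uniform_and; [uniform|].
apply (uniform_ordrec (step := fun M e u v => oadd u (e (S i)) v)); uniform.
Qed.
#[export] Hint Resolve uniform_omul : uniform.
Lemma uniform_oexp i j k : uniform (fun M e => oexp (e i) (e j) (e k)).
Proof.
apply uniform_ex, uniform_ex, uniform_and; [uniform|]; apply uniform_and; [uniform|].
apply (uniform_ordrec (step := fun M e u v => omul u (e (S (S i))) v)); uniform.
Qed.
#[export] Hint Resolve uniform_oexp : uniform.
Lemma uniform_cnf i j k l : uniform (fun M e => cnf (e i) (e j) (e k) (e l)).
Proof. unfold cnf; uniform. Qed.
#[export] Hint Resolve uniform_cnf : uniform.
Lemma uniform_coefficient i j k : uniform (fun M e => coefficient (e i) (e j) (e k)).
Proof. unfold coefficient; uniform. Qed.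
#[export] Hint Resolve uniform_coefficient : uniform.
Lemma uniform_natural_sum i j k : uniform (fun M e => natural_sum (e i) (e j) (e k)).
Proof. unfold natural_sum; uniform. Qed.
#[export] Hint Resolve uniform_natural_sum : uniform.
Lemma uniform_cc_ultrafilter i j : uniform (fun M e => cc_ultrafilter (e i) (e j)).
Proof. unfold cc_ultrafilter, ultrafilter, countably_complete; uniform. Qed.
#[export] Hint Resolve uniform_cc_ultrafilter : uniform.
Lemma uniform_Un_on i j : uniform (fun M e => Un_on (e i) (e j)).
Proof. unfold Un_on; uniform. Qed.
#[export] Hint Resolve uniform_Un_on : uniform.
Lemma uniform_Un i : uniform (fun M e => Un (e i)).
Proof. unfold Un; uniform. Qed.
Lemma uniform_ketonen i j : uniform (fun M e => ketonen (e i) (e j)).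
Proof. unfold ketonen; uniform. Qed.
#[export] Hint Resolve uniform_Un uniform_ketonen : uniform.

(** * Uniform notions as definable predicates, and proof search for definability *)

Section UniformDefinable.
Variable V : SetStr.

Lemma uniform_definable1 (P : ∀ M : SetStr, M → Prop) s :
  (∀ i, uniform (fun M e => P M (e i))) →
  definable_term s → definable (fun e => P V (s e)).
Proof.
intros H; apply definable_app1; destruct (H 0) as [p K].
exists p, (fun n => inl n); intros e; symmetry; apply (K V e).
Qed.

Lemma uniform_definable2 (P : ∀ M : SetStr, M → M → Prop) s t :
  (∀ i j, uniform (fun M e => P M (e i) (e j))) →
  definable_term s → definable_term t → definable (fun e => P V (s e) (t e)).
Proof.
intros H; apply definable_app2; destruct (H 0 1) as [p K].
exists p, (fun n => inl n); intros e; symmetry; apply (K V e).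
Qed.

Lemma uniform_definable3 (P : ∀ M : SetStr, M → M → M → Prop) s t u :
  (∀ i j k, uniform (fun M e => P M (e i) (e j) (e k))) →
  definable_term s → definable_term t → definable_term u →
  definable (fun e => P V (s e) (t e) (u e)).
Proof.
intros H; apply definable_app3; destruct (H 0 1 2) as [p K].
exists p, (fun n => inl n); intros e; symmetry; apply (K V e).
Qed.

End UniformDefinable.

Create HintDb definable discriminated.
#[export] Hint Constants Opaque : definable.
#[export] Hint Variables Opaque : definable.
#[export] Hint Resolve definable_mem definable_eq definable_not definable_and definable_or
  definable_imp definable_equiv definable_all definable_ex
  definable_term_var definable_term_const : definable.
#[export] Hint Extern 0 (definable _) => progress cbv beta : definable.
#[export] Hint Extern 0 (definable_term _) => progress cbv beta : definable.

Existing Class ZFC.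

Lemma definable_term_ren (V : SetStr) (t : (nat → V) → V) (r : nat → nat) :
  definable_term t → definable_term (fun e => t (fun n => e (r n))).
Proof. exact (definable_ren (fun n => match n with O => O | S m => S (r m) end)). Qed.

(** Meant for a predicate variable [P] that takes the whole environment as parameters: the formula
    of [P] is reused with its parameters reindexed by [r], as happens whenever a binder is crossed,
    and with a term in the distinguished place. *)
Lemma definable_bind (V : SetStr) (P : (nat → V) → V → Prop) (r : nat → nat) u :
  definable (fun e => P (fun n => e (S n)) (e 0)) → definable_term u →
  definable (fun e => P (fun n => e (r n)) (u e)).
Proof.
intros HP Hu.
refine (definable_subst (t := fun n e => match n with O => u e | S m => e (r m) end) HP _).
intros [|n]; [assumption|apply definable_term_var].
Qed.

Lemma definable_term_bind (V : SetStr) (F : (nat → V) → V → V) (r : nat → nat) u :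
  definable_term (fun e => F (fun n => e (S n)) (e 0)) → definable_term u →
  definable_term (fun e => F (fun n => e (r n)) (u e)).
Proof.
intros HF Hu.
refine (definable_subst (t := fun n e => match n with O => e 0 |
  S O => u (fun n => e (S n)) | S (S m) => e (S (r m)) end) HF _).
intros [|[|n]]; try apply definable_term_var.
now apply (definable_term_ren S).
Qed.

Lemma definable_bind2 (V : SetStr) (P : (nat → V) → V → V → Prop) (r : nat → nat) u v :
  definable (fun e => P (fun n => e (S (S n))) (e 1) (e 0)) →
  definable_term u → definable_term v →
  definable (fun e => P (fun n => e (r n)) (u e) (v e)).
Proof.
intros HP Hu Hv.
refine (definable_subst (t := fun n e => match n with O => v e | S O => u e |
  S (S m) => e (r m) end) HP _).
intros [|[|n]]; try assumption; apply definable_term_var.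
Qed.

Lemma definable_term_bind2 (V : SetStr) (F : (nat → V) → V → V → V) (r : nat → nat) u v :
  definable_term (fun e => F (fun n => e (S (S n))) (e 1) (e 0)) →
  definable_term u → definable_term v →
  definable_term (fun e => F (fun n => e (r n)) (u e) (v e)).
Proof.
intros HF Hu Hv.
refine (definable_subst (t := fun n e => match n with O => e 0 |
  1 => v (fun n => e (S n)) | 2 => u (fun n => e (S n)) | S (S (S m)) => e (S (r m)) end) HF _).
intros [|[|[|n]]]; try apply definable_term_var; now apply (definable_term_ren S).
Qed.

Ltac definable_hyp :=
  match goal with
  | H : definable (fun e => ?P (fun n => e (S (S n))) (e 1) (e 0)) |-
      definable (fun e => ?P (fun n => e (@?r n)) (@?u e) (@?v e)) =>
      apply (definable_bind2 r H)
  | H : definable_term (fun e => ?P (fun n => e (S (S n))) (e 1) (e 0)) |-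
      definable_term (fun e => ?P (fun n => e (@?r n)) (@?u e) (@?v e)) =>
      apply (definable_term_bind2 r H)
  | H : definable_term ?t |- definable_term (fun e => ?t (fun n => e (@?r n))) =>
      exact (definable_term_ren r H)
  | H : definable (fun e => ?P (fun n => e (S n)) (e 0)) |-
      definable (fun e => ?P (fun n => e (@?r n)) (@?u e)) =>
      apply (definable_bind r H)
  | H : definable_term (fun e => ?P (fun n => e (S n)) (e 0)) |-
      definable_term (fun e => ?P (fun n => e (@?r n)) (@?u e)) =>
      apply (definable_term_bind r H)
  | H : definable (fun e => ?P (e 0)) |- definable (fun e => ?P (@?s e)) =>
      apply (definable_app1 H)
  | H : definable (fun e => ?P (e 0) (e 1)) |- definable (fun e => ?P (@?s e) (@?t e)) =>
      apply (definable_app2 H)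
  | H : definable_term (fun e => ?P (e 0)) |- definable_term (fun e => ?P (@?s e)) =>
      apply (definable_term_app1 H)
  | H : definable_term (fun e => ?P (e 0) (e 1)) |-
      definable_term (fun e => ?P (@?s e) (@?t e)) =>
      apply (definable_term_app2 H)
  end.
#[export] Hint Extern 1 (definable _) => definable_hyp : definable.
#[export] Hint Extern 1 (definable_term _) => definable_hyp : definable.
Ltac dfn := intros; cbv beta; solve [typeclasses eauto with definable].

#[export] Hint Extern 0 (definable (fun e => is_empty _)) =>
  apply (uniform_definable1 uniform_is_empty) : definable.
#[export] Hint Extern 0 (definable (fun e => ordinal _)) =>
  apply (uniform_definable1 uniform_ordinal) : definable.
#[export] Hint Extern 0 (definable (fun e => limit_ordinal _)) =>
  apply (uniform_definable1 uniform_limit_ordinal) : definable.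
#[export] Hint Extern 0 (definable (fun e => is_omega _)) =>
  apply (uniform_definable1 uniform_is_omega) : definable.
#[export] Hint Extern 0 (definable (fun e => Un _)) =>
  apply (uniform_definable1 uniform_Un) : definable.
#[export] Hint Extern 0 (definable (fun e => is_fun _ _)) =>
  apply (uniform_definable2 uniform_is_fun) : definable.
#[export] Hint Extern 0 (definable (fun e => ole _ _)) =>
  apply (uniform_definable2 uniform_ole) : definable.
#[export] Hint Extern 0 (definable (fun e => cc_ultrafilter _ _)) =>
  apply (uniform_definable2 uniform_cc_ultrafilter) : definable.
#[export] Hint Extern 0 (definable (fun e => Un_on _ _)) =>
  apply (uniform_definable2 uniform_Un_on) : definable.
#[export] Hint Extern 0 (definable (fun e => ketonen _ _)) =>
  apply (uniform_definable2 uniform_ketonen) : definable.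
#[export] Hint Extern 0 (definable (fun e => is_inter _ _ _)) =>
  apply (uniform_definable3 uniform_is_inter) : definable.
#[export] Hint Extern 0 (definable (fun e => nonempty _)) =>
  apply (uniform_definable1 uniform_nonempty) : definable.
#[export] Hint Extern 0 (definable (fun e => app _ _ _)) =>
  apply (uniform_definable3 uniform_app) : definable.
#[export] Hint Extern 0 (definable (fun e => natural_sum _ _ _)) =>
  apply (uniform_definable3 uniform_natural_sum) : definable.

(** * Set formation *)

Section Terms.
Context {V : SetStr} {hV : ZFC V}.
Implicit Types (a b c d f g x y z : V) (P : V → Prop) (F : V → V).

Lemma ext x y : (∀ z, z ∈ x ↔ z ∈ y) → x = y.
Proof. apply (zfc_extensionality hV). Qed.

Lemma sub_antisym x y : x ⊆ y → y ⊆ x → x = y.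
Proof. intros H K; apply ext; intros z; split; auto. Qed.

Lemma ex_empty : ∃ x : V, is_empty x.
Proof. destruct (zfc_infinity hV) as [_ [[y [H _]] _]]; eauto. Qed.

Definition emp : V := epsilon (match ex_empty with ex_intro _ x _ => inhabits x end) (@is_empty V).

Lemma in_emp x : ¬ x ∈ emp.
Proof. exact (epsilon_spec _ _ ex_empty x). Qed.

Lemma is_empty_emp x : is_empty x ↔ x = emp.
Proof.
split; [|intros ->; exact in_emp].
intros H; apply ext; intros z; split; intros K; [case (H z K)|case (in_emp K)].
Qed.

Lemma nonempty_iff x : nonempty x ↔ x ≠ emp.
Proof.
rewrite <- is_empty_emp; unfold nonempty, is_empty; split; [firstorder|].
intros H; apply NNPP; firstorder.
Qed.

(* The default value makes [the P] definable whenever [P] is. *)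
Definition the P : V :=
  if excluded_middle_informative (exists! x, P x) then epsilon (inhabits emp) P else emp.

Lemma the_spec P : (exists! x, P x) → P (the P).
Proof.
intros H; unfold the; destruct (excluded_middle_informative _) as [K|K]; [|tauto].
apply epsilon_spec; destruct H as [x [H _]]; eauto.
Qed.

Lemma the_eq P x : P x → (∀ y, P y → y = x) → the P = x.
Proof. intros H K; apply K, the_spec; exists x; split; [assumption|firstorder]. Qed.

Lemma definable_the (P : (nat → V) → V → Prop) :
  definable (fun e => P (fun n => e (S n)) (e 0)) → definable_term (fun e => the (P e)).
Proof.
intros H.
apply (@definable_iff V (fun e =>
  (P (fun n => e (S n)) (e 0) ∧ (∀ y, P (fun n => e (S n)) y → y = e 0)) ∨
  (¬ (∃ x, P (fun n => e (S n)) x ∧ (∀ y, P (fun n => e (S n)) y → y = x)) ∧ is_empty (e 0)))).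
- dfn.
- intros e; split.
  + intros [[K L]|[K L]]; [symmetry; now apply the_eq|].
    unfold the; destruct (excluded_middle_informative _) as [[x [H1 H2]]|_].
    * case K; exists x; split; [assumption|]; intros y Hy; symmetry; auto.
    * now apply is_empty_emp.
  + intros ->; destruct (classic (exists! x, P (fun n => e (S n)) x)) as [K|K].
    * left; split; [now apply the_spec|]; intros y Hy.
      destruct K as [x [K1 K2]]; rewrite <- (K2 y Hy); apply K2, the_spec; now exists x.
    * right; split; [|unfold the; destruct (excluded_middle_informative _);
        [contradiction|exact in_emp]].
      intros [x [K1 K2]]; case K; exists x; split; [assumption|]; intros y Hy; symmetry; auto.
Qed.

Lemma definable_emp : definable_term (fun _ => emp).
Proof. apply definable_term_const. Qed.

Lemma the_set P : (∃ b, ∀ z, z ∈ b ↔ P z) → ∀ z, z ∈ the (fun b => ∀ z, z ∈ b ↔ P z) ↔ P z.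
Proof.
intros [b H]; apply the_spec; exists b; split; [assumption|].
intros c K; apply ext; intros z; rewrite H, K; tauto.
Qed.

Definition upair x y := the (fun p => ∀ z, z ∈ p ↔ z = x ∨ z = y).
Lemma in_upair z x y : z ∈ upair x y ↔ z = x ∨ z = y.
Proof. revert z; apply the_set, (zfc_pairing hV). Qed.
Lemma definable_upair s t : definable_term s → definable_term t →
  definable_term (fun e => upair (s e) (t e)).
Proof. intros; apply definable_the; dfn. Qed.

Definition union x := the (fun u => ∀ z, z ∈ u ↔ ∃ y, y ∈ x ∧ z ∈ y).
Lemma in_union z x : z ∈ union x ↔ ∃ y, y ∈ x ∧ z ∈ y.
Proof. revert z; apply the_set, (zfc_union hV). Qed.
Lemma definable_union s : definable_term s → definable_term (fun e => union (s e)).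
Proof. intros; apply definable_the; dfn. Qed.

Definition pow x := the (fun p => ∀ z, z ∈ p ↔ z ⊆ x).
Lemma in_pow z x : z ∈ pow x ↔ z ⊆ x.
Proof. revert z; apply the_set, (zfc_powerset hV). Qed.
Lemma definable_pow s : definable_term s → definable_term (fun e => pow (s e)).
Proof. intros; apply definable_the; dfn. Qed.

Definition sep a P := the (fun b => ∀ z, z ∈ b ↔ z ∈ a ∧ P z).
Lemma in_sep z a P : definable (fun e => P (e 0)) → z ∈ sep a P ↔ z ∈ a ∧ P z.
Proof.
intros [p [T H]]; revert z; apply the_set.
(* [P] reads coordinate 0 only, so all coordinate variables may be identified with the element under
   test. The variables sent to parameters are shifted past it and get their values from [env]. *)
pose (env := fun n => match T n with inl (S m) => emp | inl O => emp | inr c => c end).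
destruct (zfc_separation hV (ren (fun n => match T n with inl _ => O | inr _ => S n end) p) env a)
  as [b K].
exists b; intros z; rewrite K, sat_ren, (H (fun _ => z)).
match goal with |- _ ∧ sat ?e1 p ↔ _ ∧ sat ?e2 p => replace e2 with e1; [tauto|] end.
apply functional_extensionality; intros n; destruct (T n) as [m|c] eqn:E; simpl; auto.
unfold env; now rewrite E.
Qed.
Lemma definable_sep (a : (nat → V) → V) (P : (nat → V) → V → Prop) : definable_term a →
  definable (fun e => P (fun n => e (S n)) (e 0)) → definable_term (fun e => sep (a e) (P e)).
Proof. intros; apply definable_the; dfn. Qed.

Definition repl a F := the (fun b => ∀ y, y ∈ b ↔ ∃ x, x ∈ a ∧ y = F x).
Lemma in_repl y a F : definable_term (fun e => F (e 0)) → y ∈ repl a F ↔ ∃ x, x ∈ a ∧ y = F x.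
Proof.
intros [p [T H]]; revert y; apply the_set.
pose (env := fun n => match T n with inl _ => emp | inr c => c end).
pose (q := ren (fun n => match T n with inl O => 0 | inl _ => 1 | inr _ => S (S n) end) p).
assert (E : ∀ x y, sat (scons y (scons x env)) q ↔ y = F x).
{ intros x y; unfold q; rewrite sat_ren.
  rewrite (H (fun n => match n with O => y | _ => x end)).
  match goal with |- sat ?e1 p ↔ sat ?e2 p => replace e2 with e1; [tauto|] end.
  apply functional_extensionality; intros n; destruct (T n) as [[|m]|c] eqn:E; simpl; auto.
  unfold env; now rewrite E. }
destruct (zfc_replacement hV (phi := q) (env := env) (a := a)) as [b K].
- intros x _ y z; rewrite !E; congruence.
- exists b; intros y; rewrite K; split; intros [x [Hx L]]; exists x; now rewrite E in *.
Qed.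
Lemma definable_repl (a : (nat → V) → V) (F : (nat → V) → V → V) : definable_term a →
  definable_term (fun e => F (fun n => e (S n)) (e 0)) → definable_term (fun e => repl (a e) (F e)).
Proof. intros; apply definable_the; dfn. Qed.

End Terms.

#[export] Hint Resolve definable_the definable_emp definable_upair definable_union definable_pow definable_sep
  definable_repl : definable.

(** * Boolean operations, ordered pairs and functions *)

Section Terms2.
Context {V : SetStr} {hV : ZFC V}.
Implicit Types (a b c d f g x y z : V) (P : V → Prop) (F : V → V).

Definition sing x := upair x x.
Definition cup x y := union (upair x y).
Definition inter x y := sep x (fun z => z ∈ y).
Definition diff x y := sep x (fun z => ¬ z ∈ y).
Definition succ x := cup x (sing x).
Definition opair x y := upair (sing x) (upair x y).
Definition bigcup a F := union (repl a F).
Definition lam a F := repl a (fun x => opair x (F x)).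
Definition ap f x := the (fun y => app f x y).

Lemma definable_sing s : definable_term s → definable_term (fun e => sing (s e)).
Proof. unfold sing; dfn. Qed.
Lemma definable_cup s t : definable_term s → definable_term t →
  definable_term (fun e => cup (s e) (t e)).
Proof. unfold cup; dfn. Qed.
Lemma definable_inter s t : definable_term s → definable_term t →
  definable_term (fun e => inter (s e) (t e)).
Proof. unfold inter; dfn. Qed.
Lemma definable_diff s t : definable_term s → definable_term t →
  definable_term (fun e => diff (s e) (t e)).
Proof. unfold diff; dfn. Qed.
Lemma definable_succ s : definable_term s → definable_term (fun e => succ (s e)).
Proof. unfold succ, cup, sing; dfn. Qed.
Lemma definable_opair s t : definable_term s → definable_term t →
  definable_term (fun e => opair (s e) (t e)).
Proof. unfold opair, sing; dfn. Qed.
Lemma definable_bigcup (a : (nat → V) → V) (F : (nat → V) → V → V) : definable_term a →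
  definable_term (fun e => F (fun n => e (S n)) (e 0)) → definable_term (fun e => bigcup (a e) (F e)).
Proof. unfold bigcup; dfn. Qed.
Lemma definable_ap s t : definable_term s → definable_term t →
  definable_term (fun e => ap (s e) (t e)).
Proof. unfold ap; dfn. Qed.
End Terms2.
#[export] Hint Resolve definable_sing definable_cup definable_inter definable_diff definable_succ
  definable_opair definable_bigcup definable_ap : definable.

Section Sets.
Context {V : SetStr} {hV : ZFC V}.
Implicit Types (a b c d f g x y z : V) (P : V → Prop) (F : V → V).

Lemma definable_lam (a : (nat → V) → V) (F : (nat → V) → V → V) : definable_term a →
  definable_term (fun e => F (fun n => e (S n)) (e 0)) → definable_term (fun e => lam (a e) (F e)).
Proof. unfold lam; dfn. Qed.

Lemma in_sing z x : z ∈ sing x ↔ z = x.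
Proof. unfold sing; rewrite in_upair; tauto. Qed.

Lemma in_cup z x y : z ∈ cup x y ↔ z ∈ x ∨ z ∈ y.
Proof.
unfold cup; rewrite in_union; split.
- intros [u [H K]]; rewrite in_upair in H; destruct H as [-> | ->]; tauto.
- intros [H|H]; [exists x|exists y]; rewrite in_upair; tauto.
Qed.

Lemma in_succ z x : z ∈ succ x ↔ z ∈ x ∨ z = x.
Proof. unfold succ; rewrite in_cup, in_sing; tauto. Qed.

Lemma in_inter z x y : z ∈ inter x y ↔ z ∈ x ∧ z ∈ y.
Proof. unfold inter; rewrite in_sep by dfn; tauto. Qed.

Lemma in_diff z x y : z ∈ diff x y ↔ z ∈ x ∧ ¬ z ∈ y.
Proof. unfold diff; rewrite in_sep by dfn; tauto. Qed.

Lemma in_bigcup z a F : definable_term (fun e => F (e 0)) →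
  z ∈ bigcup a F ↔ ∃ x, x ∈ a ∧ z ∈ F x.
Proof.
intros HF; unfold bigcup; rewrite in_union; split.
- intros [y [H K]]; rewrite in_repl in H by dfn; destruct H as [x [H ->]]; eauto.
- intros [x [H K]]; exists (F x); rewrite in_repl by dfn; eauto.
Qed.

Lemma is_upair_iff x y p : is_upair x y p ↔ p = upair x y.
Proof.
split; [|intros ->; intros z; apply in_upair].
intros H; apply ext; intros z; rewrite (H z), in_upair; tauto.
Qed.

Lemma is_succ_iff x y : is_succ x y ↔ y = succ x.
Proof.
split; [|intros ->; intros z; apply in_succ].
intros H; apply ext; intros z; rewrite (H z), in_succ; tauto.
Qed.

Lemma is_inter_iff x y i : is_inter x y i ↔ i = inter x y.
Proof.
split; [|intros ->; intros z; apply in_inter].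
intros H; apply ext; intros z; rewrite (H z), in_inter; tauto.
Qed.

Lemma is_diff_iff x y i : is_diff x y i ↔ i = diff x y.
Proof.
split; [|intros ->; intros z; apply in_diff].
intros H; apply ext; intros z; rewrite (H z), in_diff; tauto.
Qed.

Lemma is_opair_iff x y p : is_opair x y p ↔ p = opair x y.
Proof.
unfold is_opair, opair, sing; split.
- intros H; apply ext; intros z; rewrite (H z), in_upair, !is_upair_iff; tauto.
- intros -> z; rewrite in_upair, !is_upair_iff; tauto.
Qed.

Lemma opair_inj x y x' y' : opair x y = opair x' y' → x = x' ∧ y = y'.
Proof.
intros H.
assert (K : ∀ z, z = sing x ∨ z = upair x y ↔ z = sing x' ∨ z = upair x' y').
{ intros z; unfold opair in H; rewrite <- !in_upair, H; tauto. }
assert (L : ∀ u v w, sing u = upair v w → u = v ∧ u = w).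
{ intros u v w E; split; symmetry; apply in_sing; rewrite E, in_upair; tauto. }
assert (Lx : x = x').
{ destruct (proj1 (K (sing x)) (or_introl eq_refl)) as [E|E];
    destruct (L _ _ _ E); congruence. }
subst x'; split; [reflexivity|].
assert (Y : ∀ v w, upair x v = upair x w → v = w).
{ intros v w E.
  assert (E1 : v ∈ upair x w) by (rewrite <- E, in_upair; tauto).
  assert (E2 : w ∈ upair x v) by (rewrite E, in_upair; tauto).
  rewrite in_upair in E1, E2; intuition congruence. }
destruct (proj1 (K (upair x y)) (or_intror eq_refl)) as [E|E]; [|auto].
destruct (proj2 (K (upair x y')) (or_intror eq_refl)) as [E'|E']; [|auto].
symmetry in E, E'; destruct (L _ _ _ E), (L _ _ _ E'); congruence.
Qed.

Lemma app_iff f x y : app f x y ↔ opair x y ∈ f.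
Proof.
split; [intros [p [H K]]; rewrite is_opair_iff in H; now subst|].
intros H; exists (opair x y); now rewrite is_opair_iff.
Qed.

Lemma app_ap f d x y : is_fun f d → app f x y ↔ x ∈ d ∧ y = ap f x.
Proof.
intros [_ [H K]].
assert (L : x ∈ d → app f x (ap f x)).
{ intros Hx; apply H in Hx; destruct Hx as [z Hz].
  apply (the_spec (P := fun y => app f x y)).
  exists z; split; [assumption|]; intros w Hw; eapply K; eauto. }
split; [|intros [Hx ->]; auto].
intros A; assert (Hx : x ∈ d) by (apply H; eauto).
split; [assumption|]; eapply K; eauto.
Qed.

Lemma app_lam a F x y : definable_term (fun e => F (e 0)) →
  app (lam a F) x y ↔ x ∈ a ∧ y = F x.
Proof.
intros HF; rewrite app_iff; unfold lam; rewrite in_repl by dfn; split.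
- intros [z [Hz E]]; apply opair_inj in E; destruct E as [-> ->]; auto.
- intros [H ->]; eauto.
Qed.

Lemma is_fun_lam a F : definable_term (fun e => F (e 0)) → is_fun (lam a F) a.
Proof.
intros HF; split; [|split].
- intros p; unfold lam; rewrite in_repl by dfn; intros [x [_ ->]]; exists x, (F x).
  now apply is_opair_iff.
- intros x; split; [intros H; exists (F x); now apply app_lam|].
  intros [y H]; rewrite app_lam in H by dfn; tauto.
- intros x y z; rewrite !app_lam by dfn; intuition congruence.
Qed.

Lemma ap_lam a F x : definable_term (fun e => F (e 0)) → x ∈ a → ap (lam a F) x = F x.
Proof.
intros HF Hx; symmetry; apply (app_ap x (F x) (is_fun_lam a HF)); now apply app_lam.
Qed.

Lemma fun_ext f g d : is_fun f d → is_fun g d → (∀ x, x ∈ d → ap f x = ap g x) → f = g.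
Proof.
intros Hf Hg H.
assert (K : ∀ f g, is_fun f d → is_fun g d → (∀ x, x ∈ d → ap f x = ap g x) → f ⊆ g).
{ clear; intros f g Hf Hg H p Hp.
  destruct (proj1 Hf p Hp) as [x [y E]].
  assert (A : app f x y) by (exists p; auto).
  rewrite (app_ap x y Hf) in A; destruct A as [Hx ->].
  rewrite is_opair_iff in E; subst p; rewrite (H x Hx), <- app_iff.
  now apply (app_ap x _ Hg). }
apply sub_antisym; apply K; auto; intros x Hx; symmetry; auto.
Qed.

Lemma lam_ap f d : is_fun f d → lam d (ap f) = f.
Proof.
intros H; apply (fun_ext (is_fun_lam d (F := ap f) ltac:(dfn)) H).
intros x Hx; now rewrite ap_lam by dfn.
Qed.

Lemma lam_ext a F G : definable_term (fun e => F (e 0)) → definable_term (fun e => G (e 0)) →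
  (∀ x, x ∈ a → F x = G x) → lam a F = lam a G.
Proof.
intros HF HG H; apply (@fun_ext _ _ a); try now apply is_fun_lam.
intros x Hx; rewrite !ap_lam by dfn; auto.
Qed.

Definition fns d t := sep (pow (bigcup d (fun x => repl t (fun y => opair x y)))) (fun f => is_fun f d).

Lemma in_fns f d t : f ∈ fns d t ↔ is_fun f d ∧ ∀ x, x ∈ d → ap f x ∈ t.
Proof.
unfold fns; rewrite in_sep by dfn; rewrite in_pow; split.
- intros [H K]; split; [assumption|]; intros x Hx.
  assert (A : app f x (ap f x)) by now apply (app_ap x _ K).
  apply app_iff, H in A; rewrite in_bigcup in A by dfn; destruct A as [u [_ B]].
  rewrite in_repl in B by dfn; destruct B as [v [Hv E]].
  apply opair_inj in E; destruct E as [_ ->]; assumption.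
- intros [H K]; split; [|assumption]; intros p Hp.
  destruct (proj1 H p Hp) as [x [y E]].
  assert (A : app f x y) by (exists p; auto).
  rewrite (app_ap x y H) in A; destruct A as [Hx ->].
  rewrite is_opair_iff in E; subst p.
  rewrite in_bigcup by dfn; exists x; split; [assumption|].
  rewrite in_repl by dfn; eauto.
Qed.

Lemma mem_irrefl x : ¬ x ∈ x.
Proof.
intros H; destruct (zfc_foundation hV (x := sing x)) as [y [K L]].
- exists x; now apply in_sing.
- apply in_sing in K; subst y; apply (L x H); now apply in_sing.
Qed.

Lemma mem_asym x y : x ∈ y → ¬ y ∈ x.
Proof.
intros H K; destruct (zfc_foundation hV (x := upair x y)) as [z [L M]].
- exists x; apply in_upair; auto.
- apply in_upair in L; destruct L as [-> | ->]; eapply M; eauto; apply in_upair; auto.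
Qed.

Lemma set_min a P : definable (fun e => P (e 0)) → (∃ x, x ∈ a ∧ P x) →
  ∃ x, x ∈ a ∧ P x ∧ ∀ y, y ∈ a → P y → ¬ y ∈ x.
Proof.
intros HP [x [Hx Px]]; destruct (zfc_foundation hV (x := sep a P)) as [y [H K]].
- exists x; now rewrite in_sep.
- rewrite in_sep in H by dfn; exists y; do 2 (split; [tauto|]).
  intros z Hz Pz Hzy; apply (K z Hzy); now rewrite in_sep.
Qed.

(** * Ordinals *)

Lemma ordinal_mem a b : ordinal a → b ∈ a → ordinal b.
Proof.
intros [T L] Hb; split; [|intros y z Hy Hz; apply L; eapply T; eauto].
intros y z Hz Hy.
assert (Hya : y ∈ a) by (eapply T; eauto).
assert (Hza : z ∈ a) by (eapply T; eauto).
destruct (L z b Hza Hb) as [H|[->|H]]; [assumption|case (mem_asym Hy Hz)|].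
destruct (zfc_foundation hV (x := cup (sing b) (upair y z))) as [u [Hu K]].
- exists b; rewrite in_cup, in_sing; auto.
- rewrite in_cup, in_sing, in_upair in Hu; exfalso.
  destruct Hu as [->|[-> | ->]];
    [apply (K y)|apply (K z)|apply (K b)]; rewrite ?in_cup, ?in_sing, ?in_upair; auto.
Qed.

Lemma ordinal_trans a y z : ordinal a → z ∈ y → y ∈ a → z ∈ a.
Proof. intros [T _]; apply T. Qed.

Lemma ordinal_min P : definable (fun e => P (e 0)) → (∃ a, ordinal a ∧ P a) →
  ∃ a, ordinal a ∧ P a ∧ ∀ b, b ∈ a → ¬ P b.
Proof.
intros HP [a [Ha Pa]].
destruct (set_min (a := succ a) (P := P)) as [b [H [K L]]]; [dfn|exists a; rewrite in_succ; auto|].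
assert (Hb : ordinal b) by (rewrite in_succ in H; destruct H as [H| ->]; eauto using ordinal_mem).
exists b; do 2 (split; [assumption|]); intros c Hc Pc; apply (L c); auto.
rewrite in_succ in *; left; destruct H as [H| ->]; eauto using ordinal_trans.
Qed.

Lemma ordinal_ind P : definable (fun e => P (e 0)) →
  (∀ a, ordinal a → (∀ b, b ∈ a → P b) → P a) → ∀ a, ordinal a → P a.
Proof.
intros HP H a Ha; apply NNPP; intros K.
destruct (@ordinal_min (fun a => ¬ P a)) as [b [Hb [K1 K2]]]; [dfn|eauto|].
apply K1, H; [assumption|]; intros c Hc; apply NNPP; intros M; exact (K2 c Hc M).
Qed.

Lemma ordinal_sub a b : ordinal a → ordinal b → a ⊆ b → a ∈ b ∨ a = b.
Proof.
intros Ha Hb H; destruct (classic (a = b)) as [E|E]; [auto|left].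
destruct (set_min (a := b) (P := fun x => ¬ x ∈ a)) as [c [Hc [K L]]]; [dfn| |].
- apply NNPP; intros N; apply E, sub_antisym; [assumption|].
  intros z Hz; apply NNPP; intros M; eauto.
- replace a with c; [assumption|]; apply sub_antisym; intros z Hz.
  + apply NNPP; intros M; apply (L z); auto; eauto using ordinal_trans.
  + destruct (proj2 Hb c z Hc (H z Hz)) as [M|[->|M]]; [|contradiction|assumption].
    case K; eauto using ordinal_trans.
Qed.

Lemma ordinal_total a b : ordinal a → ordinal b → a ∈ b ∨ a = b ∨ b ∈ a.
Proof.
intros Ha Hb.
assert (Hc : ordinal (inter a b)).
{ split; [intros y z Hz Hy; rewrite in_inter in *|intros y z Hy Hz; rewrite in_inter in *].
  - destruct Hy; split; eapply ordinal_trans; [| |apply H| | |apply H0]; assumption.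
  - apply (proj2 Ha); tauto. }
destruct (ordinal_sub Hc Ha) as [H|H]; [intros z Hz; apply in_inter in Hz; tauto| |].
- destruct (ordinal_sub Hc Hb) as [K|K]; [intros z Hz; apply in_inter in Hz; tauto| |].
  + case (@mem_irrefl (inter a b)); now rewrite in_inter.
  + rewrite K in H; auto.
- assert (Hs : a ⊆ b) by (intros z Hz; rewrite <- H, in_inter in Hz; tauto).
  destruct (ordinal_sub Ha Hb Hs); auto.
Qed.

Lemma ordinal_le a b : ordinal a → ordinal b → ¬ b ∈ a → a ⊆ b.
Proof.
intros Ha Hb H; destruct (ordinal_total Ha Hb) as [K|[->|K]]; [|auto|contradiction].
intros z Hz; eauto using ordinal_trans.
Qed.

Lemma ordinal_sub_mem a b c : ordinal c → ordinal a → a ⊆ b → ordinal b → b ∈ c → a ∈ c.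
Proof.
intros Hc Ha H Hb K; destruct (ordinal_sub Ha Hb H) as [L|L]; [|now subst].
eauto using ordinal_trans.
Qed.

Lemma transitive_ordinals a : transitive a → (∀ x, x ∈ a → ordinal x) → ordinal a.
Proof. intros T H; split; [assumption|]; intros y z Hy Hz; apply ordinal_total; auto. Qed.

Lemma ordinal_emp : ordinal emp.
Proof. apply transitive_ordinals; [intros y z _|intros y]; intros H; case (in_emp H). Qed.

Lemma ordinal_succ a : ordinal a → ordinal (succ a).
Proof.
intros Ha; apply transitive_ordinals.
- intros y z Hz Hy; rewrite in_succ in *; destruct Hy as [Hy | ->]; eauto using ordinal_trans.
- intros x; rewrite in_succ; intros [H | ->]; eauto using ordinal_mem.
Qed.

Lemma ordinal_union a : (∀ x, x ∈ a → ordinal x) → ordinal (union a).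
Proof.
intros H; apply transitive_ordinals.
- intros y z Hz Hy; rewrite in_union in *; destruct Hy as [u [Hu Hy]].
  exists u; eauto using ordinal_trans.
- intros x; rewrite in_union; intros [y [Hy Hx]]; eauto using ordinal_mem.
Qed.

Lemma ordinal_bigcup a F : definable_term (fun e => F (e 0)) →
  (∀ x, x ∈ a → ordinal (F x)) → ordinal (bigcup a F).
Proof.
intros HF H; apply ordinal_union; intros x; rewrite in_repl by dfn; intros [y [Hy ->]]; auto.
Qed.

Lemma succ_mem a b : ordinal a → b ∈ a → succ b ∈ a ∨ succ b = a.
Proof.
intros Ha Hb; apply ordinal_sub; eauto using ordinal_succ, ordinal_mem.
intros z; rewrite in_succ; intros [H | ->]; eauto using ordinal_trans.
Qed.

Lemma succ_mem_succ a b : ordinal a → b ∈ a → succ b ∈ succ a.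
Proof. intros Ha Hb; rewrite in_succ; now apply succ_mem. Qed.

Lemma succ_sub a b : ordinal a → ordinal b → a ⊆ b → succ a ⊆ succ b.
Proof.
intros Ha Hb H z; rewrite !in_succ; intros [Hz | ->]; [auto|now apply ordinal_sub].
Qed.

Lemma in_succ_self a : a ∈ succ a.
Proof. rewrite in_succ; auto. Qed.

Lemma succ_ne_emp a : succ a ≠ emp.
Proof. intros H; apply (@in_emp V hV a); rewrite <- H; apply in_succ_self. Qed.

Lemma limit_succ a b : limit_ordinal a → b ∈ a → succ b ∈ a.
Proof.
intros [_ [_ H]] Hb; destruct (H b Hb) as [z [K L]]; rewrite is_succ_iff in K; now subst.
Qed.

Lemma emp_in_ordinal a : ordinal a → a ≠ emp → emp ∈ a.
Proof.
intros Ha H; destruct (ordinal_total ordinal_emp Ha) as [K|[K|K]];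
  [assumption|congruence|case (in_emp K)].
Qed.

Lemma ordinal_cases a : ordinal a →
  a = emp ∨ (∃ b, ordinal b ∧ a = succ b) ∨ limit_ordinal a.
Proof.
intros Ha; destruct (classic (a = emp)) as [E|E]; [auto|right].
destruct (classic (∃ b, ordinal b ∧ a = succ b)) as [K|K]; [auto|right].
split; [assumption|]; split; [now apply nonempty_iff|].
intros b Hb; exists (succ b); rewrite is_succ_iff; split; [reflexivity|].
destruct (succ_mem Ha Hb); [assumption|case K]; eauto using ordinal_mem.
Qed.

Lemma limit_ne_emp a : limit_ordinal a → a ≠ emp.
Proof. intros [_ [H _]]; now apply nonempty_iff. Qed.

Lemma ordinal_ind3 P : definable (fun e => P (e 0)) → P emp →
  (∀ a, ordinal a → P a → P (succ a)) →
  (∀ a, limit_ordinal a → (∀ b, b ∈ a → P b) → P a) → ∀ a, ordinal a → P a.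
Proof.
intros HP H0 HS HL; apply (ordinal_ind HP); intros a Ha IH.
destruct (ordinal_cases Ha) as [->|[[b [Hb ->]]|H]]; auto.
apply HS; [assumption|]; apply IH, in_succ_self.
Qed.

(** * The set of natural numbers *)

Definition omega := the (fun w => is_omega w).

Lemma omega_spec : is_omega omega.
Proof.
apply (the_spec (P := fun w => is_omega w)).
destruct (@ordinal_min (fun x => limit_ordinal x)) as [w [Hw [K L]]]; [dfn| |].
- destruct (zfc_infinity hV) as [x [[y [Hy Hyx]] H]].
  rewrite is_empty_emp in Hy; subst y.
  (* The set given by infinity need not be an ordinal. Its elements that are ordinals and also
     subsets of it do form one, and this ordinal is still closed under successors. *)
  pose (o := sep x (fun z => ordinal z ∧ z ⊆ x)).
  assert (Ho : ∀ z, z ∈ o ↔ z ∈ x ∧ ordinal z ∧ z ⊆ x)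
    by (intros z; unfold o; rewrite in_sep by dfn; tauto).
  exists o; assert (Oo : ordinal o).
  { apply transitive_ordinals; [|intros z; rewrite Ho; tauto].
    intros y z Hz; rewrite !Ho; intros [H1 [H2 H3]]; split; [auto|].
    split; [eauto using ordinal_mem|]; intros u Hu; eauto using ordinal_trans. }
  split; [assumption|]; split; [assumption|]; split.
  + exists emp; rewrite Ho; split; [assumption|]; split; [apply ordinal_emp|].
    intros z Hz; case (in_emp Hz).
  + intros y Hy; rewrite Ho in Hy; destruct Hy as [H1 [H2 H3]].
    destruct (H y H1) as [z [E Hz]]; exists z; split; [assumption|].
    rewrite is_succ_iff in E; subst z; rewrite Ho; split; [assumption|].
    split; [now apply ordinal_succ|]; intros u; rewrite in_succ; intros [Hu | ->]; auto.
- exists w; split; [split; assumption|].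
  intros w' [K' L'].
  destruct (ordinal_total Hw (proj1 K')) as [M|[M|M]]; [|assumption|].
  + case (L' w M K).
  + case (L w' M K').
Qed.

Lemma is_omega_iff w : is_omega w ↔ w = omega.
Proof.
split; [|intros ->; apply omega_spec].
intros [K L]; destruct omega_spec as [K' L'].
destruct (ordinal_total (proj1 K) (proj1 K')) as [M|[M|M]]; [|assumption|].
- case (L' w M K).
- case (L _ M K').
Qed.

Lemma ordinal_omega : ordinal omega.
Proof. apply omega_spec. Qed.
Lemma emp_in_omega : emp ∈ omega.
Proof. apply emp_in_ordinal; [apply ordinal_omega|]; apply limit_ne_emp, omega_spec. Qed.
Lemma succ_in_omega n : n ∈ omega → succ n ∈ omega.
Proof. apply limit_succ, omega_spec. Qed.
Lemma ordinal_nat n : n ∈ omega → ordinal n.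
Proof. apply ordinal_mem, ordinal_omega. Qed.

Lemma nat_cases n : n ∈ omega → n = emp ∨ ∃ m, m ∈ omega ∧ n = succ m.
Proof.
intros Hn; destruct (ordinal_cases (ordinal_nat Hn)) as [H|[[m [Hm ->]]|H]]; [auto| |].
- right; exists m; split; [|reflexivity].
  eapply ordinal_trans; [apply ordinal_omega|apply in_succ_self|assumption].
- case (proj2 omega_spec n Hn H).
Qed.

Lemma nat_ind_set P : definable (fun e => P (e 0)) → P emp →
  (∀ n, n ∈ omega → P n → P (succ n)) → ∀ n, n ∈ omega → P n.
Proof.
intros HP H0 HS n Hn.
apply (@ordinal_ind (fun n => n ∈ omega → P n)); [dfn| |now apply ordinal_nat|assumption].
intros a _ IH Ha; destruct (nat_cases Ha) as [->|[m [Hm ->]]]; [assumption|].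
apply HS; [assumption|]; apply IH; [apply in_succ_self|assumption].
Qed.

End Sets.
#[export] Hint Resolve definable_lam : definable.
Lemma definable_fns (V : SetStr) (hV : ZFC V) (s t : (nat → V) → V) :
  definable_term s → definable_term t → definable_term (fun e => fns (s e) (t e)).
Proof. unfold fns; dfn. Qed.
#[export] Hint Resolve definable_fns : definable.

(** * Recursion *)

Section Recursion.
Context {V : SetStr} {hV : ZFC V}.
Implicit Types (a b c d f g x y z : V) (E : V → V → Prop) (G : V → V → V).

Definition closed_under E c := ∀ y z, y ∈ c → E z y → z ∈ c.
Definition preds E x := the (fun b => ∀ z, z ∈ b ↔ E z x).
Definition is_rec E G c f :=
  closed_under E c ∧ is_fun f c ∧ ∀ x, x ∈ c → ap f x = G x (lam (preds E x) (fun y => ap f y)).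
Definition wfrec E G x := the (fun y => ∃ c f, x ∈ c ∧ is_rec E G c f ∧ y = ap f x).

Lemma definable_wfrec (E : (nat → V) → V → V → Prop) (G : (nat → V) → V → V → V) t :
  definable (fun e => E (fun n => e (S (S n))) (e 1) (e 0)) →
  definable_term (fun e => G (fun n => e (S (S n))) (e 1) (e 0)) →
  definable_term t → definable_term (fun e => wfrec (E e) (G e) (t e)).
Proof. intros; unfold wfrec, is_rec, closed_under, preds; dfn. Qed.

Section Equation.
Variables (E : V → V → Prop) (G : V → V → V).
Hypothesis HE : definable (fun e => E (e 0) (e 1)).
Hypothesis HG : definable_term (fun e => G (e 0) (e 1)).
Hypothesis wf : ∀ a, nonempty a → ∃ x, x ∈ a ∧ ∀ y, y ∈ a → ¬ E y x.
Hypothesis setlike : ∀ x, ∃ c, x ∈ c ∧ closed_under E c.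

Lemma in_preds z x : z ∈ preds E x ↔ E z x.
Proof.
revert z; apply the_set; destruct (setlike x) as [c [Hx Hc]].
exists (sep c (fun z => E z x)); intros z; rewrite in_sep by dfn; split; [tauto|eauto].
Qed.

Lemma is_rec_agree c f c' f' x :
  is_rec E G c f → is_rec E G c' f' → x ∈ c → x ∈ c' → ap f x = ap f' x.
Proof.
intros [C [F R]] [C' [F' R']] Hx Hx'; apply NNPP; intros N.
destruct (@wf (sep (inter c c') (fun x => ap f x ≠ ap f' x))) as [y [Hy K]].
- exists x; rewrite in_sep by dfn; rewrite in_inter; auto.
- rewrite in_sep in Hy by dfn; rewrite in_inter in Hy; destruct Hy as [[H H'] M].
  apply M; rewrite R, R' by assumption; f_equal; unfold preds; apply lam_ext; [dfn|dfn|].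
  intros z Hz; apply in_preds in Hz; apply NNPP; intros M'; apply (K z); [|assumption].
  rewrite in_sep by dfn; rewrite in_inter; eauto.
Qed.

Lemma wfrec_is_rec c f x : is_rec E G c f → x ∈ c → wfrec E G x = ap f x.
Proof.
intros H Hx; apply the_eq; [eauto|].
intros y [c' [f' [Hx' [H' ->]]]]; eapply is_rec_agree; eauto.
Qed.

Lemma definable_preds_fixed s :
  definable_term s → definable_term (fun e => preds E (s e)).
Proof. intros; unfold preds; dfn. Qed.

Lemma definable_wfrec_fixed : definable_term (fun e => wfrec E G (e 0)).
Proof. unfold wfrec, is_rec, closed_under, preds; dfn. Qed.

(** Otherwise take an [E]-minimal failure [y] in a closed set around [x]. The points of that set
    which are already covered form a closed set containing all predecessors of [y]; on it, with [y]
    added, the recursion can be written down explicitly. *)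
Lemma ex_is_rec x : ∃ c f, x ∈ c ∧ is_rec E G c f.
Proof.
pose proof definable_wfrec_fixed as HW; pose proof definable_preds_fixed as HP.
destruct (setlike x) as [c0 [Hx Hc0]]; apply NNPP; intros N.
destruct (@wf (sep c0 (fun x => ¬ ∃ c f, x ∈ c ∧ is_rec E G c f))) as [y [Hy K]].
{ exists x; rewrite in_sep; [auto|unfold is_rec, closed_under; dfn]. }
rewrite in_sep in Hy by (unfold is_rec, closed_under; dfn).
destruct Hy as [Hy M]; apply M.
pose (c1 := sep c0 (fun x => ∃ c f, x ∈ c ∧ is_rec E G c f)).
assert (Hc1 : ∀ z, z ∈ c1 ↔ z ∈ c0 ∧ ∃ c f, z ∈ c ∧ is_rec E G c f).
{ intros z; unfold c1; rewrite in_sep; [tauto|].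
  unfold is_rec, closed_under; dfn. }
assert (P : ∀ z, E z y → z ∈ c1).
{ intros z Hz; rewrite Hc1; split; [eauto|]; apply NNPP; intros Q; apply (K z); [|assumption].
  rewrite in_sep; [split; [eauto|assumption]|].
  unfold is_rec, closed_under; dfn. }
assert (Cl : ∀ u z, u ∈ cup c1 (sing y) → E z u → z ∈ c1).
{ intros u z Hu Hz; rewrite in_cup, in_sing in Hu; destruct Hu as [Hu | ->]; [|auto].
  rewrite Hc1 in *; destruct Hu as [Hu [c [f [H1 H2]]]]; split; [eauto|].
  exists c, f; split; [|assumption]; eapply (proj1 H2); eauto. }
assert (HD : definable_term (fun e => G (e 0) (lam (preds E (e 0)) (fun z => wfrec E G z))))
  by dfn.
assert (W : ∀ u, u ∈ c1 → wfrec E G u = G u (lam (preds E u) (fun z => wfrec E G z))).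
{ intros u Hu; rewrite Hc1 in Hu; destruct Hu as [_ [c [f [H1 H2]]]].
  rewrite (wfrec_is_rec H2 H1), (proj2 (proj2 H2)) by assumption; f_equal.
  apply lam_ext; [dfn|dfn|].
  intros z Hz; apply in_preds in Hz; symmetry; apply (wfrec_is_rec H2).
  eapply (proj1 H2); eauto. }
exists (cup c1 (sing y)),
  (lam (cup c1 (sing y)) (fun u => G u (lam (preds E u) (fun z => wfrec E G z)))).
split; [rewrite in_cup, in_sing; auto|].
split; [intros u z Hu Hz; rewrite in_cup; eauto|]; split; [now apply is_fun_lam|].
intros u Hu; rewrite ap_lam by (auto || dfn); f_equal; apply lam_ext; [dfn|dfn|].
intros z Hz; apply in_preds in Hz.
assert (Hz1 : z ∈ c1) by eauto.
rewrite ap_lam; [now apply W|assumption|rewrite in_cup; auto].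
Qed.

Lemma wfrec_eq x : wfrec E G x = G x (lam (preds E x) (fun y => wfrec E G y)).
Proof.
pose proof definable_wfrec_fixed as HW; pose proof definable_preds_fixed as HP.
destruct (ex_is_rec x) as [c [f [Hx H]]].
rewrite (wfrec_is_rec H Hx), (proj2 (proj2 H)) by assumption; f_equal.
apply lam_ext; [dfn|dfn|].
intros z Hz; apply in_preds in Hz; symmetry; apply (wfrec_is_rec H).
eapply (proj1 H); eauto.
Qed.
End Equation.

(** Recursion on full membership presupposes transitive closures. Membership in ordinals is set-like
    by itself, so it can drive the recursion that constructs them. *)
Lemma ordrec_like_step x : ∃ c, x ∈ c ∧ closed_under (fun y z => y ∈ z ∧ ordinal z) c.
Proof.
destruct (classic (ordinal x)) as [Hx|Hx].
- exists (succ x); split; [apply in_succ_self|]; intros y z Hy [Hz _].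
  rewrite in_succ in *; destruct Hy as [Hy | ->]; eauto using ordinal_trans.
- exists (sing x); rewrite in_sing; split; [reflexivity|].
  intros y z; rewrite in_sing; intros -> [_ H]; contradiction.
Qed.

(** Iterate the union operation along ω, starting with [x]. The empty set is put into [t] to serve
    as a default value when functions are forced to take values in [t]. *)
Lemma ex_transitive_superset x : ∃ t, transitive t ∧ x ⊆ t ∧ emp ∈ t.
Proof.
pose (E := fun y z => y ∈ z ∧ ordinal z).
pose (G := fun n f => cup x (bigcup n (fun m => union (ap f m)))).
assert (HE : definable (fun e => E (e 0) (e 1))) by (unfold E; dfn).
assert (HG : definable_term (fun e => G (e 0) (e 1))) by (unfold G; dfn).
pose proof (definable_wfrec_fixed HE HG) as HW.
pose proof (definable_preds_fixed HE) as HP.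
assert (wf : ∀ a, nonempty a → ∃ x, x ∈ a ∧ ∀ y, y ∈ a → ¬ E y x).
{ intros a Ha; destruct (zfc_foundation hV Ha) as [y [H K]]; exists y.
  split; [assumption|]; intros z Hz [M _]; exact (K z M Hz). }
assert (HT : ∀ n z, ordinal n →
  z ∈ wfrec E G n ↔ z ∈ x ∨ ∃ m, m ∈ n ∧ ∃ u, u ∈ wfrec E G m ∧ z ∈ u).
{ intros n z Hn; rewrite (wfrec_eq HE HG wf ordrec_like_step); unfold G at 1.
  rewrite in_cup, in_bigcup by dfn.
  assert (Q : ∀ m, m ∈ n → ap (lam (preds E n) (fun y => wfrec E G y)) m = wfrec E G m).
  { intros m Hm; apply ap_lam; [assumption|].
    apply (in_preds HE ordrec_like_step); split; assumption. }
  split; (intros [H|[m [Hm H]]]; [auto|right; exists m; split; [assumption|]]).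
  - rewrite Q, in_union in H by assumption; assumption.
  - rewrite Q, in_union by assumption; assumption. }
exists (cup (bigcup omega (fun n => wfrec E G n)) (sing emp)).
assert (Q : ∀ z, z ∈ cup (bigcup omega (fun n => wfrec E G n)) (sing emp) ↔
  z = emp ∨ ∃ n, n ∈ omega ∧ z ∈ wfrec E G n).
{ intros z; rewrite in_cup, in_sing, in_bigcup by dfn; tauto. }
split; [|split].
- intros y z Hz; rewrite !Q; intros [-> | [n [Hn Hy]]]; [case (in_emp Hz)|right].
  exists (succ n); split; [now apply succ_in_omega|].
  rewrite HT by now apply ordinal_succ, ordinal_nat.
  right; exists n; split; [apply in_succ_self|eauto].
- intros z Hz; rewrite Q; right; exists emp; split; [apply emp_in_omega|].
  rewrite HT by apply ordinal_emp; auto.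
- rewrite Q; auto.
Qed.

Lemma mem_setlike x : ∃ c, x ∈ c ∧ closed_under (fun y z => y ∈ z) c.
Proof.
destruct (ex_transitive_superset (sing x)) as [t [H [K _]]]; exists t; split.
- apply K, in_sing; reflexivity.
- intros y z Hy Hz; eauto.
Qed.

Lemma mem_wf a : nonempty a → ∃ x, x ∈ a ∧ ∀ y, y ∈ a → ¬ y ∈ x.
Proof.
intros Ha; destruct (zfc_foundation hV Ha) as [y [H K]]; exists y.
split; [assumption|]; intros z Hz M; exact (K z M Hz).
Qed.

Lemma mem_ind (P : V → Prop) : definable (fun e => P (e 0)) →
  (∀ x, (∀ y, y ∈ x → P y) → P x) → ∀ x, P x.
Proof.
intros HP H x; apply NNPP; intros N; destruct (mem_setlike x) as [c [Hx Hc]].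
destruct (set_min (a := c) (P := fun x => ¬ P x)) as [y [Hy [K L]]]; [dfn|eauto|].
apply K, H; intros z Hz; apply NNPP; intros M; exact (L z (Hc y z Hy Hz) M Hz).
Qed.

Definition memrec G x := wfrec (fun y z => y ∈ z) G x.

Lemma definable_memrec (G : (nat → V) → V → V → V) t :
  definable_term (fun e => G (fun n => e (S (S n))) (e 1) (e 0)) →
  definable_term t → definable_term (fun e => memrec (G e) (t e)).
Proof. intros HG Ht; apply (definable_wfrec (E := fun _ y z => y ∈ z)); dfn. Qed.

Lemma definable_memrec_fixed G t : definable_term (fun e => G (e 0) (e 1)) →
  definable_term t → definable_term (fun e => memrec G (t e)).
Proof. intros HG Ht; apply (definable_memrec (G := fun _ => G)); dfn. Qed.

Lemma memrec_eq G x : definable_term (fun e => G (e 0) (e 1)) →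
  memrec G x = G x (lam x (fun y => memrec G y)).
Proof.
intros HG; unfold memrec at 1; rewrite wfrec_eq; [|dfn|dfn|apply mem_wf|apply mem_setlike].
replace (preds (fun y z => y ∈ z) x) with x; [reflexivity|].
apply ext; intros z; rewrite in_preds; [tauto|dfn|apply mem_setlike].
Qed.

End Recursion.
#[export] Hint Resolve definable_memrec : definable.

(** * Rank, the cumulative hierarchy and forms of choice *)

Section Choice.
Context {V : SetStr} {hV : ZFC V}.
Implicit Types (a b c d f g x y z : V).

Definition rank x := memrec (fun x f => bigcup x (fun y => succ (ap f y))) x.
Lemma definable_rank s : definable_term s → definable_term (fun e => rank (s e)).
Proof. unfold rank; dfn. Qed.

Definition level a := memrec (fun x f => bigcup x (fun y => pow (ap f y))) a.
Lemma definable_level s : definable_term s → definable_term (fun e => level (s e)).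
Proof. unfold level; dfn. Qed.

Hint Resolve definable_rank definable_level : definable.

Lemma in_rank z x : z ∈ rank x ↔ ∃ y, y ∈ x ∧ z ∈ succ (rank y).
Proof.
unfold rank at 1; rewrite memrec_eq by dfn; fold (@rank); rewrite in_bigcup by dfn.
split; intros [y [Hy H]]; exists y; split; auto.
- now rewrite ap_lam in H by (dfn || assumption).
- now rewrite ap_lam by (dfn || assumption).
Qed.

Lemma in_level z a : z ∈ level a ↔ ∃ b, b ∈ a ∧ z ⊆ level b.
Proof.
unfold level at 1; rewrite memrec_eq by dfn; rewrite in_bigcup by dfn.
split; intros [y [Hy H]]; exists y; split; auto.
- rewrite ap_lam in H by (dfn || assumption); now apply in_pow.
- rewrite ap_lam by (dfn || assumption); now apply in_pow.
Qed.

Lemma ordinal_rank x : ordinal (rank x).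
Proof.
apply (@mem_ind _ _ (fun x => ordinal (rank x))); [dfn|]; clear x; intros x IH.
apply transitive_ordinals; intros y; [intros z Hz|]; rewrite in_rank; intros [u [Hu Hy]].
- rewrite in_rank; exists u; split; [assumption|].
  eapply ordinal_trans; eauto using ordinal_succ.
- eapply ordinal_mem; [apply ordinal_succ, (IH u Hu)|assumption].
Qed.

Lemma in_level_rank x : x ∈ level (succ (rank x)).
Proof.
apply (@mem_ind _ _ (fun x => x ∈ level (succ (rank x)))); [dfn|]; clear x; intros x IH.
rewrite in_level; exists (rank x); split; [apply in_succ_self|]; intros y Hy.
specialize (IH y Hy); rewrite in_level in *; destruct IH as [b [Hb H]]; exists b.
split; [|assumption]; rewrite in_rank; eauto.
Qed.

(** Scott's trick: the witnesses for [a] may form a proper class, so only those in the first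
    possible level are kept. Pairing them with [a] makes the resulting sets disjoint, as the axiom
    of choice demands. *)
Lemma choice_fun d (P : V → V → Prop) : definable (fun e => P (e 0) (e 1)) →
  (∀ a, a ∈ d → ∃ y, P a y) → ∃ f, is_fun f d ∧ ∀ a, a ∈ d → P a (ap f a).
Proof.
intros HP H.
pose (r a := the (fun b => (ordinal b ∧ ∃ y, y ∈ level b ∧ P a y) ∧
  ∀ c, c ∈ b → ¬ ∃ y, y ∈ level c ∧ P a y)).
assert (Hr : definable_term (fun e => r (e 0))) by (unfold r; dfn).
assert (Kr : ∀ a, a ∈ d → ∃ y, y ∈ level (r a) ∧ P a y).
{ intros a Ha; apply (@the_spec _ _ (fun b => (ordinal b ∧ ∃ y, y ∈ level b ∧ P a y) ∧
    ∀ c, c ∈ b → ¬ ∃ y, y ∈ level c ∧ P a y)).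
  destruct (@ordinal_min _ _ (fun b => ∃ y, y ∈ level b ∧ P a y)) as [b [Hb [K L]]]; [dfn| |].
  - destruct (H a Ha) as [y Hy]; exists (succ (rank y)).
    split; [apply ordinal_succ, ordinal_rank|]; exists y; split; [apply in_level_rank|assumption].
  - exists b; split; [auto|]; intros b' [[Hb' K'] L'].
    destruct (ordinal_total Hb Hb') as [M|[M|M]]; [|assumption|].
    + case (L' b M K).
    + case (L b' M K'). }
pose (s a := repl (sep (level (r a)) (fun y => P a y)) (fun y => opair a y)).
assert (Hs : definable_term (fun e => s (e 0))) by (unfold s; dfn).
assert (Ks : ∀ a p, p ∈ s a ↔ ∃ y, y ∈ level (r a) ∧ P a y ∧ p = opair a y).
{ intros a p; unfold s; rewrite in_repl by dfn.
  split; intros [y K]; exists y; rewrite in_sep in * by dfn; tauto. }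
destruct (zfc_choice hV (a := repl d s)) as [c Hc].
- intros x; rewrite in_repl by dfn; intros [a [Ha ->]].
  destruct (Kr a Ha) as [y [K L]]; exists (opair a y); apply Ks; eauto.
- intros x y; rewrite !in_repl by dfn; intros [a [Ha ->]] [b [Hb ->]] [z [K L]].
  rewrite Ks in *; destruct K as [u [_ [_ ->]]], L as [v [_ [_ E]]].
  apply opair_inj in E; destruct E as [-> _]; reflexivity.
- exists (lam d (fun a => the (fun y => opair a y ∈ s a ∧ opair a y ∈ c))).
  split; [apply is_fun_lam; dfn|]; intros a Ha; rewrite ap_lam by (dfn || assumption).
  destruct (Hc (s a)) as [z [[K L] M]]; [rewrite in_repl by dfn; eauto|].
  rewrite Ks in K; destruct K as [y [K [Hy ->]]].
  rewrite (@the_eq _ _ (fun y => opair a y ∈ s a ∧ opair a y ∈ c) y); [assumption| |].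
  + split; [apply Ks; eauto|assumption].
  + intros u Hu; apply M in Hu; apply opair_inj in Hu; destruct Hu; congruence.
Qed.

Lemma union_succ a : ordinal a → union (succ a) = a.
Proof.
intros Ha; apply ext; intros z; rewrite in_union; split.
- intros [y [Hy Hz]]; rewrite in_succ in Hy; destruct Hy as [Hy | ->]; eauto using ordinal_trans.
- intros Hz; exists a; split; [apply in_succ_self|assumption].
Qed.

Lemma nat_rec_fun x0 (F : V → V) : definable_term (fun e => F (e 0)) →
  ∃ f, is_fun f omega ∧ ap f emp = x0 ∧ ∀ n, n ∈ omega → ap f (succ n) = F (ap f n).
Proof.
intros HF.
(* For a successor, [union n] is the predecessor. *)
pose (G := fun n f => the (fun y => (n = emp ∧ y = x0) ∨ (n ≠ emp ∧ y = F (ap f (union n))))).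
assert (HG : definable_term (fun e => G (e 0) (e 1))) by (unfold G; dfn).
assert (HR : ∀ s, definable_term s → definable_term (fun e => memrec G (s e))).
{ intros s Hs; now apply definable_memrec_fixed. }
exists (lam omega (fun n => memrec G n)); split; [apply is_fun_lam; dfn|]; split.
- rewrite ap_lam, memrec_eq by (dfn || apply emp_in_omega); apply the_eq; [auto|].
  intros y [[_ K]|[K _]]; congruence.
- intros n Hn; rewrite ap_lam by (dfn || now apply succ_in_omega).
  rewrite (memrec_eq (succ n) HG).
  assert (E : ap (lam (succ n) (fun y => memrec G y)) (union (succ n)) = memrec G n).
  { rewrite union_succ by now apply ordinal_nat.
    apply ap_lam; [dfn|apply in_succ_self]. }
  apply the_eq.
  + right; split; [apply succ_ne_emp|].
    now rewrite E, ap_lam by (dfn || assumption).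
  + intros y [[K _]|[_ K]]; [case (succ_ne_emp K)|].
    now rewrite K, E, ap_lam by (dfn || assumption).
Qed.

Lemma dependent_choice a (R : V → V → Prop) : definable (fun e => R (e 0) (e 1)) →
  nonempty a → (∀ x, x ∈ a → ∃ y, y ∈ a ∧ R y x) →
  ∃ f, is_fun f omega ∧ (∀ n, n ∈ omega → ap f n ∈ a) ∧
    ∀ n, n ∈ omega → R (ap f (succ n)) (ap f n).
Proof.
intros HR [x0 Hx0] H.
destruct (@choice_fun a (fun x y => y ∈ a ∧ R y x)) as [c [_ Hc]]; [dfn|auto|].
destruct (@nat_rec_fun x0 (fun x => ap c x)) as [f [Hf [f0 fS]]]; [dfn|].
assert (K : ∀ n, n ∈ omega → ap f n ∈ a).
{ apply nat_ind_set; [dfn|now rewrite f0|]; intros n Hn IH; rewrite fS by assumption.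
  now apply Hc. }
exists f; split; [assumption|]; split; [assumption|].
intros n Hn; rewrite fS by assumption; apply Hc; auto.
Qed.

End Choice.
#[export] Hint Resolve definable_rank definable_level : definable.

(** * Ordinal arithmetic *)

Section Arithmetic.
Context {V : SetStr} {hV : ZFC V}.
Implicit Types (a b c d f g h k l m n p q r x y z : V).

(* Tarski's recursions are valid for arbitrary sets, and the algebraic laws
   follow from them by ∈-induction without any case distinction. *)
Definition add a b := memrec (fun b f => cup a (repl b (fun y => ap f y))) b.
Lemma definable_add s t : definable_term s → definable_term t →
  definable_term (fun e => add (s e) (t e)).
Proof. unfold add; dfn. Qed.
Hint Resolve definable_add : definable.

Definition mul a b := memrec (fun b f => bigcup b (fun y => repl a (fun z => add (ap f y) z))) b.
Lemma definable_mul s t : definable_term s → definable_term t →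
  definable_term (fun e => mul (s e) (t e)).
Proof. unfold mul; dfn. Qed.
Hint Resolve definable_mul : definable.

(** This is [ω^a]. The element 0 provides [ω^0 = 1] and is absorbed at all later stages, so zero,
    successors and limits share one equation. *)
Definition wexp a := memrec (fun a f => cup (sing emp) (bigcup a (fun y => mul (ap f y) omega))) a.
Lemma definable_wexp s : definable_term s → definable_term (fun e => wexp (s e)).
Proof. unfold wexp; dfn. Qed.
Hint Resolve definable_wexp : definable.

Lemma in_add x a b : x ∈ add a b ↔ x ∈ a ∨ ∃ y, y ∈ b ∧ x = add a y.
Proof.
unfold add at 1; rewrite memrec_eq by dfn; rewrite in_cup, in_repl by dfn.
split; (intros [H|[y [Hy H]]]; [auto|right; exists y; split; [assumption|]]).
- now rewrite ap_lam in H by (dfn || assumption).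
- now rewrite ap_lam by (dfn || assumption).
Qed.

Lemma in_mul x a b : x ∈ mul a b ↔ ∃ y z, y ∈ b ∧ z ∈ a ∧ x = add (mul a y) z.
Proof.
unfold mul at 1; rewrite memrec_eq by dfn; rewrite in_bigcup by dfn.
split.
- intros [y [Hy H]]; rewrite in_repl in H by dfn; destruct H as [z [Hz ->]].
  exists y, z; now rewrite ap_lam by (dfn || assumption).
- intros [y [z [Hy [Hz ->]]]]; exists y; split; [assumption|].
  rewrite in_repl by dfn; exists z; now rewrite ap_lam by (dfn || assumption).
Qed.

Lemma in_wexp x a : x ∈ wexp a ↔ x = emp ∨ ∃ y, y ∈ a ∧ x ∈ mul (wexp y) omega.
Proof.
unfold wexp at 1; rewrite memrec_eq by dfn; rewrite in_cup, in_sing, in_bigcup by dfn.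
split; (intros [H|[y [Hy H]]]; [auto|right; exists y; split; [assumption|]]).
- now rewrite ap_lam in H by (dfn || assumption).
- now rewrite ap_lam by (dfn || assumption).
Qed.

Lemma add_emp a : add a emp = a.
Proof.
apply ext; intros x; rewrite in_add; split; [|auto].
intros [H|[y [Hy _]]]; [assumption|case (in_emp Hy)].
Qed.

Lemma mul_emp a : mul a emp = emp.
Proof.
apply ext; intros x; rewrite in_mul; split; [|intros H; case (in_emp H)].
intros [y [z [Hy _]]]; case (in_emp Hy).
Qed.

Lemma emp_add a : add emp a = a.
Proof.
apply (@mem_ind _ _ (fun a => add emp a = a)); [dfn|]; clear a; intros a IH.
apply ext; intros x; rewrite in_add; split.
- intros [H|[y [Hy ->]]]; [case (in_emp H)|now rewrite IH].
- intros H; right; exists x; now rewrite IH.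
Qed.

Lemma add_succ a b : add a (succ b) = succ (add a b).
Proof.
apply ext; intros x; rewrite in_succ, !in_add; split.
- intros [H|[y [Hy ->]]]; [auto|]; rewrite in_succ in Hy; destruct Hy as [Hy | ->]; eauto.
- intros [[H|[y [Hy ->]]] | ->]; [auto| |]; right; eexists; split; eauto; rewrite in_succ; auto.
Qed.

Lemma mul_succ a b : mul a (succ b) = add (mul a b) a.
Proof.
apply ext; intros x; rewrite in_add, !in_mul; split.
- intros [y [z [Hy [Hz ->]]]]; rewrite in_succ in Hy; destruct Hy as [Hy | ->]; eauto 6.
- intros [[y [z [Hy [Hz ->]]]]|[z [Hz ->]]]; [exists y, z|exists b, z]; rewrite in_succ; auto.
Qed.

Lemma add_assoc a b c : add a (add b c) = add (add a b) c.
Proof.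
apply (@mem_ind _ _ (fun c => add a (add b c) = add (add a b) c)); [dfn|].
clear c; intros c IH; apply ext; intros x; rewrite (in_add _ a), (in_add _ (add a b)); split.
- intros [H|[y [Hy ->]]]; [left; apply in_add; auto|].
  rewrite in_add in Hy; destruct Hy as [Hy|[z [Hz ->]]].
  + left; apply in_add; eauto.
  + right; exists z; auto.
- intros [H|[z [Hz ->]]].
  + rewrite in_add in H; destruct H as [H|[y [Hy ->]]]; [auto|].
    right; exists y; split; [apply in_add; auto|reflexivity].
  + right; exists (add b z); split; [apply in_add; eauto|symmetry; auto].
Qed.

Lemma mul_add a b c : mul a (add b c) = add (mul a b) (mul a c).
Proof.
apply (@mem_ind _ _ (fun c => mul a (add b c) = add (mul a b) (mul a c))); [dfn|].
clear c; intros c IH; apply ext; intros x; rewrite in_mul, in_add; split.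
- intros [y [z [Hy [Hz ->]]]]; rewrite in_add in Hy; destruct Hy as [Hy|[u [Hu ->]]].
  + left; apply in_mul; eauto.
  + right; exists (add (mul a u) z); split; [apply in_mul; eauto|].
    now rewrite IH, add_assoc.
- intros [H|[u [Hu ->]]].
  + rewrite in_mul in H; destruct H as [y [z [Hy [Hz ->]]]].
    exists y, z; split; [apply in_add; auto|auto].
  + rewrite in_mul in Hu; destruct Hu as [y [z [Hy [Hz ->]]]].
    exists (add b y), z; split; [apply in_add; eauto|]; split; [assumption|].
    now rewrite IH, add_assoc.
Qed.

Lemma mul_assoc a b c : mul a (mul b c) = mul (mul a b) c.
Proof.
apply (@mem_ind _ _ (fun c => mul a (mul b c) = mul (mul a b) c)); [dfn|].
clear c; intros c IH; apply ext; intros x; rewrite !in_mul; split.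
- intros [y [z [Hy [Hz ->]]]]; rewrite in_mul in Hy; destruct Hy as [u [v [Hu [Hv ->]]]].
  exists u, (add (mul a v) z); split; [assumption|]; split; [apply in_mul; eauto|].
  now rewrite mul_add, IH, add_assoc.
- intros [u [w [Hu [Hw ->]]]]; rewrite in_mul in Hw; destruct Hw as [v [z [Hv [Hz ->]]]].
  exists (add (mul b u) v), z; split; [apply in_mul; eauto|]; split; [assumption|].
  now rewrite mul_add, IH, add_assoc.
Qed.

Lemma wexp_add a b : wexp (add a b) = mul (wexp a) (wexp b).
Proof.
apply (@mem_ind _ _ (fun b => wexp (add a b) = mul (wexp a) (wexp b))); [dfn|].
clear b; intros b IH; apply ext; intros x; split.
- rewrite in_wexp; intros H; rewrite in_mul.
  assert (K : x ∈ wexp a → ∃ y z, y ∈ wexp b ∧ z ∈ wexp a ∧ x = add (mul (wexp a) y) z).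
  { intros Hx; exists emp, x; split; [apply in_wexp; auto|]; now rewrite mul_emp, emp_add. }
  destruct H as [->|[y [Hy H]]]; [apply K, in_wexp; auto|].
  rewrite in_add in Hy; destruct Hy as [Hy|[z [Hz ->]]]; [apply K, in_wexp; eauto|].
  rewrite IH, <- mul_assoc, in_mul in H by assumption.
  destruct H as [u [v [Hu [Hv ->]]]]; exists u, v; split; [apply in_wexp|]; eauto.
- rewrite in_mul; intros [y [z [Hy [Hz ->]]]]; rewrite in_wexp in Hy.
  destruct Hy as [->|[u [Hu Hy]]].
  + rewrite mul_emp, emp_add, in_wexp; rewrite in_wexp in Hz.
    destruct Hz as [H|[u [Hu H]]]; [auto|right; exists u; rewrite in_add; auto].
  + apply in_wexp; right; exists (add a u); split; [apply in_add; eauto|].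
    rewrite IH, <- mul_assoc, in_mul by assumption; eauto.
Qed.

Lemma mul_one a : mul a (succ emp) = a.
Proof. now rewrite mul_succ, mul_emp, emp_add. Qed.

Lemma ordinal_add a b : ordinal a → ordinal b → ordinal (add a b).
Proof.
intros Ha; apply (@ordinal_ind _ _ (fun b => ordinal (add a b))); [dfn|].
clear b; intros b Hb IH; apply transitive_ordinals.
- intros x z Hz; rewrite !in_add; intros [Hx|[y [Hy ->]]]; [eauto using ordinal_trans|].
  rewrite in_add in Hz; destruct Hz as [Hz|[u [Hu ->]]]; eauto using ordinal_trans.
- intros x; rewrite in_add; intros [Hx|[y [Hy ->]]]; eauto using ordinal_mem.
Qed.

Lemma ordinal_mul a b : ordinal a → ordinal b → ordinal (mul a b).
Proof.
intros Ha; apply (@ordinal_ind _ _ (fun b => ordinal (mul a b))); [dfn|].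
clear b; intros b Hb IH; apply transitive_ordinals.
- intros x w Hw; rewrite !in_mul; intros [y [z [Hy [Hz ->]]]].
  rewrite in_add in Hw; destruct Hw as [Hw|[u [Hu ->]]].
  + rewrite in_mul in Hw; destruct Hw as [y' [z' [Hy' [Hz' ->]]]].
    exists y', z'; eauto using ordinal_trans.
  + exists y, u; eauto using ordinal_trans.
- intros x; rewrite in_mul; intros [y [z [Hy [Hz ->]]]].
  apply ordinal_add; eauto using ordinal_mem.
Qed.

Lemma ordinal_wexp a : ordinal a → ordinal (wexp a).
Proof.
apply (@ordinal_ind _ _ (fun a => ordinal (wexp a))); [dfn|].
clear a; intros a Ha IH; apply transitive_ordinals.
- intros x z Hz; rewrite !in_wexp; intros [->|[y [Hy Hx]]]; [case (in_emp Hz)|].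
  right; exists y; split; [assumption|].
  eapply ordinal_trans; eauto using ordinal_mul, ordinal_omega.
- intros x; rewrite in_wexp; intros [->|[y [Hy Hx]]]; [apply ordinal_emp|].
  eapply ordinal_mem; [|exact Hx]; eauto using ordinal_mul, ordinal_omega.
Qed.

Lemma add_lt a b b' : b ∈ b' → add a b ∈ add a b'.
Proof. intros H; apply in_add; eauto. Qed.

Lemma add_sub_l a a' b : ordinal a → ordinal a' → ordinal b → a ⊆ a' → add a b ⊆ add a' b.
Proof.
intros Ha Ha' Hb H; revert b Hb.
apply (@ordinal_ind _ _ (fun b => add a b ⊆ add a' b)); [dfn|].
intros b Hb IH x; rewrite in_add; intros [Hx|[y [Hy ->]]]; [apply in_add; auto|].
assert (Oy : ordinal y) by eauto using ordinal_mem.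
apply (@ordinal_sub_mem _ _ (add a y) (add a' y)); auto using ordinal_add, add_lt.
Qed.

Lemma sub_add_r a b : ordinal a → ordinal b → b ⊆ add a b.
Proof.
intros Ha Hb z Hz; rewrite <- (emp_add b) in Hz; revert z Hz.
apply add_sub_l; auto using ordinal_emp; intros z Hz; case (in_emp Hz).
Qed.

Lemma sub_add_l a b : a ⊆ add a b.
Proof. intros x Hx; apply in_add; auto. Qed.

Lemma ex_add a b : ordinal a → ordinal b → a ⊆ b → ∃ c, ordinal c ∧ b = add a c.
Proof.
intros Ha Hb H.
assert (K : b ∈ add a (succ b)).
{ rewrite add_succ, in_succ; destruct (ordinal_sub Hb (ordinal_add Ha Hb)); auto.
  now apply sub_add_r. }
rewrite in_add in K; destruct K as [K|[y [Hy E]]]; [case (mem_irrefl (H b K))|].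
exists y; split; [|assumption]; eapply ordinal_mem; [apply (ordinal_succ Hb)|assumption].
Qed.

Lemma mul_lt a b b' : emp ∈ a → b ∈ b' → mul a b ∈ mul a b'.
Proof. intros Ha H; apply in_mul; exists b, emp; rewrite add_emp; auto. Qed.

(** The elements of [mul a (succ x)] are by definition the [a·q + r] with [r] in [a]. So it suffices
    that [x] belongs to this product, which follows from [x ≤ a·x]. *)
Lemma division a x : ordinal a → emp ∈ a → ordinal x →
  ∃ q r, ordinal q ∧ r ∈ a ∧ x = add (mul a q) r.
Proof.
intros Ha H0 Hx.
assert (K : x ⊆ mul a x).
{ revert x Hx; apply (@ordinal_ind _ _ (fun x => x ⊆ mul a x)); [dfn|].
  intros x Hx IH y Hy.
  assert (Oy : ordinal y) by eauto using ordinal_mem.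
  apply (@ordinal_sub_mem _ _ y (mul a y)); auto using ordinal_mul, mul_lt. }
assert (L : x ∈ mul a (succ x)).
{ rewrite mul_succ, in_add; destruct (ordinal_sub Hx (ordinal_mul Ha Hx) K) as [M|M]; [auto|].
  right; exists emp; now rewrite add_emp. }
rewrite in_mul in L; destruct L as [q [r [Hq [Hr E]]]]; exists q, r; split; [|auto].
eapply ordinal_mem; [apply (ordinal_succ Hx)|assumption].
Qed.

Lemma division_lt a q r q' r' : r ∈ a → q ∈ q' → add (mul a q) r ∈ add (mul a q') r'.
Proof. intros Hr Hq; apply in_add; left; apply in_mul; eauto. Qed.

Lemma division_unique a q r q' r' : ordinal a → ordinal q → ordinal q' → r ∈ a → r' ∈ a →
  add (mul a q) r = add (mul a q') r' → q = q' ∧ r = r'.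
Proof.
intros Ha Hq Hq' Hr Hr' E.
assert (Q : q = q').
{ destruct (ordinal_total Hq Hq') as [H|[H|H]]; [exfalso|assumption|exfalso].
  - apply (division_lt r' Hr) in H; rewrite E in H; exact (mem_irrefl H).
  - apply (division_lt r Hr') in H; rewrite E in H; exact (mem_irrefl H). }
subst q'; split; [reflexivity|].
destruct (@ordinal_total _ _ r r') as [H|[H|H]]; eauto using ordinal_mem; exfalso.
- apply (add_lt (mul a q)) in H; rewrite E in H; exact (mem_irrefl H).
- apply (add_lt (mul a q)) in H; rewrite E in H; exact (mem_irrefl H).
Qed.

Lemma emp_in_wexp a : emp ∈ wexp a.
Proof. apply in_wexp; auto. Qed.

Lemma wexp_sub a b : a ⊆ b → wexp a ⊆ wexp b.
Proof. intros H x; rewrite !in_wexp; intros [K|[y [Hy K]]]; eauto. Qed.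

Lemma wexp_succ a : wexp (succ a) = mul (wexp a) omega.
Proof.
apply ext; intros x; rewrite in_wexp; split; [|right; exists a; auto using in_succ_self].
assert (K : x ∈ wexp a → x ∈ mul (wexp a) omega).
{ intros H; apply in_mul; exists emp, x; rewrite mul_emp, emp_add; auto using emp_in_omega. }
intros [->|[y [Hy H]]]; [apply K, emp_in_wexp|].
rewrite in_succ in Hy; destruct Hy as [Hy | ->]; [apply K, in_wexp; eauto|assumption].
Qed.

Lemma wexp_emp x : x ∈ wexp emp ↔ x = emp.
Proof.
rewrite in_wexp; split; [|auto]; intros [H|[y [Hy _]]]; [assumption|case (in_emp Hy)].
Qed.

Lemma wexp_limit a x : limit_ordinal a → x ∈ wexp a ↔ ∃ y, y ∈ a ∧ x ∈ wexp y.
Proof.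
intros Ha; split.
- rewrite in_wexp; intros [->|[y [Hy H]]].
  + exists emp; split; [|apply emp_in_wexp].
    apply emp_in_ordinal; [apply Ha|now apply limit_ne_emp].
  + exists (succ y); rewrite wexp_succ; auto using limit_succ.
- intros [y [Hy H]]; revert x H; apply wexp_sub; intros z Hz.
  eapply ordinal_trans; [apply Ha|exact Hz|exact Hy].
Qed.

Lemma wexp_mul_nat a k : k ∈ omega → mul (wexp a) k ∈ wexp (succ a).
Proof. intros Hk; rewrite wexp_succ; auto using mul_lt, emp_in_wexp. Qed.

Lemma in_wexp_succ x a : x ∈ wexp (succ a) ↔
  ∃ k r, k ∈ omega ∧ r ∈ wexp a ∧ x = add (mul (wexp a) k) r.
Proof. rewrite wexp_succ, in_mul; tauto. Qed.

Lemma sub_wexp a : ordinal a → a ⊆ wexp a.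
Proof.
apply (@ordinal_ind _ _ (fun a => a ⊆ wexp a)); [dfn|].
clear a; intros a Ha IH b Hb.
assert (Ob : ordinal b) by eauto using ordinal_mem.
apply (@ordinal_sub_mem _ _ b (wexp b)); auto using ordinal_wexp.
apply in_wexp; right; exists b; split; [assumption|].
rewrite <- (mul_one (wexp b)) at 1.
apply mul_lt; auto using emp_in_wexp, succ_in_omega, emp_in_omega.
Qed.

(** Every ordinal lies below some power of [ω]; this lets facts about coefficients be proved by
    induction on the exponent of such a power. *)
Lemma in_wexp_self_succ a : ordinal a → a ∈ wexp (succ a).
Proof. intros Ha; apply (sub_wexp (ordinal_succ Ha)), in_succ_self. Qed.

Lemma nat_add k l : k ∈ omega → l ∈ omega → add k l ∈ omega.
Proof.
intros Hk; revert l; apply nat_ind_set; [dfn|now rewrite add_emp|].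
intros l Hl IH; rewrite add_succ; now apply succ_in_omega.
Qed.

Lemma nat_succ_add k l : k ∈ omega → l ∈ omega → add (succ k) l = succ (add k l).
Proof.
intros Hk; revert l; apply nat_ind_set; [dfn|now rewrite !add_emp|].
intros l Hl IH; now rewrite !add_succ, IH.
Qed.

Lemma nat_add_comm k l : k ∈ omega → l ∈ omega → add k l = add l k.
Proof.
intros Hk; revert l; apply nat_ind_set; [dfn|now rewrite add_emp, emp_add|].
intros l Hl IH; now rewrite add_succ, nat_succ_add, IH.
Qed.

(** Additive indecomposability of powers of [ω]. At a successor, both summands lie below finite
    multiples of [ω^a], and finite multiples add up to finite multiples. *)
Lemma wexp_closed_add a r s : ordinal a → r ∈ wexp a → s ∈ wexp a → add r s ∈ wexp a.
Proof.
intros Ha; revert r s; revert a Ha.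
apply (@ordinal_ind3 _ _ (fun a => ∀ r s, r ∈ wexp a → s ∈ wexp a → add r s ∈ wexp a)); [dfn| | |].
- intros r s Hr Hs; rewrite wexp_emp in *; subst; now rewrite add_emp.
- intros a Ha _ r s Hr Hs.
  assert (Or : ordinal r) by eauto using ordinal_mem, ordinal_wexp, ordinal_succ.
  assert (Os : ordinal s) by eauto using ordinal_mem, ordinal_wexp, ordinal_succ.
  rewrite in_wexp_succ in Hr, Hs.
  destruct Hr as [k [z [Hk [Hz Er]]]], Hs as [l [z' [Hl [Hz' Es]]]].
  pose proof (ordinal_wexp Ha) as OE.
  assert (Ok : ordinal (mul (wexp a) (succ k))) by eauto using ordinal_mul, ordinal_succ, ordinal_nat.
  assert (L : r ∈ mul (wexp a) (succ k)) by (rewrite mul_succ, Er; now apply add_lt).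
  assert (L' : s ∈ mul (wexp a) (succ l)) by (rewrite mul_succ, Es; now apply add_lt).
  apply (@ordinal_sub_mem _ _ (add r s) (add (mul (wexp a) (succ k)) s));
    auto using ordinal_add, ordinal_wexp, ordinal_succ.
  + apply add_sub_l; auto; intros u Hu; eauto using ordinal_trans.
  + eapply ordinal_trans; [auto using ordinal_wexp, ordinal_succ|exact (add_lt _ L')|].
    rewrite <- mul_add; apply wexp_mul_nat; auto using nat_add, succ_in_omega.
- intros a Ha IH r s; rewrite !(wexp_limit _ Ha); intros [y [Hy Hr]] [z [Hz Hs]].
  assert (Oy : ordinal y) by (eapply ordinal_mem; [apply Ha|assumption]).
  assert (Oz : ordinal z) by (eapply ordinal_mem; [apply Ha|assumption]).
  destruct (classic (z ∈ y)) as [C|C].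
  + exists y; split; [assumption|]; apply IH; auto.
    revert s Hs; apply wexp_sub; intros u Hu; eauto using ordinal_trans.
  + exists z; split; [assumption|]; apply IH; auto.
    revert r Hr; apply wexp_sub; now apply ordinal_le.
Qed.

(** * Coefficients of the Cantor normal form *)

(** The remainder [r] collects the terms with exponents below [g]. Those with exponents above [g]
    contribute a multiple of [ω] to the quotient by [ω^g], so the remainder of that quotient modulo
    [ω] is the coefficient. *)
Definition has_coef a g k := ∃ q r, ordinal q ∧ k ∈ omega ∧ r ∈ wexp g ∧
  a = add (mul (wexp g) (add (mul omega q) k)) r.
Definition coef a g := the (fun k => has_coef a g k).
Lemma definable_coef s t : definable_term s → definable_term t →
  definable_term (fun e => coef (s e) (t e)).
Proof. unfold coef, has_coef; dfn. Qed.
Hint Resolve definable_coef : definable.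

Lemma coef_eq a g k : ordinal g → has_coef a g k → coef a g = k.
Proof.
intros Hg H; apply the_eq; [assumption|]; intros k' H'.
destruct H as [q [r [Hq [Hk [Hr E]]]]], H' as [q' [r' [Hq' [Hk' [Hr' E']]]]].
subst a; apply division_unique in E';
  eauto using ordinal_wexp, ordinal_add, ordinal_mul, ordinal_omega, ordinal_nat.
destruct E' as [E' _]; apply division_unique in E'; auto using ordinal_omega.
now destruct E'.
Qed.

Lemma coef_spec a g : ordinal a → ordinal g → has_coef a g (coef a g).
Proof.
intros Ha Hg.
destruct (@division (wexp g) a) as [q [r [Hq [Hr E]]]]; auto using ordinal_wexp, emp_in_wexp.
destruct (@division omega q) as [q' [k [Hq' [Hk E']]]]; auto using ordinal_omega, emp_in_omega.
assert (H : has_coef a g k) by (exists q', r; subst; auto).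
now rewrite (coef_eq Hg H).
Qed.

Lemma coef_nat a g : ordinal a → ordinal g → coef a g ∈ omega.
Proof. intros Ha Hg; destruct (coef_spec Ha Hg) as [q [r H]]; tauto. Qed.

Lemma coef_small a g : ordinal g → a ∈ wexp g → coef a g = emp.
Proof.
intros Hg Ha; apply coef_eq; [assumption|]; exists emp, a.
rewrite mul_emp, add_emp, mul_emp, emp_add; auto using ordinal_emp, emp_in_omega.
Qed.

Lemma coef_lead_eq g k a : ordinal g → k ∈ omega → a ∈ wexp g →
  coef (add (mul (wexp g) k) a) g = k.
Proof.
intros Hg Hk Ha; apply coef_eq; [assumption|]; exists emp, a.
rewrite mul_emp, emp_add; auto using ordinal_emp.
Qed.

Lemma coef_lead_gt g k a h : ordinal g → k ∈ omega → a ∈ wexp g → ordinal h → g ∈ h →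
  coef (add (mul (wexp g) k) a) h = emp.
Proof.
intros Hg Hk Ha Hh H; apply coef_small; [assumption|].
apply in_wexp; right; exists g; split; [assumption|]; apply in_mul; eauto.
Qed.

Lemma wexp_multiple g h : ordinal g → h ∈ g →
  ∃ x, ordinal x ∧ wexp g = mul (wexp h) (mul omega x).
Proof.
intros Hg H; assert (Oh : ordinal h) by eauto using ordinal_mem.
destruct (@ex_add (succ h) g) as [x [Hx ->]]; auto using ordinal_succ.
- intros z; rewrite in_succ; intros [Hz | ->]; eauto using ordinal_trans.
- exists (wexp x); split; [now apply ordinal_wexp|].
  now rewrite wexp_add, wexp_succ, mul_assoc.
Qed.

(** For [h] below [g], the term [ω^g·k] is a multiple of [ω^h·ω]. Adding it on the left changes only
    the quotient [q] in [has_coef]. *)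
Lemma coef_lead_lt g k a h : ordinal g → k ∈ omega → a ∈ wexp g → h ∈ g →
  coef (add (mul (wexp g) k) a) h = coef a h.
Proof.
intros Hg Hk Ha Hh.
assert (Oh : ordinal h) by eauto using ordinal_mem.
assert (Oa : ordinal a) by eauto using ordinal_mem, ordinal_wexp.
apply coef_eq; [assumption|].
destruct (coef_spec Oa Oh) as [q [r [Hq [Hm [Hr E]]]]].
destruct (wexp_multiple Hg Hh) as [x [Hx ->]].
exists (add (mul x k) q), r; split; [eauto using ordinal_add, ordinal_mul, ordinal_nat|].
do 2 (split; [assumption|]); rewrite E at 1.
rewrite add_assoc, <- !mul_assoc, <- mul_add, add_assoc, <- mul_add; reflexivity.
Qed.

(** Ordinals are compared lexicographically by their coefficients, [h] being the largest exponent at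
    which the two differ. Induction on a power of [ω] above [b]: at a successor exponent either the
    leading coefficients differ, or they agree and the remainders are compared. *)
Lemma lt_coef a b : ordinal b → a ∈ b →
  ∃ h, ordinal h ∧ coef a h ∈ coef b h ∧ ∀ i, ordinal i → h ∈ i → coef a i = coef b i.
Proof.
intros Hb Hab.
assert (K : ∀ g, ordinal g → ∀ a b, a ∈ b → b ∈ wexp g →
  ∃ h, h ∈ g ∧ coef a h ∈ coef b h ∧ ∀ i, ordinal i → h ∈ i → coef a i = coef b i).
{ clear; apply (@ordinal_ind3 _ _ (fun g => ∀ a b, a ∈ b → b ∈ wexp g →
    ∃ h, h ∈ g ∧ coef a h ∈ coef b h ∧ ∀ i, ordinal i → h ∈ i → coef a i = coef b i)); [dfn| | |].
  - intros a b H Hb; rewrite wexp_emp in Hb; subst; case (in_emp H).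
  - intros g Hg IH a b H Hb.
    assert (Ha : a ∈ wexp (succ g)) by eauto using ordinal_trans, ordinal_wexp, ordinal_succ.
    rewrite in_wexp_succ in Ha, Hb.
    destruct Ha as [k [a' [Hk [Ha E]]]], Hb as [l [b' [Hl [Hb E']]]].
    destruct (ordinal_total (ordinal_nat Hk) (ordinal_nat Hl)) as [C|[C|C]].
    + exists g; split; [apply in_succ_self|]; subst a b.
      rewrite !coef_lead_eq by assumption; split; [assumption|].
      intros i Hi Hgi; now rewrite !coef_lead_gt.
    + subst l; assert (H' : a' ∈ b').
      { destruct (@ordinal_total _ _ a' b') as [D|[D|D]];
          eauto using ordinal_mem, ordinal_wexp; exfalso; subst a b.
        - subst; exact (mem_irrefl H).
        - exact (mem_asym H (add_lt _ D)). }
      destruct (IH a' b' H' Hb) as [h [Hh [L M]]]; exists h; rewrite in_succ; split; [auto|].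
      subst a b; rewrite !coef_lead_lt by assumption; split; [assumption|].
      intros i Hi Hhi; destruct (ordinal_total Hi Hg) as [D|[D|D]].
      * rewrite !coef_lead_lt by assumption; auto.
      * subst; now rewrite !coef_lead_eq.
      * now rewrite !coef_lead_gt.
    + exfalso; subst a b; apply (mem_asym H); now apply division_lt.
  - intros g Hg IH a b H Hb; rewrite (wexp_limit _ Hg) in Hb; destruct Hb as [y [Hy Hb]].
    destruct (IH y Hy a b H Hb) as [h [Hh L]]; exists h; split; [|assumption].
    eapply ordinal_trans; [apply Hg|exact Hh|exact Hy]. }
destruct (K (succ b) (ordinal_succ Hb) a b Hab (in_wexp_self_succ Hb)) as [h [Hh L]].
exists h; split; [|assumption]; eapply ordinal_mem; [apply (ordinal_succ Hb)|exact Hh].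
Qed.

Lemma coef_lt a b h : ordinal a → ordinal b → ordinal h → coef a h ∈ coef b h →
  (∀ i, ordinal i → h ∈ i → coef a i = coef b i) → a ∈ b.
Proof.
intros Ha Hb Hh H K; destruct (ordinal_total Ha Hb) as [C|[C|C]]; [assumption|exfalso|exfalso].
- subst; exact (mem_irrefl H).
- destruct (lt_coef Ha C) as [g [Hg [L M]]].
  destruct (ordinal_total Hg Hh) as [D|[D|D]].
  + rewrite (M h Hh D) in H; exact (mem_irrefl H).
  + subst; exact (mem_asym H L).
  + rewrite (K g Hg D) in L; exact (mem_irrefl L).
Qed.

Lemma coef_inj a b : ordinal a → ordinal b → (∀ h, ordinal h → coef a h = coef b h) → a = b.
Proof.
intros Ha Hb H; destruct (ordinal_total Ha Hb) as [C|[C|C]]; [exfalso|assumption|exfalso].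
- destruct (lt_coef Hb C) as [g [Hg [L _]]]; rewrite (H g Hg) in L; exact (mem_irrefl L).
- destruct (lt_coef Ha C) as [g [Hg [L _]]]; rewrite (H g Hg) in L; exact (mem_irrefl L).
Qed.

(** Not every family of natural numbers is a family of coefficients, since almost all must vanish.
    Instead of treating supports, the sum is built by induction on a power of [ω] above both
    summands, adding leading coefficients at successor exponents. *)
Lemma ex_coef_sum a b : ordinal a → ordinal b →
  ∃ c, ordinal c ∧ ∀ h, ordinal h → coef c h = add (coef a h) (coef b h).
Proof.
intros Ha Hb.
assert (K : ∀ g, ordinal g → ∀ a b, a ∈ wexp g → b ∈ wexp g →
  ∃ c, c ∈ wexp g ∧ ∀ h, ordinal h → coef c h = add (coef a h) (coef b h)).
{ clear; apply (@ordinal_ind3 _ _ (fun g => ∀ a b, a ∈ wexp g → b ∈ wexp g →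
    ∃ c, c ∈ wexp g ∧ ∀ h, ordinal h → coef c h = add (coef a h) (coef b h))); [dfn| | |].
  - intros a b; rewrite !wexp_emp; intros -> ->; exists emp; rewrite wexp_emp.
    split; [reflexivity|]; intros h Hh; rewrite coef_small by auto using emp_in_wexp.
    now rewrite add_emp.
  - intros g Hg IH a b; rewrite !in_wexp_succ.
    intros [k [a' [Hk [Ha ->]]]] [l [b' [Hl [Hb ->]]]].
    destruct (IH a' b' Ha Hb) as [c [Hc H]].
    exists (add (mul (wexp g) (add k l)) c); rewrite in_wexp_succ.
    split; [exists (add k l), c; auto using nat_add|]; intros h Hh.
    destruct (ordinal_total Hh Hg) as [D|[D|D]].
    + rewrite !coef_lead_lt by auto using nat_add; auto.
    + subst; now rewrite !coef_lead_eq by auto using nat_add.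
    + rewrite !coef_lead_gt by auto using nat_add; now rewrite add_emp.
  - intros g Hg IH a b; rewrite !(wexp_limit _ Hg); intros [y [Hy Ha]] [z [Hz Hb]].
    assert (Oy : ordinal y) by (eapply ordinal_mem; [apply Hg|assumption]).
    assert (Oz : ordinal z) by (eapply ordinal_mem; [apply Hg|assumption]).
    assert (L : ∃ u, u ∈ g ∧ a ∈ wexp u ∧ b ∈ wexp u).
    { destruct (classic (z ∈ y)) as [C|C]; [exists y|exists z].
      - do 2 (split; [assumption|]); revert b Hb; apply wexp_sub; intros u Hu; eauto using ordinal_trans.
      - split; [assumption|]; split; [|assumption]; revert a Ha; apply wexp_sub; now apply ordinal_le.
    }
    destruct L as [u [Hu [L M]]]; destruct (IH u Hu a b L M) as [c [Hc N]].
    exists c; split; [|assumption]; rewrite (wexp_limit _ Hg); eauto. }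
pose proof (ordinal_add Ha Hb) as Hs.
destruct (K (succ (add a b)) (ordinal_succ Hs) a b) as [c [Hc H]].
- apply (@wexp_sub (succ a)); [|now apply in_wexp_self_succ].
  apply succ_sub; auto using sub_add_l.
- apply (@wexp_sub (succ b)); [|now apply in_wexp_self_succ].
  apply succ_sub; auto using sub_add_r.
- exists c; split; [|assumption].
  eapply ordinal_mem; [apply ordinal_wexp, (ordinal_succ Hs)|assumption].
Qed.

End Arithmetic.
#[export] Hint Resolve definable_add definable_mul definable_wexp definable_coef : definable.

(** * Natural sums *)

Section NaturalSum.
Context {V : SetStr} {hV : ZFC V}.
Implicit Types (a b c d f g h k l m n p q r x y z : V).

(** Identifies the relations [oadd], [omul] and [oexp], which are given by approximating sequences,
    with Tarski's functions: it is enough to check the three recursion clauses for [F]. *)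
Lemma ordrec_iff (F : V → V) z (step : V → V → Prop) b y : definable_term (fun e => F (e 0)) →
  ordinal b → F emp = z →
  (∀ w v, ordinal w → step (F w) v ↔ v = F (succ w)) →
  (∀ x t, limit_ordinal x → t ∈ F x ↔ ∃ w, w ∈ x ∧ t ∈ F w) →
  ordrec z step b y ↔ y = F b.
Proof.
intros HF Hb F0 FS FL; split.
- intros [d [f [Hd [Hf [Hy H]]]]]; rewrite is_succ_iff in Hd; subst d.
  assert (K : ∀ x, ordinal x → x ∈ succ b → ap f x = F x).
  { apply (@ordinal_ind _ _ (fun x => x ∈ succ b → ap f x = F x)); [dfn|].
    intros x Hx IH Hxb.
    assert (A : app f x (ap f x)) by now apply (app_ap x _ Hf).
    assert (IH' : ∀ w, w ∈ x → ap f w = F w) by (intros w Hw; eauto using ordinal_trans, ordinal_succ).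
    destruct (H x _ A) as [H0 [H1 H2]].
    destruct (ordinal_cases Hx) as [->|[[w [Hw ->]]|L]].
    - rewrite F0; apply H0; now apply is_empty_emp.
    - destruct (H1 w) as [u [Hu K]]; [now apply is_succ_iff|].
      rewrite (app_ap w u Hf) in Hu; destruct Hu as [_ ->].
      rewrite IH', FS in K by (assumption || apply in_succ_self); assumption.
    - apply ext; intros t; rewrite (H2 L t), (FL x t L); split.
      + intros [w [u [Hw [Hu Ht]]]]; rewrite (app_ap w u Hf) in Hu; destruct Hu as [_ ->].
        rewrite IH' in Ht by assumption; eauto.
      + intros [w [Hw Ht]]; exists w, (ap f w); split; [assumption|].
        rewrite (app_ap w _ Hf), IH' by assumption; repeat split; auto.
        eauto using ordinal_trans, ordinal_succ. }
  rewrite (app_ap b y Hf) in Hy; destruct Hy as [Hbs ->]; auto.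
- intros ->; exists (succ b), (lam (succ b) F); split; [now apply is_succ_iff|].
  split; [now apply is_fun_lam|]; split; [rewrite app_lam by dfn; auto using in_succ_self|].
  intros x v; rewrite app_lam by dfn; intros [Hx ->].
  assert (Ox : ordinal x) by eauto using ordinal_mem, ordinal_succ.
  split; [|split].
  + rewrite is_empty_emp; intros ->; assumption.
  + intros w Hw; rewrite is_succ_iff in Hw; subst x; exists (F w).
    assert (Ow : ordinal w) by (eapply ordinal_mem; [exact Ox|apply in_succ_self]).
    rewrite app_lam, FS by (dfn || assumption); repeat split; auto.
    eapply ordinal_trans; [apply (ordinal_succ Hb)|apply in_succ_self|assumption].
  + intros L t; rewrite (FL x t L); split.
    * intros [w [Hw Ht]]; exists w, (F w); rewrite app_lam by dfn; repeat split; auto.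
      eauto using ordinal_trans, ordinal_succ.
    * intros [w [u [Hw [Hu Ht]]]]; rewrite app_lam in Hu by dfn; destruct Hu as [_ ->]; eauto.
Qed.

Lemma oadd_iff a b c : ordinal b → oadd a b c ↔ c = add a b.
Proof.
intros Hb; apply (@ordrec_iff (fun b => add a b)); [dfn|assumption|apply add_emp| |].
- intros w v _; rewrite is_succ_iff, add_succ; tauto.
- intros x t Hx; rewrite in_add; split.
  + intros [Ht|[y [Hy ->]]].
    * exists emp; rewrite add_emp; split; [|assumption].
      apply emp_in_ordinal; [apply Hx|now apply limit_ne_emp].
    * exists (succ y); split; [now apply limit_succ|]; apply add_lt, in_succ_self.
  + intros [w [Hw Ht]]; rewrite in_add in Ht; destruct Ht as [Ht|[y [Hy ->]]]; [auto|].
    right; exists y; split; [|reflexivity]; eapply ordinal_trans; [apply Hx|exact Hy|exact Hw].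
Qed.

Lemma omul_iff a b c : ordinal a → ordinal b → omul a b c ↔ c = mul a b.
Proof.
intros Ha Hb; unfold omul.
assert (K : ordrec emp (fun u v => oadd u a v) b c ↔ c = mul a b).
{ apply (@ordrec_iff (fun b => mul a b)); [dfn|assumption|apply mul_emp| |].
  - intros w v _; rewrite oadd_iff, mul_succ by assumption; tauto.
  - intros x t Hx; rewrite in_mul; split.
    + intros [y [z [Hy [Hz ->]]]]; exists (succ y); split; [now apply limit_succ|].
      apply in_mul; exists y, z; auto using in_succ_self.
    + intros [w [Hw Ht]]; rewrite in_mul in Ht; destruct Ht as [y [z [Hy [Hz ->]]]].
      exists y, z; split; [|auto]; eapply ordinal_trans; [apply Hx|exact Hy|exact Hw]. }
rewrite <- K; split.
- intros [z [Hz H]]; rewrite is_empty_emp in Hz; now subst.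
- intros H; exists emp; now rewrite is_empty_emp.
Qed.

Lemma oexp_iff g p : ordinal g → oexp omega g p ↔ p = wexp g.
Proof.
intros Hg; unfold oexp.
assert (K : ordrec (succ emp) (fun u v => omul u omega v) g p ↔ p = wexp g).
{ apply (@ordrec_iff (fun b => wexp b)); [dfn|assumption| | |].
  - apply ext; intros x; rewrite wexp_emp, in_succ; split; [auto|].
    intros [H|H]; [case (in_emp H)|assumption].
  - intros w v Hw; rewrite omul_iff, wexp_succ by auto using ordinal_wexp, ordinal_omega; tauto.
  - intros x t Hx; now apply wexp_limit. }
rewrite <- K; split.
- intros [z [i [Hz [Hi H]]]]; rewrite is_empty_emp in Hz; rewrite is_succ_iff in Hi; now subst.
- intros H; exists emp, (succ emp); now rewrite is_empty_emp, is_succ_iff.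
Qed.

(** * Cantor normal forms as finite sequences *)

Definition is_cnf a n e c s :=
  n ∈ omega ∧ is_fun e n ∧ is_fun c n ∧ is_fun s (succ n) ∧
  (∀ i, i ∈ n → ordinal (ap e i)) ∧
  (∀ i j, i ∈ n → j ∈ n → i ∈ j → ap e j ∈ ap e i) ∧
  (∀ i, i ∈ n → ap c i ∈ omega ∧ ap c i ≠ emp) ∧
  ap s emp = emp ∧
  (∀ i, i ∈ n → ap s (succ i) = add (ap s i) (mul (wexp (ap e i)) (ap c i))) ∧
  ap s n = a.

Lemma cnf_iff a n e c : cnf a n e c ↔ ∃ s, is_cnf a n e c s.
Proof.
split.
- intros [w [s [n' [Hw [Hn [Hn' [He [Hc [Hs [H1 [H2 [H3 [H4 [H5 H6]]]]]]]]]]]]]].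
  rewrite is_omega_iff in Hw; rewrite is_succ_iff in Hn'; subst w n'; exists s.
  assert (On : ordinal n) by now apply ordinal_nat.
  assert (Ae : ∀ i, i ∈ n → app e i (ap e i)) by (intros; now apply (app_ap _ _ He)).
  assert (Ac : ∀ i, i ∈ n → app c i (ap c i)) by (intros; now apply (app_ap _ _ Hc)).
  assert (As : ∀ i, i ∈ succ n → app s i (ap s i)) by (intros; now apply (app_ap _ _ Hs)).
  repeat (split; [solve [eauto]|]); split; [|split; [|split]].
  + intros i Hi; rewrite <- nonempty_iff; eauto.
  + apply is_empty_emp, (H4 emp); [now apply is_empty_emp|]; apply As.
    apply emp_in_ordinal; [now apply ordinal_succ|apply succ_ne_emp].
  + intros i Hi.
    assert (Oi : i ∈ succ n) by (rewrite in_succ; auto).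
    assert (Os : succ i ∈ succ n) by now apply succ_mem_succ.
    destruct (H5 i (succ i) _ _ Hi (proj2 (is_succ_iff i (succ i)) eq_refl) (As _ Oi) (As _ Os))
      as [g [k [p [t [Hg [Hk [Hp [Ht Hx]]]]]]]].
    assert (Og : ordinal g) by eauto.
    assert (Ok : ordinal k) by (apply ordinal_nat; destruct (H3 _ _ Hk); assumption).
    rewrite oexp_iff in Hp by assumption; subst p.
    rewrite omul_iff in Ht by auto using ordinal_wexp; subst t.
    rewrite oadd_iff in Hx by auto using ordinal_wexp, ordinal_mul.
    rewrite (app_ap _ _ He) in Hg; rewrite (app_ap _ _ Hc) in Hk.
    destruct Hg as [_ ->], Hk as [_ ->]; assumption.
  + rewrite (app_ap _ _ Hs) in H6; symmetry; apply H6.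
- intros [s [Hn [He [Hc [Hs [H1 [H2 [H3 [H4 [H5 H6]]]]]]]]]].
  exists omega, s, (succ n); rewrite is_succ_iff, is_omega_iff.
  repeat (split; [solve [auto]|]); split; [|split; [|split; [|split; [|split]]]].
  + intros i g Hg; rewrite (app_ap _ _ He) in Hg; destruct Hg as [Hi ->]; auto.
  + intros i j x y; rewrite !(app_ap _ _ He); intros [Hi ->] [Hj ->]; auto.
  + intros i k Hk; rewrite (app_ap _ _ Hc) in Hk; destruct Hk as [Hi ->].
    rewrite nonempty_iff; auto.
  + intros z x Hz; rewrite (app_ap _ _ Hs), is_empty_emp in *; subst z.
    intros [_ ->]; assumption.
  + intros i i' x y Hi Hi'; rewrite is_succ_iff in Hi'; subst i'; rewrite !(app_ap _ _ Hs).
    intros [_ ->] [_ ->].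
    exists (ap e i), (ap c i), (wexp (ap e i)), (mul (wexp (ap e i)) (ap c i)).
    assert (Og : ordinal (ap e i)) by auto.
    assert (Ok : ordinal (ap c i)) by (apply ordinal_nat, H3; assumption).
    rewrite (app_ap _ _ He), (app_ap _ _ Hc), oexp_iff, omul_iff, oadd_iff
      by auto using ordinal_wexp, ordinal_mul.
    auto 10.
  + rewrite (app_ap _ _ Hs); split; [apply in_succ_self|auto].
Qed.

Lemma cnf_coef a n e c s : is_cnf a n e c s → ordinal a ∧ ∀ h, ordinal h →
  (∀ i, i ∈ n → ap e i = h → coef a h = ap c i) ∧ ((∀ i, i ∈ n → ap e i ≠ h) → coef a h = emp).
Proof.
intros [Hn [He [Hc [Hs [H1 [H2 [H3 [H4 [H5 <-]]]]]]]]].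
assert (On : ordinal n) by now apply ordinal_nat.
assert (Es : ∀ i, i ∈ n → i ∈ succ n) by (intros; rewrite in_succ; auto).
assert (Oc : ∀ i, i ∈ n → ordinal (ap c i)) by (intros; apply ordinal_nat, H3; assumption).
assert (Ot : ∀ m, m ∈ n → ordinal (mul (wexp (ap e m)) (ap c m)))
  by auto using ordinal_mul, ordinal_wexp.
assert (Dn : ∀ m, succ m ∈ succ n → m ∈ n).
{ intros m Hm; rewrite in_succ in Hm; destruct Hm as [Hm|Hm]; [|rewrite <- Hm; apply in_succ_self].
  eapply ordinal_trans; [exact On|apply in_succ_self|exact Hm]. }
(* A partial sum whose exponents are all at least [h] is a multiple of [ω^h]. Applied at a successor
   [h + 1], this says that the partial sum has coefficient zero at [h]. *)
assert (M : ∀ h, ordinal h → ∀ m, m ∈ omega → m ∈ succ n → (∀ i, i ∈ m → h ⊆ ap e i) →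
  ∃ q, ordinal q ∧ ap s m = mul (wexp h) q).
{ intros h Hh; apply (@nat_ind_set _ _ (fun m => m ∈ succ n → (∀ i, i ∈ m → h ⊆ ap e i) →
  ∃ q, ordinal q ∧ ap s m = mul (wexp h) q)); [dfn| |].
  - intros _ _; exists emp; rewrite mul_emp; auto using ordinal_emp.
  - intros m Hm IH Hmn K; apply Dn in Hmn; destruct IH as [q [Hq E]]; auto.
    { intros i Hi; apply K; rewrite in_succ; auto. }
    destruct (@ex_add _ _ h (ap e m)) as [x [Hx E']]; auto.
    { apply K, in_succ_self. }
    exists (add q (mul (wexp x) (ap c m))).
    split; [auto using ordinal_add, ordinal_mul, ordinal_wexp|].
    rewrite H5, E, E', wexp_add, <- mul_assoc, <- mul_add by assumption; reflexivity. }
enough (K : ∀ m, m ∈ omega → m ∈ succ n → ordinal (ap s m) ∧ ∀ h, ordinal h →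
  (∀ i, i ∈ m → ap e i = h → coef (ap s m) h = ap c i) ∧
  ((∀ i, i ∈ m → ap e i ≠ h) → coef (ap s m) h = emp))
  by (apply K; [assumption|apply in_succ_self]).
apply (@nat_ind_set _ _ (fun m => m ∈ succ n → ordinal (ap s m) ∧ ∀ h, ordinal h →
  (∀ i, i ∈ m → ap e i = h → coef (ap s m) h = ap c i) ∧
  ((∀ i, i ∈ m → ap e i ≠ h) → coef (ap s m) h = emp))); [dfn| |].
- intros _; rewrite H4; split; [apply ordinal_emp|]; intros h Hh; split.
  + intros i Hi; case (in_emp Hi).
  + intros _; apply coef_small; auto using emp_in_wexp.
- intros m Hm IH Hmn; apply Dn in Hmn; destruct IH as [Os IH]; [auto|].
  assert (Om : ordinal m) by now apply ordinal_nat.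
  rewrite H5 by assumption; split; [auto using ordinal_add|].
  intros h Hh; specialize (IH h Hh); destruct IH as [I1 I2].
  assert (Eg : ∀ i, i ∈ m → ap e m ∈ ap e i).
  { intros i Hi; apply H2; auto; eauto using ordinal_trans. }
  (* The exponent of the new term is compared with [h]. If smaller, the term goes into the
     remainder, which stays below [ω^h]. If equal, the earlier terms form a multiple of [ω^(h+1)],
     so the new coefficient is read off. If larger, the whole sum is such a multiple. *)
  destruct (ordinal_total (H1 m Hmn) Hh) as [D|[D|D]].
  + assert (E : coef (add (ap s m) (mul (wexp (ap e m)) (ap c m))) h = coef (ap s m) h).
    { destruct (coef_spec Os Hh) as [q [r [Hq [Hk [Hr E]]]]].
      apply coef_eq; [assumption|].
      exists q, (add r (mul (wexp (ap e m)) (ap c m))); do 2 (split; [assumption|]).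
      rewrite E at 1; split; [|now rewrite add_assoc].
      apply wexp_closed_add; auto; apply in_wexp; right; exists (ap e m).
      split; [assumption|]; apply mul_lt; [apply emp_in_wexp|]; now apply H3. }
    rewrite E; split.
    * intros i Hi Ei; rewrite in_succ in Hi; destruct Hi as [Hi | ->]; [auto|].
      rewrite Ei in D; case (mem_irrefl D).
    * intros K; apply I2; intros i Hi; apply K; rewrite in_succ; auto.
  + destruct (M (succ (ap e m)) (ordinal_succ (H1 m Hmn)) m Hm) as [q [Hq E]]; auto.
    { intros i Hi x; rewrite in_succ; intros [Hx | ->]; [|auto].
      eapply ordinal_trans; [apply H1|exact Hx|auto]; eauto using ordinal_trans. }
    assert (E' : coef (add (ap s m) (mul (wexp (ap e m)) (ap c m))) h = ap c m).
    { apply coef_eq; [assumption|]; exists q, emp; split; [assumption|].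
      split; [now apply H3|]; split; [apply emp_in_wexp|].
      now rewrite add_emp, E, wexp_succ, <- mul_assoc, <- mul_add, D. }
    rewrite E'; split.
    * intros i Hi Ei; rewrite in_succ in Hi; destruct Hi as [Hi | ->]; [|auto].
      apply Eg in Hi; rewrite Ei, D in Hi; case (mem_irrefl Hi).
    * intros K; case (K m (in_succ_self m) D).
  + assert (Hs' : ∀ i, i ∈ succ m → succ h ⊆ ap e i).
    { intros i Hi.
      assert (Hie : h ∈ ap e i).
      { rewrite in_succ in Hi; destruct Hi as [Hi | ->]; [|assumption].
        eapply ordinal_trans; [apply H1|exact D|auto]; eauto using ordinal_trans. }
      assert (Hin : i ∈ n).
      { rewrite in_succ in Hi; destruct Hi as [Hi | ->]; eauto using ordinal_trans. }
      intros x; rewrite in_succ; intros [Hx | ->]; eauto using ordinal_trans. }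
    split.
    * intros i Hi Ei; exfalso; apply (@mem_irrefl _ _ h); rewrite <- Ei at 2.
      apply Hs'; [assumption|apply in_succ_self].
    * intros _; destruct (M (succ h) (ordinal_succ Hh) (succ m)) as [q [Hq E]];
        auto using succ_in_omega, succ_mem_succ.
      rewrite <- H5, E by assumption; apply coef_eq; [assumption|].
      exists q, emp; rewrite !add_emp, wexp_succ, mul_assoc; auto using emp_in_omega, emp_in_wexp.
Qed.

Definition snoc f n x := lam (succ n) (fun i => the (fun y => (i ∈ n ∧ y = ap f i) ∨ (¬ i ∈ n ∧ y = x))).

Lemma is_fun_snoc f n x : is_fun (snoc f n x) (succ n).
Proof. apply is_fun_lam; dfn. Qed.

Lemma ap_snoc_old f n x i : i ∈ n → ap (snoc f n x) i = ap f i.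
Proof.
intros Hi; unfold snoc; rewrite ap_lam by (dfn || (rewrite in_succ; auto)).
apply the_eq; [auto|tauto].
Qed.

Lemma ap_snoc_new f n x : ap (snoc f n x) n = x.
Proof.
unfold snoc; rewrite ap_lam by (dfn || apply in_succ_self); pose proof (@mem_irrefl _ _ n).
apply the_eq; [auto|tauto].
Qed.

Lemma cnf_snoc a n e c s g k : is_cnf a n e c s → ordinal g → k ∈ omega → k ≠ emp →
  (∀ i, i ∈ n → g ∈ ap e i) →
  is_cnf (add a (mul (wexp g) k)) (succ n) (snoc e n g) (snoc c n k)
    (snoc s (succ n) (add a (mul (wexp g) k))).
Proof.
intros [Hn [He [Hc [Hs [H1 [H2 [H3 [H4 [H5 H6]]]]]]]]] Hg Hk Hk0 K.
assert (On : ordinal n) by now apply ordinal_nat.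
split; [now apply succ_in_omega|].
do 3 (split; [apply is_fun_snoc|]); split; [|split; [|split; [|split; [|split]]]].
- intros i Hi; rewrite in_succ in Hi; destruct Hi as [Hi | ->].
  + rewrite ap_snoc_old; auto.
  + now rewrite ap_snoc_new.
- intros i j Hi Hj Hij; rewrite in_succ in Hi, Hj.
  destruct Hj as [Hj | ->].
  + assert (Hin : i ∈ n) by eauto using ordinal_trans.
    rewrite !ap_snoc_old by assumption; auto.
  + rewrite ap_snoc_new, ap_snoc_old by assumption; auto.
- intros i Hi; rewrite in_succ in Hi; destruct Hi as [Hi | ->].
  + rewrite ap_snoc_old by assumption; now apply H3.
  + rewrite ap_snoc_new; auto.
- rewrite ap_snoc_old; [assumption|].
  apply emp_in_ordinal; [now apply ordinal_succ|apply succ_ne_emp].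
- intros i Hi; rewrite in_succ in Hi; destruct Hi as [Hi | ->].
  + rewrite !ap_snoc_old; auto; [rewrite in_succ; auto|now apply succ_mem_succ].
  + rewrite !ap_snoc_new, ap_snoc_old by apply in_succ_self; now rewrite H6.
- apply ap_snoc_new.
Qed.

Lemma ex_cnf a : ordinal a → ∃ n e c s, is_cnf a n e c s.
Proof.
intros Ha.
(* The statement is strengthened for the induction on [g]: a normal form with all exponents at least
   [g] can be continued by any ordinal below [ω^g]. The lemma is the case of the empty normal form,
   with [g = a + 1]. *)
assert (K : ∀ g, ordinal g → ∀ p n e c s, is_cnf p n e c s → (∀ i, i ∈ n → g ⊆ ap e i) →
  ∀ a, a ∈ wexp g → ∃ n e c s, is_cnf (add p a) n e c s).
{ clear; apply (@ordinal_ind3 _ _ (fun g => ∀ p n e c s, is_cnf p n e c s →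
    (∀ i, i ∈ n → g ⊆ ap e i) →
    ∀ a, a ∈ wexp g → ∃ n e c s, is_cnf (add p a) n e c s)); [unfold is_cnf; dfn| | |].
  - intros p n e c s H _ a Ha; rewrite wexp_emp in Ha; subst; rewrite add_emp; eauto.
  - intros g Hg IH p n e c s H K a Ha; rewrite in_wexp_succ in Ha.
    destruct Ha as [k [r [Hk [Hr ->]]]].
    assert (K' : ∀ i, i ∈ n → g ∈ ap e i) by (intros i Hi; apply (K i Hi), in_succ_self).
    destruct (classic (k = emp)) as [->|Hk0].
    + rewrite mul_emp, emp_add; apply (IH p n e c s); auto.
      intros i Hi z Hz; apply (K i Hi); rewrite in_succ; auto.
    + rewrite add_assoc; eapply IH; [eapply cnf_snoc; eauto| |assumption].
      intros i Hi; rewrite in_succ in Hi; destruct Hi as [Hi | ->].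
      * rewrite ap_snoc_old by assumption; intros z Hz.
        apply (K i Hi); rewrite in_succ; auto.
      * now rewrite ap_snoc_new.
  - intros g Hg IH p n e c s H K a Ha; rewrite (wexp_limit _ Hg) in Ha.
    destruct Ha as [y [Hy Ha]]; apply (IH y Hy p n e c s); auto.
    intros i Hi z Hz; apply (K i Hi); eapply ordinal_trans; [apply Hg|exact Hz|exact Hy]. }
destruct (K (succ a) (ordinal_succ Ha) emp emp emp emp (lam (succ emp) (fun _ => emp)))
  with (a := a) as [n [e [c [s H]]]].
- assert (F : is_fun emp emp).
  { split; [intros p Hp; case (in_emp Hp)|]; split.
    - intros x; split; [intros Hx; case (in_emp Hx)|].
      intros [y [p [_ Hp]]]; case (in_emp Hp).
    - intros x y z [p [_ Hp]]; case (in_emp Hp). }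
  assert (Z : ∀ i, ¬ i ∈ emp) by (intros i; apply in_emp).
  split; [apply emp_in_omega|]; do 2 (split; [assumption|]).
  split; [apply is_fun_lam; dfn|].
  assert (L : ap (lam (succ emp) (fun _ => emp)) emp = emp)
    by (rewrite ap_lam by (dfn || apply in_succ_self); reflexivity).
  rewrite L; repeat split; try (intros; exfalso; eapply Z; eassumption).
- intros i Hi; case (in_emp Hi).
- now apply in_wexp_self_succ.
- rewrite emp_add in H; exists n, e, c, s; assumption.
Qed.

Lemma coefficient_iff a g k : ordinal a → ordinal g → coefficient a g k ↔ k = coef a g.
Proof.
intros Ha Hg.
assert (K : ∀ k, coefficient a g k → k = coef a g).
{ clear k; intros k [n [e [c [H L]]]]; rewrite cnf_iff in H; destruct H as [s H].
  pose proof H as [_ [He [Hc _]]]; destruct (cnf_coef H) as [_ M].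
  destruct (M g Hg) as [M1 M2]; symmetry; destruct L as [[i [L L']]|[L L']].
  - rewrite (app_ap _ _ He) in L; rewrite (app_ap _ _ Hc) in L'.
    destruct L as [Hi ->], L' as [_ ->]; auto.
  - rewrite is_empty_emp in L; subst k; apply M2; intros i Hi Ei; apply L'.
    exists i; rewrite (app_ap _ _ He); auto. }
split; [apply K|]; intros ->; destruct (ex_cnf Ha) as [n [e [c [s H]]]].
assert (L : ∃ k, coefficient a g k).
{ pose proof H as [_ [He [Hc _]]].
  destruct (classic (∃ i, app e i g)) as [[i Hi]|N].
  - exists (ap c i), n, e, c; split; [apply cnf_iff; eauto|]; left; exists i.
    split; [assumption|]; rewrite (app_ap _ _ He) in Hi; now apply (app_ap _ _ Hc).
  - exists emp, n, e, c; split; [apply cnf_iff; eauto|]; right.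
    now rewrite is_empty_emp. }
destruct L as [k L]; now rewrite <- (K k L).
Qed.

Lemma natural_sum_iff a b c : natural_sum a b c ↔ ordinal a ∧ ordinal b ∧ ordinal c ∧
  ∀ g, ordinal g → coef c g = add (coef a g) (coef b g).
Proof.
split; intros [Ha [Hb [Hc H]]]; do 3 (split; [assumption|]); intros g Hg.
- destruct (H g Hg) as [k [l [m [Hk [Hl [Hm K]]]]]].
  rewrite coefficient_iff in Hk, Hl, Hm by assumption; subst.
  rewrite oadd_iff in K; [assumption|]; apply ordinal_nat; now apply coef_nat.
- exists (coef a g), (coef b g), (coef c g); rewrite !coefficient_iff by assumption.
  rewrite oadd_iff; [auto|]; apply ordinal_nat; now apply coef_nat.
Qed.

Lemma ex_natural_sum a b : ordinal a → ordinal b → ∃ c, natural_sum a b c.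
Proof.
intros Ha Hb; destruct (ex_coef_sum Ha Hb) as [c [Hc H]]; exists c.
now apply natural_sum_iff.
Qed.

Lemma natural_sum_fun a b c c' : natural_sum a b c → natural_sum a b c' → c = c'.
Proof.
rewrite !natural_sum_iff; intros [_ [_ [Hc H]]] [_ [_ [Hc' H']]].
apply coef_inj; auto; intros h Hh; now rewrite H, H'.
Qed.

Lemma natural_sum_comm a b c : natural_sum a b c → natural_sum b a c.
Proof.
rewrite !natural_sum_iff; intros [Ha [Hb [Hc H]]]; do 3 (split; [assumption|]).
intros g Hg; rewrite H by assumption; apply nat_add_comm; now apply coef_nat.
Qed.

Lemma natural_sum_lt_r a b b' c c' : b ∈ b' → natural_sum a b c → natural_sum a b' c' → c ∈ c'.
Proof.
rewrite !natural_sum_iff; intros L [Ha [Hb [Hc H]]] [_ [Hb' [Hc' H']]].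
destruct (lt_coef Hb' L) as [h [Hh [K M]]].
apply (coef_lt Hc Hc' Hh).
- rewrite H, H' by assumption; now apply add_lt.
- intros i Hi Hhi; rewrite H, H', M by assumption; reflexivity.
Qed.

Lemma natural_sum_lt_l a a' b c c' : a ∈ a' → natural_sum a b c → natural_sum a' b c' → c ∈ c'.
Proof. intros L H H'; apply natural_sum_comm in H, H'; eapply natural_sum_lt_r; eauto. Qed.

(** The contrapositive of monotonicity: if [a' ≤ a] and [b' ≤ b], then [c' ≤ c], changing one
    summand at a time through the intermediate sum of [a'] and [b]. *)
Lemma natural_sum_lt_inv a b c a' b' c' :
  natural_sum a b c → natural_sum a' b' c' → c ∈ c' → a ∈ a' ∨ b ∈ b'.
Proof.
intros H H' L.
assert (Ha : ordinal a) by apply H. assert (Hb : ordinal b) by apply H.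
assert (Ha' : ordinal a') by apply H'. assert (Hb' : ordinal b') by apply H'.
assert (Hc : ordinal c) by apply H. assert (Hc' : ordinal c') by apply H'.
destruct (ex_natural_sum Ha' Hb) as [d K].
apply NNPP; intros N; apply not_or_and in N; destruct N as [N1 N2].
assert (D1 : d ∈ c ∨ d = c).
{ destruct (ordinal_total Ha Ha') as [C|[C|C]]; [contradiction| |].
  - subst; right; eapply natural_sum_fun; eauto.
  - left; eapply natural_sum_lt_l; eauto. }
assert (D2 : c' ∈ d ∨ c' = d).
{ destruct (ordinal_total Hb Hb') as [C|[C|C]]; [contradiction| |].
  - subst; right; eapply natural_sum_fun; eauto.
  - left; eapply natural_sum_lt_r; eauto. }
assert (D : c' ∈ c ∨ c' = c).
{ destruct D1 as [D1|D1], D2 as [D2|D2]; subst; auto; left; eauto using ordinal_trans. }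
destruct D as [D|D]; [exact (mem_asym L D)|subst; exact (mem_irrefl L)].
Qed.

End NaturalSum.

(** * Countably complete ultrafilters *)

Definition almost_all {V : SetStr} {hV : ZFC V} (U d : V) (P : V → Prop) := sep d P ∈ U.

Lemma definable_almost_all (V : SetStr) (hV : ZFC V) (U d : (nat → V) → V)
    (P : (nat → V) → V → Prop) : definable_term U → definable_term d →
  definable (fun e => P (fun n => e (S n)) (e 0)) →
  definable (fun e => almost_all (U e) (d e) (P e)).
Proof. intros; unfold almost_all; dfn. Qed.
#[export] Hint Resolve definable_almost_all : definable.

Section Ultrafilter.
Context {V : SetStr} {hV : ZFC V}.
Variables U d : V.
Hypothesis HU : cc_ultrafilter U d.
Implicit Types (a b c f g h n x y z : V) (P Q : V → Prop).
Notation aa := (almost_all U d).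

Lemma uf_sub x : x ∈ U → x ⊆ d.
Proof. apply HU. Qed.
Lemma uf_space : d ∈ U.
Proof. apply HU. Qed.

Lemma aa_ex P : definable (fun e => P (e 0)) → aa P → ∃ x, x ∈ d ∧ P x.
Proof.
intros HP H; destruct HU as [[_ [_ [K _]]] _].
destruct (K _ H) as [x Hx]; rewrite in_sep in Hx by dfn; eauto.
Qed.

Lemma aa_mono P Q : definable (fun e => P (e 0)) → definable (fun e => Q (e 0)) →
  aa P → (∀ x, x ∈ d → P x → Q x) → aa Q.
Proof.
intros HP HQ H K; destruct HU as [[_ [_ [_ [M _]]]] _].
apply (M _ _ H); intros z; rewrite !in_sep by dfn; intros [Hz L]; auto.
Qed.

Lemma aa_and P Q : definable (fun e => P (e 0)) → definable (fun e => Q (e 0)) →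
  aa P → aa Q → aa (fun x => P x ∧ Q x).
Proof.
intros HP HQ H K; destruct HU as [[_ [_ [_ [_ [M _]]]]] _].
apply (M _ _ _ H K); intros z; rewrite !in_sep by dfn; tauto.
Qed.

Lemma aa_imp P Q : definable (fun e => P (e 0)) → definable (fun e => Q (e 0)) →
  (∀ x, x ∈ d → P x → Q x) → aa P → aa Q.
Proof. intros; now apply (@aa_mono P). Qed.

Lemma aa_iff P Q : definable (fun e => P (e 0)) → definable (fun e => Q (e 0)) →
  (∀ x, x ∈ d → P x ↔ Q x) → aa P ↔ aa Q.
Proof. intros HP HQ H; split; apply aa_imp; auto; intros x Hx; now apply H. Qed.

Lemma aa_mono2 P P' Q : definable (fun e => P (e 0)) → definable (fun e => P' (e 0)) →
  definable (fun e => Q (e 0)) →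
  aa P → aa P' → (∀ x, x ∈ d → P x → P' x → Q x) → aa Q.
Proof.
intros HP HP' HQ H H' K; apply (@aa_mono (fun x => P x ∧ P' x)); [dfn|dfn|now apply aa_and|].
intros x Hx []; auto.
Qed.

Lemma aa_imp2 P P' Q : definable (fun e => P (e 0)) → definable (fun e => P' (e 0)) →
  definable (fun e => Q (e 0)) →
  (∀ x, x ∈ d → P x → P' x → Q x) → aa P → aa P' → aa Q.
Proof. intros; now apply (@aa_mono2 P P'). Qed.

Lemma aa_all P : definable (fun e => P (e 0)) → (∀ x, x ∈ d → P x) → aa P.
Proof.
intros HP H; unfold almost_all; replace (sep d P) with d; [apply uf_space|].
apply ext; intros z; rewrite in_sep by dfn; split; [auto|tauto].
Qed.

Lemma aa_not P : definable (fun e => P (e 0)) → aa (fun x => ¬ P x) ↔ ¬ aa P.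
Proof.
intros HP; split.
- intros H K; destruct (@aa_ex (fun x => P x ∧ ¬ P x)) as [x [_ []]]; [dfn| |contradiction].
  apply aa_and; (assumption || dfn).
- intros H; destruct HU as [[_ [_ [_ [_ [_ M]]]]] _].
  destruct (M (sep d P) (sep d (fun x => ¬ P x))) as [K|K]; [| |contradiction|assumption].
  + intros z; rewrite in_sep by dfn; tauto.
  + intros z; rewrite !in_sep by dfn; tauto.
Qed.

Lemma aa_or P Q : definable (fun e => P (e 0)) → definable (fun e => Q (e 0)) →
  aa (fun x => P x ∨ Q x) → aa P ∨ aa Q.
Proof.
intros HP HQ H; apply NNPP; intros N; apply not_or_and in N; destruct N as [N1 N2].
apply aa_not in N1, N2; [|dfn|dfn].
destruct (@aa_ex (fun x => (P x ∨ Q x) ∧ ¬ P x ∧ ¬ Q x)) as [x [_ K]]; [dfn| |tauto].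
repeat apply aa_and; (assumption || dfn).
Qed.

Lemma aa_const (A : Prop) : definable (fun _ : nat → V => A) → aa (fun _ => A) ↔ A.
Proof.
intros HA; split; [|intros H; apply aa_all; auto].
intros H; destruct (@aa_ex (fun _ => A) HA H) as [x [_ K]]; exact K.
Qed.

Lemma aa_omega (P : V → V → Prop) : definable (fun e => P (e 0) (e 1)) →
  (∀ n, n ∈ omega → aa (fun x => P n x)) → aa (fun x => ∀ n, n ∈ omega → P n x).
Proof.
intros HP H; destruct HU as [_ K].
apply (K omega (lam omega (fun n => sep d (fun x => P n x)))).
- apply omega_spec.
- apply is_fun_lam; dfn.
- intros n X; rewrite app_lam by dfn; intros [Hn ->]; now apply H.
- intros x; rewrite in_sep by dfn; split; (intros [Hx L]; split; [assumption|]).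
  + intros n X; rewrite app_lam by dfn; intros [Hn ->]; rewrite in_sep by dfn; auto.
  + intros n Hn; specialize (L n (sep d (fun x => P n x))).
    rewrite app_lam, in_sep in L by dfn; apply L; auto.
Qed.

Lemma almost_iff (R : V → V → Prop) f g : definable (fun e => R (e 0) (e 1)) →
  is_fun f d → is_fun g d → almost U d R f g ↔ aa (fun a => R (ap f a) (ap g a)).
Proof.
intros HR Hf Hg; unfold almost, almost_all.
assert (K : ∀ a, a ∈ sep d (fun a => R (ap f a) (ap g a)) ↔
  a ∈ d ∧ ∃ x y, app f a x ∧ app g a y ∧ R x y).
{ intros a; rewrite in_sep by dfn; split; (intros [Ha H]; split; [assumption|]).
  - exists (ap f a), (ap g a); rewrite (app_ap _ _ Hf), (app_ap _ _ Hg); auto.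
  - destruct H as [x [y [Hx [Hy L]]]]; rewrite (app_ap _ _ Hf) in Hx.
    rewrite (app_ap _ _ Hg) in Hy; destruct Hx as [_ ->], Hy as [_ ->]; assumption. }
split.
- intros [A [HA L]]; replace (sep d _) with A; [assumption|].
  apply ext; intros a; now rewrite K, L.
- intros H; eexists; split; [exact H|exact K].
Qed.

(** Dependent choice turns a failure into a sequence of functions, each below the previous one
    almost everywhere. By countable completeness some coordinate witnesses all these descents at
    once, against the wellfoundedness of [R]. *)
Lemma ultraproduct_wf (R : V → V → Prop) : definable (fun e => R (e 0) (e 1)) →
  (∀ s, nonempty s → ∃ x, x ∈ s ∧ ∀ y, y ∈ s → ¬ R y x) →
  ∀ s, nonempty s →
    ∃ f, f ∈ s ∧ ∀ g, g ∈ s → ¬ aa (fun a => R (ap g a) (ap f a)).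
Proof.
intros HR W s Hs; apply NNPP; intros N.
destruct (@dependent_choice _ _ s (fun g f => aa (fun a => R (ap g a) (ap f a))))
  as [F [_ [HF K]]]; [dfn|assumption| |].
- intros f Hf; apply NNPP; intros M; apply N; exists f; split; [assumption|].
  intros g Hg L; apply M; eauto.
- apply (@aa_omega (fun n a => R (ap (ap F (succ n)) a) (ap (ap F n) a))) in K; [|dfn].
  apply aa_ex in K; [|dfn]; destruct K as [a [_ K]].
  destruct (W (repl omega (fun n => ap (ap F n) a))) as [x [Hx L]].
  + exists (ap (ap F emp) a); rewrite in_repl by dfn; eauto using emp_in_omega.
  + rewrite in_repl in Hx by dfn; destruct Hx as [n [Hn ->]].
    apply (L (ap (ap F (succ n)) a)); [|auto].
    rewrite in_repl by dfn; eauto using succ_in_omega.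
Qed.

(** * Ultrapowers *)

Definition is_collapse c f := is_fun f c ∧ (∀ h, h ∈ c → is_fun h d) ∧
  (∀ g h, h ∈ c → is_fun g d → aa (fun a => ap g a ∈ ap h a) →
     ∃ g', g' ∈ c ∧ aa (fun a => ap g a = ap g' a)) ∧
  ∀ h z, h ∈ c → z ∈ ap f h ↔ ∃ g, g ∈ c ∧ aa (fun a => ap g a ∈ ap h a) ∧ z = ap f g.

Lemma collapse_iff f x : collapse U d f x ↔
  ∃ c k, is_collapse c k ∧ f ∈ c ∧ x = ap k f.
Proof.
split.
- intros [Hf [c [k [H1 [H2 [H3 [H4 H5]]]]]]]; exists c, k.
  rewrite (app_ap _ _ H1) in H5; split; [|assumption].
  split; [assumption|]; split; [assumption|]; split.
  + intros g h Hh Hg H; destruct (H3 g h Hh Hg) as [g' [K L]].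
    * apply almost_iff; auto; dfn.
    * exists g'; split; [assumption|]; rewrite almost_iff in L by (auto || dfn); assumption.
  + intros h z Hh.
    assert (A : app k h (ap k h)) by now apply (app_ap _ _ H1).
    rewrite (H4 h _ A z); split.
    * intros [g [K L]]; rewrite (app_ap _ _ H1) in L; destruct L as [L ->]; exists g.
      rewrite almost_iff in K by (auto || dfn); auto.
    * intros [g [K [L ->]]]; exists g; rewrite (app_ap _ _ H1), almost_iff by (auto || dfn); auto.
- intros [c [k [[H1 [H2 [H3 H4]]] [Hf ->]]]]; split; [auto|]; exists c, k.
  split; [assumption|]; split; [assumption|]; split; [|split].
  + intros g h Hh Hg H; rewrite almost_iff in H by (auto || dfn).
    destruct (H3 g h Hh Hg H) as [g' [K L]]; exists g'; split; [assumption|].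
    apply almost_iff; auto; dfn.
  + intros h y Hy z; rewrite (app_ap _ _ H1) in Hy; destruct Hy as [Hh ->].
    rewrite H4 by assumption; split; intros [g K]; exists g.
    * destruct K as [K [L ->]]; rewrite (app_ap _ _ H1), almost_iff by (auto || dfn); auto.
    * destruct K as [K L]; rewrite (app_ap _ _ H1) in L; destruct L as [L ->].
      rewrite almost_iff in K by (auto || dfn); auto.
  + now apply (app_ap _ _ H1).
Qed.

(** Uniqueness of the transitive collapse, by a minimal counterexample for membership modulo [U].
    Two approximations need not contain the same functions, only equivalent ones, so the statement
    compares values at functions that are equal almost everywhere. *)
Lemma collapse_agree c k c' k' f f' : is_collapse c k → is_collapse c' k' →
  f ∈ c → f' ∈ c' → aa (fun a => ap f a = ap f' a) → ap k f = ap k' f'.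
Proof.
intros H H' Hf Hf' E; apply NNPP; intros N.
pose (P := fun f => ∃ f', f' ∈ c' ∧ aa (fun a => ap f a = ap f' a) ∧ ap k f ≠ ap k' f').
assert (HP : definable (fun e => P (e 0))) by (unfold P; dfn).
destruct (@ultraproduct_wf (fun x y => x ∈ y) ltac:(dfn) mem_wf (sep c P)) as [g [Hg M]].
{ exists f; rewrite in_sep by dfn; unfold P; eauto. }
rewrite in_sep in Hg by dfn; destruct Hg as [Hg [g' [Hg' [L Ne]]]]; apply Ne.
assert (I : ∀ h h', h ∈ c → aa (fun a => ap h a ∈ ap g a) → h' ∈ c' →
  aa (fun a => ap h a = ap h' a) → ap k h = ap k' h').
{ intros h h' Hh K Hh' Eh; apply NNPP; intros Nh; apply (M h); [|assumption].
  rewrite in_sep by dfn; split; [assumption|]; exists h'; auto. }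
destruct H as [H1 [H2 [H3 H4]]], H' as [H1' [H2' [H3' H4']]].
apply ext; intros z; rewrite H4, H4' by assumption; split.
- intros [h [Hh [K ->]]].
  destruct (H3' h g' Hg' (H2 h Hh)) as [h' [Hh' Eh]].
  { apply (aa_mono2 (P := fun a => ap h a ∈ ap g a) (P' := fun a => ap g a = ap g' a));
      try assumption; try dfn; intros x _ A <-; exact A. }
  exists h'; split; [assumption|]; split; [|now apply I].
  apply (aa_mono2 (P := fun a => ap h a ∈ ap g a ∧ ap h a = ap h' a) (P' := fun a => ap g a = ap g' a));
    try assumption; try dfn; [apply aa_and; (assumption || dfn)|].
  intros x _ [A <-] <-; exact A.
- intros [h' [Hh' [K ->]]].
  destruct (H3 h' g Hg (H2' h' Hh')) as [h [Hh Eh]].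
  { apply (aa_mono2 (P := fun a => ap h' a ∈ ap g' a) (P' := fun a => ap g a = ap g' a));
      try assumption; try dfn; intros x _ A ->; exact A. }
  assert (Eh' : aa (fun a => ap h a = ap h' a))
    by (apply (aa_mono (P := fun a => ap h' a = ap h a)); try assumption; try dfn; auto).
  assert (K' : aa (fun a => ap h a ∈ ap g a)).
  { apply (aa_mono2 (P := fun a => ap h' a ∈ ap g' a ∧ ap h' a = ap h a) (P' := fun a => ap g a = ap g' a));
      try assumption; try dfn; [apply aa_and; (assumption || dfn)|].
    intros x _ [A <-] ->; exact A. }
  exists h; split; [assumption|]; split; [assumption|]; symmetry; now apply I.
Qed.

Lemma ex_is_collapse t : transitive t → emp ∈ t → ∃ k, is_collapse (fns d t) k.
Proof.
intros Ht H0; pose (c := fns d t).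
pose (E := fun g h => g ∈ c ∧ h ∈ c ∧ aa (fun a => ap g a ∈ ap h a)).
pose (G := fun h f => repl (preds E h) (fun g => ap f g)).
assert (HE : definable (fun e => E (e 0) (e 1))) by (unfold E; dfn).
assert (HP : ∀ s, definable_term s → definable_term (fun e => preds E (s e))).
{ intros s Hs; now apply definable_preds_fixed. }
assert (HG : definable_term (fun e => G (e 0) (e 1))) by (unfold G; dfn).
pose proof (definable_wfrec_fixed HE HG) as HW.
assert (wf : ∀ a, nonempty a → ∃ x, x ∈ a ∧ ∀ y, y ∈ a → ¬ E y x).
{ intros a [x Hx].
  destruct (classic (∃ x, x ∈ a ∧ x ∈ c)) as [[y Hy]|N].
  - destruct (@ultraproduct_wf (fun x y => x ∈ y) ltac:(dfn) mem_wf (inter a c)) as [g [Hg M]].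
    + exists y; now rewrite in_inter.
    + rewrite in_inter in Hg; exists g; split; [tauto|]; intros h Hh [K1 [_ K2]].
      apply (M h); [now apply in_inter|assumption].
  - exists x; split; [assumption|]; intros y Hy [K _]; apply N; eauto. }
assert (sl : ∀ x, ∃ s, x ∈ s ∧ closed_under E s).
{ intros x; exists (cup c (sing x)); rewrite in_cup, in_sing; split; [auto|].
  intros y z _ [Hz _]; rewrite in_cup; auto. }
exists (lam c (fun h => wfrec E G h)); split; [apply is_fun_lam; dfn|].
split; [intros h Hh; unfold c in Hh; rewrite in_fns in Hh; tauto|]; split.
- intros g h Hh Hg K.
  (* Separation by a condition that does not mention the element is a definable conditional. The
     value is [ap g a] where this lies in [ap h a], and empty elsewhere; in both cases it belongs to
     [t]. *)
  exists (lam d (fun a => sep (ap g a) (fun _ => ap g a ∈ ap h a))).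
  assert (Es : ∀ a, ap g a ∈ ap h a → sep (ap g a) (fun _ => ap g a ∈ ap h a) = ap g a).
  { intros a Ha; apply ext; intros z; rewrite in_sep by dfn; tauto. }
  rewrite in_fns in Hh |- *; split.
  + split; [apply is_fun_lam; dfn|]; intros a Ha; rewrite ap_lam by (dfn || assumption).
    destruct (classic (ap g a ∈ ap h a)) as [L|L].
    * rewrite Es by assumption; eapply Ht; [exact L|]; now apply Hh.
    * replace (sep _ _) with (@emp V hV); [assumption|]; apply ext; intros z.
      rewrite in_sep by dfn; split; [intros Hz; case (in_emp Hz)|tauto].
  + apply (aa_mono (P := fun a => ap g a ∈ ap h a)); [dfn|dfn|assumption|].
    intros a Ha L; rewrite ap_lam by (dfn || assumption); now rewrite Es.
- intros h z Hh; rewrite ap_lam by (dfn || assumption); rewrite (wfrec_eq HE HG wf sl).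
  unfold G at 1; rewrite in_repl by dfn; split.
  + intros [g [Hg ->]]; rewrite ap_lam by (dfn || assumption).
    apply (in_preds HE sl) in Hg; destruct Hg as [Hg [_ K]]; exists g.
    now rewrite ap_lam by (dfn || assumption).
  + intros [g [Hg [K ->]]]; exists g.
    assert (L : g ∈ preds E h) by (apply (in_preds HE sl); repeat split; assumption).
    split; [assumption|]; now rewrite !ap_lam by (dfn || assumption).
Qed.

Definition coll f := the (fun x => collapse U d f x).

Lemma definable_coll s : definable_term s → definable_term (fun e => coll (s e)).
Proof. intros; unfold coll, collapse, almost; dfn. Qed.
Hint Resolve definable_coll : definable.

Lemma coll_eq c k f : is_collapse c k → f ∈ c → coll f = ap k f.
Proof.
intros H Hf; apply the_eq; [apply collapse_iff; eauto|].
intros y Hy; rewrite collapse_iff in Hy; destruct Hy as [c' [k' [H' [Hf' ->]]]].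
apply (collapse_agree H' H Hf' Hf), aa_all; [dfn|reflexivity].
Qed.

Lemma ex_fns_collapse f g : is_fun f d → is_fun g d → ∃ t k,
  transitive t ∧ emp ∈ t ∧ is_collapse (fns d t) k ∧ f ∈ fns d t ∧ g ∈ fns d t.
Proof.
intros Hf Hg.
destruct (ex_transitive_superset (cup (repl d (ap f)) (repl d (ap g)))) as [t [Ht [K H0]]].
destruct (ex_is_collapse Ht H0) as [k Hk]; exists t, k; rewrite !in_fns.
repeat (split; [assumption|]); split; (split; [assumption|]).
- intros x Hx; apply K; rewrite in_cup, !in_repl by dfn; eauto.
- intros x Hx; apply K; rewrite in_cup, !in_repl by dfn; eauto.
Qed.

Lemma collapse_coll f : is_fun f d → ∀ x, collapse U d f x ↔ x = coll f.
Proof.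
intros Hf x; destruct (ex_fns_collapse Hf Hf) as [t [k [_ [_ [Hk [Hc _]]]]]]; split.
- intros H; rewrite collapse_iff in H; destruct H as [c' [k' [H' [Hf' ->]]]].
  now rewrite (coll_eq H' Hf').
- intros ->; rewrite collapse_iff; exists (fns d t), k.
  now rewrite (coll_eq Hk Hc).
Qed.

Lemma coll_aa_eq f g : is_fun f d → is_fun g d → aa (fun a => ap f a = ap g a) → coll f = coll g.
Proof.
intros Hf Hg H; destruct (ex_fns_collapse Hf Hg) as [t [k [_ [_ [Hk [Kf Kg]]]]]].
rewrite (coll_eq Hk Kf), (coll_eq Hk Kg); now apply (collapse_agree Hk Hk).
Qed.

Lemma in_coll z g : is_fun g d →
  z ∈ coll g ↔ ∃ f, is_fun f d ∧ aa (fun a => ap f a ∈ ap g a) ∧ z = coll f.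
Proof.
intros Hg; destruct (ex_fns_collapse Hg Hg) as [t [k [_ [_ [Hk [Kg _]]]]]].
pose proof Hk as [H1 [H2 [H3 H4]]]; rewrite (coll_eq Hk Kg), H4 by assumption; split.
- intros [f [Hf [K ->]]]; exists f; rewrite (coll_eq Hk Hf); auto.
- intros [f [Hf [K ->]]]; destruct (H3 f g Kg Hf K) as [f' [Hf' E]]; exists f'.
  split; [assumption|]; split.
  + apply (aa_mono2 (P := fun a => ap f a ∈ ap g a) (P' := fun a => ap f a = ap f' a));
      try assumption; try dfn; intros x _ A <-; exact A.
  + rewrite <- (coll_eq Hk Hf'); apply coll_aa_eq; auto.
Qed.

(** This is extensionality of the ultrapower. Let [p] be minimal such that some [q], different
    modulo [U], has the same collapse. A function [h] choosing from the symmetric difference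
    collapses into both, and minimality of [p] identifies it with a function on the side that it
    avoids. *)
Lemma coll_inj f g : is_fun f d → is_fun g d → coll f = coll g → aa (fun a => ap f a = ap g a).
Proof.
intros Hf Hg E; destruct (ex_fns_collapse Hf Hg) as [t [k [Ht [H0 [Hk [Kf Kg]]]]]].
apply NNPP; intros N.
pose (P := fun f => ∃ g, g ∈ fns d t ∧ coll f = coll g ∧ ¬ aa (fun a => ap f a = ap g a)).
assert (HP : definable (fun e => P (e 0))) by (unfold P; dfn).
destruct (@ultraproduct_wf (fun x y => x ∈ y) ltac:(dfn) mem_wf (sep (fns d t) P)) as [p [Hp M]].
{ exists f; rewrite in_sep by dfn; unfold P; eauto. }
clear f g Hf Hg E Kf Kg N.
rewrite in_sep in Hp by dfn; destruct Hp as [Kp [q [Kq [E N]]]].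
assert (Hp : is_fun p d) by (rewrite in_fns in Kp; tauto).
assert (Hq : is_fun q d) by (rewrite in_fns in Kq; tauto).
(* The first alternative only makes the choice total; almost everywhere [p] and [q] differ, and [h]
   takes a value in exactly one of the two. *)
destruct (@choice_fun _ _ d (fun a z => (ap p a = ap q a ∧ z = emp) ∨
  (z ∈ ap p a ∧ ¬ z ∈ ap q a) ∨ (¬ z ∈ ap p a ∧ z ∈ ap q a))) as [h [Hh K]]; [dfn| |].
{ intros a Ha; destruct (classic (ap p a = ap q a)) as [L|L]; [exists emp; auto|].
  apply NNPP; intros M'; apply L, ext; intros z; apply NNPP; intros O; apply M'; exists z.
  destruct (classic (z ∈ ap p a)), (classic (z ∈ ap q a)); tauto. }
assert (Kh : h ∈ fns d t).
{ rewrite in_fns in *; split; [assumption|]; intros a Ha.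
  destruct (K a Ha) as [[_ L]|[[L _]|[_ L]]]; [now rewrite L| |]; eapply Ht; [exact L|now apply Kp|exact L|now apply Kq]. }
pose proof Hk as [_ [_ [H3 _]]].
apply aa_not in N; [|dfn].
assert (C : aa (fun a => ap h a ∈ ap p a ∧ ¬ ap h a ∈ ap q a) ∨
  aa (fun a => ¬ ap h a ∈ ap p a ∧ ap h a ∈ ap q a)).
{ apply aa_or; [dfn|dfn|].
  apply (aa_mono (P := fun a => ap p a ≠ ap q a)); [dfn|dfn|assumption|].
  intros a Ha L; destruct (K a Ha) as [[L' _]|L']; [contradiction|assumption]. }
assert (I : ∀ u v, u ∈ fns d t → v ∈ fns d t → aa (fun a => ap u a ∈ ap p a) →
  coll u = coll v → aa (fun a => ap u a = ap v a)).
{ intros u v Hu Hv L Ec; apply NNPP; intros N'; apply (M u); [|assumption].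
  rewrite in_sep by dfn; split; [assumption|]; exists v; auto. }
destruct C as [C|C].
- assert (C1 : aa (fun a => ap h a ∈ ap p a))
    by (apply (aa_mono (P := fun a => ap h a ∈ ap p a ∧ ¬ ap h a ∈ ap q a)); try assumption; try dfn; tauto).
  assert (D : coll h ∈ coll q) by (rewrite <- E; apply in_coll; eauto).
  rewrite in_coll in D by assumption; destruct D as [h' [Hh' [D D']]].
  destruct (H3 h' q Kq Hh' D) as [u [Ku Eu]].
  assert (Hu : is_fun u d) by (rewrite in_fns in Ku; tauto).
  assert (L : aa (fun a => ap h a = ap u a)).
  { apply I; auto; rewrite D'; now apply coll_aa_eq. }
  destruct (@aa_ex (fun a => (¬ ap h a ∈ ap q a) ∧ ap h' a ∈ ap q a ∧ ap h' a = ap u a ∧ ap h a = ap u a))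
    as [x [_ [A1 [A2 [A3 A4]]]]]; [dfn| |congruence].
  apply aa_and; [dfn|dfn| |repeat apply aa_and; (assumption || dfn)].
  apply (aa_mono (P := fun a => ap h a ∈ ap p a ∧ ¬ ap h a ∈ ap q a)); try assumption; try dfn; tauto.
- assert (C1 : aa (fun a => ap h a ∈ ap q a))
    by (apply (aa_mono (P := fun a => ¬ ap h a ∈ ap p a ∧ ap h a ∈ ap q a)); try assumption; try dfn; tauto).
  assert (D : coll h ∈ coll p) by (rewrite E; apply in_coll; eauto).
  rewrite in_coll in D by assumption; destruct D as [h' [Hh' [D D']]].
  destruct (H3 h' p Kp Hh' D) as [u [Ku Eu]].
  assert (Hu : is_fun u d) by (rewrite in_fns in Ku; tauto).
  assert (D2 : aa (fun a => ap u a ∈ ap p a)).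
  { apply (aa_mono2 (P := fun a => ap h' a ∈ ap p a) (P' := fun a => ap h' a = ap u a));
      try assumption; try dfn; intros x _ A <-; exact A. }
  assert (L : aa (fun a => ap u a = ap h a)).
  { apply I; auto; rewrite D'; symmetry; now apply coll_aa_eq. }
  destruct (@aa_ex (fun a => (¬ ap h a ∈ ap p a) ∧ ap u a ∈ ap p a ∧ ap u a = ap h a))
    as [x [_ [A1 [A2 A3]]]]; [dfn| |congruence].
  apply aa_and; [dfn|dfn| |repeat apply aa_and; (assumption || dfn)].
  apply (aa_mono (P := fun a => ¬ ap h a ∈ ap p a ∧ ap h a ∈ ap q a)); try assumption; try dfn; tauto.
Qed.

Lemma coll_mem f g : is_fun f d → is_fun g d →
  coll f ∈ coll g ↔ aa (fun a => ap f a ∈ ap g a).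
Proof.
intros Hf Hg; rewrite in_coll by assumption; split; [|eauto].
intros [h [Hh [K E]]]; apply coll_inj in E; [|assumption|assumption].
apply (aa_mono2 (P := fun a => ap h a ∈ ap g a) (P' := fun a => ap f a = ap h a));
  try assumption; try dfn; intros x _ A ->; exact A.
Qed.

End Ultrafilter.
#[export] Hint Extern 1 (definable_term (fun e => coll _ _ _)) => simple apply definable_coll : definable.

(** * Łoś's theorem *)

Lemma val_inj (V : SetStr) (M : V → Prop) (x y : sub M) : val x = val y → x = y.
Proof.
destruct x as [x Hx], y as [y Hy]; simpl; intros E; subst y; f_equal.
apply proof_irrelevance.
Qed.

Section Los.
Context {V : SetStr} {hV : ZFC V}.
Variables U d : V.
Hypothesis HU : Un_on U d.
Implicit Types (f g h : V).
Notation aa := (almost_all U d).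

Lemma Un_on_cc : cc_ultrafilter U d.
Proof. apply HU. Qed.
Let HC := Un_on_cc.

Lemma Un_on_fun d' : Un_on U d' → d' = d.
Proof.
intros H'; apply sub_antisym; [apply (uf_sub HC), (uf_space (proj1 (proj2 H')))|].
apply (uf_sub (proj1 (proj2 H'))), (uf_space HC).
Qed.

Lemma in_Ult_coll f : in_Ult U (coll U d (lam d (ap f))).
Proof.
exists d, (lam d (ap f)); split; [assumption|].
apply collapse_coll; auto; apply is_fun_lam; dfn.
Qed.

(** The passage to [lam d (ap f)] turns any set into a function on [d]. So [cls] is total on [V],
    and each environment of sets yields an environment of the ultrapower. *)
Definition cls f : Ult U := exist _ _ (in_Ult_coll f).

Lemma val_cls f : is_fun f d → val (cls f) = coll U d f.
Proof. intros Hf; unfold val, cls; simpl; now rewrite lam_ap. Qed.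

Lemma cls_surj (y : Ult U) : ∃ f, is_fun f d ∧ y = cls f.
Proof.
destruct y as [x Hx]; pose proof Hx as [d' [f [H K]]]; pose proof (Un_on_fun H); subst d'.
assert (Hf : is_fun f d) by apply K; exists f; split; [assumption|].
apply val_inj; rewrite val_cls by assumption; now apply collapse_coll.
Qed.

Lemma cls_mem f g : cls f ∈ cls g ↔ aa (fun a => ap f a ∈ ap g a).
Proof.
unfold cls; simpl; rewrite (coll_mem HC) by (apply is_fun_lam; dfn).
apply (aa_iff HC); try dfn; intros x Hx; now rewrite !ap_lam by (dfn || assumption).
Qed.

Lemma cls_eq f g : cls f = cls g ↔ aa (fun a => ap f a = ap g a).
Proof.
assert (K : cls f = cls g ↔ coll U d (lam d (ap f)) = coll U d (lam d (ap g))).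
{ split; [intros E; apply (f_equal (@val _ _)) in E; exact E|]; intros E; now apply val_inj. }
rewrite K; split.
- intros E; apply (coll_inj HC) in E; [|apply is_fun_lam; dfn|apply is_fun_lam; dfn].
  revert E; apply (aa_imp HC); try dfn; intros x Hx; now rewrite !ap_lam by (dfn || assumption).
- intros E; apply (coll_aa_eq HC); [apply is_fun_lam; dfn|apply is_fun_lam; dfn|].
  revert E; apply (aa_imp HC); try dfn; intros x Hx; now rewrite !ap_lam by (dfn || assumption).
Qed.

Theorem los (p : form) : ∀ e : nat → V,
  sat (fun n => cls (e n)) p ↔ aa (fun a => sat (fun n => ap (e n) a) p).
Proof.
assert (D : ∀ (p : form) (e : nat → V),
  definable (fun e' : nat → V => sat (fun n => ap (e n) (e' 0)) p)).
{ intros q e; apply (definable_sat q (t := fun n e' => ap (e n) (e' 0))); dfn. }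
assert (S : ∀ (M : SetStr) (A : Type) (F : A → M) (x : A) (e : nat → A) q,
  sat (fun n => F (scons x e n)) q ↔ sat (scons (F x) (fun n => F (e n))) q).
{ intros M A F x e q; replace (scons _ _) with (fun n => F (scons x e n)); [tauto|].
  apply functional_extensionality; now intros [|n]. }
induction p as [i j|i j|p IH|p IHp q IHq|p IH]; intros e; simpl.
- apply cls_mem.
- apply cls_eq.
- rewrite IH; symmetry; apply (aa_not HC), D.
- rewrite IHp, IHq; split.
  + intros []; apply (aa_and HC); auto.
  + intros H; split; revert H; apply (aa_imp HC); auto; try tauto;
      apply definable_and; auto.
- assert (D' : definable (fun e' : nat → V => ∀ x, sat (scons x (fun n => ap (e n) (e' 0))) p)).
  { exact (D (FAll p) e). }
  split.
  + intros H; apply NNPP; intros N; apply (aa_not HC) in N; [|assumption].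
    assert (D2 : definable (fun e' : nat → V => sat (scons (e' 1) (fun n => ap (e n) (e' 0))) p)).
    { apply (@definable_iff _ (fun e' => sat (fun n =>
        match n with O => e' 1 | S m => ap (e m) (e' 0) end) p)).
      - apply (definable_sat p (t := fun n e' => match n with O => e' 1 | S m => ap (e m) (e' 0) end)).
        intros [|n]; dfn.
      - intros e'; replace (scons _ _) with
          (fun n => match n with O => e' 1 | S m => ap (e m) (e' 0) end); [tauto|].
        apply functional_extensionality; now intros [|n]. }
    (* [f] picks a counterexample at [a] whenever there is one; the implication makes the chosen
       relation total. If [f] satisfies the formula almost everywhere, then the universal statement
       holds almost everywhere. *)
    destruct (@choice_fun _ _ d (fun a x => sat (scons x (fun n => ap (e n) a)) p →
      ∀ x, sat (scons x (fun n => ap (e n) a)) p)) as [f [Hf K]].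
    * apply definable_imp; [exact D2|exact D'].
    * intros a Ha; destruct (classic (∀ x, sat (scons x (fun n => ap (e n) a)) p)) as [L|L];
        [exists a; auto|].
      apply not_all_ex_not in L; destruct L as [x L]; exists x; tauto.
    * specialize (H (cls f)); rewrite <- S, IH in H.
      destruct (@aa_ex _ _ _ _ HC (fun a => (¬ ∀ x, sat (scons x (fun n => ap (e n) a)) p) ∧
        sat (fun n => ap (scons f e n) a) p)) as [a [Ha [L L']]].
      -- apply definable_and; [apply definable_not, D'|apply D].
      -- apply (aa_and HC); auto; apply definable_not, D'.
      -- apply L, K; [assumption|]; now apply (S V V (fun f => ap f a)).
  + intros H y; destruct (cls_surj y) as [f [_ ->]]; rewrite <- S, IH.
    revert H; apply (aa_imp HC); auto.
    intros a _ H; apply (S V V (fun f => ap f a)); auto.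
Qed.

Lemma los_uniform (P : ∀ M : SetStr, (nat → M) → Prop) e : uniform P →
  P (Ult U) (fun n => cls (e n)) ↔ aa (fun a => P V (fun n => ap (e n) a)).
Proof.
intros [p H]; rewrite <- (H (Ult U)), los.
assert (D : definable (fun e' : nat → V => sat (fun n => ap (e n) (e' 0)) p))
  by (apply (definable_sat p (t := fun n e' => ap (e n) (e' 0))); dfn).
assert (D' : definable (fun e' : nat → V => P V (fun n => ap (e n) (e' 0))))
  by (apply (definable_iff D); intros e'; apply H).
split; apply (aa_imp HC); auto; intros a _; apply H.
Qed.

Lemma los_true (P : ∀ M : SetStr, (nat → M) → Prop) : uniform P →
  (∀ e, P V e) → ∀ e, P (Ult U) e.
Proof.
intros HP H e.
pose (r := fun n => proj1_sig (constructive_indefinite_description _ (cls_surj (e n)))).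
assert (E : e = fun n => cls (r n)).
{ apply functional_extensionality; intros n; unfold r.
  now destruct (constructive_indefinite_description _ _) as [f [Hf Ef]]. }
rewrite E, los_uniform by assumption; apply (aa_all HC); auto.
destruct HP as [p HP].
apply (@definable_iff _ (fun e' : nat → V => sat (fun n => ap (r n) (e' 0)) p));
  [|intros e'; apply HP].
apply (definable_sat p (t := fun n e' => ap (r n) (e' 0))); dfn.
Qed.

Lemma los1 (P : ∀ M : SetStr, M → Prop) f : (∀ i, uniform (fun M e => P M (e i))) →
  P (Ult U) (cls f) ↔ aa (fun a => P V (ap f a)).
Proof. intros H; exact (los_uniform (fun _ => f) (H 0)). Qed.

Lemma los2 (P : ∀ M : SetStr, M → M → Prop) f g : (∀ i j, uniform (fun M e => P M (e i) (e j))) →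
  P (Ult U) (cls f) (cls g) ↔ aa (fun a => P V (ap f a) (ap g a)).
Proof.
intros H; exact (los_uniform (fun n => match n with 0 => f | _ => g end) (H 0 1)).
Qed.

Lemma los3 (P : ∀ M : SetStr, M → M → M → Prop) f g h :
  (∀ i j k, uniform (fun M e => P M (e i) (e j) (e k))) →
  P (Ult U) (cls f) (cls g) (cls h) ↔ aa (fun a => P V (ap f a) (ap g a) (ap h a)).
Proof.
intros H; exact (los_uniform (fun n => match n with 0 => f | 1 => g | _ => h end) (H 0 1 2)).
Qed.

(** Each axiom, and each instance of a scheme, is uniform and hence transfers. All results about
    models of ZFC then apply inside the ultrapower, in particular to ultrapowers formed there. *)
Instance ZFC_Ult : ZFC (Ult U).
Proof.
assert (E0 : ∀ P : SetStr → Prop, uniform (fun M _ => P M) → P V → P (Ult U)).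
{ intros P HP H; apply (los_true HP (fun _ => H) (fun _ => cls U)). }
constructor.
- apply (E0 (fun M => ∀ x y : M, (∀ z, z ∈ x ↔ z ∈ y) → x = y)); [uniform|apply (zfc_extensionality hV)].
- apply (E0 (fun M => ∀ x : M, nonempty x → ∃ y, y ∈ x ∧ ∀ z, z ∈ y → ¬ z ∈ x));
    [uniform|apply (zfc_foundation hV)].
- apply (E0 (fun M => ∀ x y : M, ∃ p, is_upair x y p)); [uniform|apply (zfc_pairing hV)].
- apply (E0 (fun M => ∀ x : M, ∃ u, ∀ z, z ∈ u ↔ ∃ y, y ∈ x ∧ z ∈ y));
    [uniform|apply (zfc_union hV)].
- apply (E0 (fun M => ∀ x : M, ∃ p, ∀ z, z ∈ p ↔ z ⊆ x)); [uniform|apply (zfc_powerset hV)].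
- apply (E0 (fun M => ∃ x : M, (∃ y, is_empty y ∧ y ∈ x) ∧
    ∀ y, y ∈ x → ∃ z, is_succ y z ∧ z ∈ x)); [uniform|apply (zfc_infinity hV)].
- intros phi env; revert env.
  apply (@los_true (fun M env => ∀ a : M, ∃ b, ∀ x, x ∈ b ↔ x ∈ a ∧ sat (scons x env) phi));
    [|intros env; apply (zfc_separation hV)].
  pose proof (uniform_sat_scons phi (fun n => S (S (S n))) 0); uniform.
- intros phi env; revert env.
  apply (@los_true (fun M env => ∀ a : M,
    (∀ x, x ∈ a → ∀ y z, sat (scons y (scons x env)) phi →
                         sat (scons z (scons x env)) phi → y = z) →
    ∃ b, ∀ y, y ∈ b ↔ ∃ x, x ∈ a ∧ sat (scons y (scons x env)) phi));
    [|intros env; apply (zfc_replacement hV)].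
  pose proof (uniform_sat_scons2 phi (fun n => S (S (S (S n))))); uniform.
- apply (E0 (fun M => ∀ a : M, (∀ x, x ∈ a → nonempty x) →
    (∀ x y, x ∈ a → y ∈ a → (∃ z, z ∈ x ∧ z ∈ y) → x = y) →
    ∃ c, ∀ x, x ∈ a → ∃ z, (z ∈ x ∧ z ∈ c) ∧ ∀ z', z' ∈ x ∧ z' ∈ c → z = z'));
    [uniform|apply (zfc_choice hV)].
Qed.

Definition ultj (x : V) := cls (lam d (fun _ => x)).
Definition ultid := cls (lam d (fun a => a)).

Lemma ult_embed_iff (x : V) (y : Ult U) : ult_embed x y ↔ y = ultj x.
Proof.
assert (K : ∀ f, is_const d x f ↔ f = lam d (fun _ => x)).
{ intros f; split.
  - intros [Hf L]; apply (fun_ext Hf); [apply is_fun_lam; dfn|]; intros a Ha.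
    rewrite ap_lam by (dfn || assumption); apply (L a); now apply (app_ap _ _ Hf).
  - intros ->; split; [apply is_fun_lam; dfn|]; intros a y'; rewrite app_lam by dfn; tauto. }
assert (F : is_fun (lam d (fun _ => x)) d) by (apply is_fun_lam; dfn).
split.
- intros [d' [f [H1 [H2 H3]]]]; pose proof (Un_on_fun H1); subst d'.
  rewrite K in H2; subst f; apply val_inj; unfold ultj; rewrite val_cls by assumption.
  now apply collapse_coll.
- intros ->; exists d, (lam d (fun _ => x)); rewrite K; repeat (split; [auto; fail|]).
  unfold ultj; rewrite val_cls by assumption; now apply collapse_coll.
Qed.

Lemma ult_id_iff (y : Ult U) : ult_id y ↔ y = ultid.
Proof.
assert (K : ∀ f, is_id d f ↔ f = lam d (fun a => a)).
{ intros f; split.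
  - intros [Hf L]; apply (fun_ext Hf); [apply is_fun_lam; dfn|]; intros a Ha.
    rewrite ap_lam by (dfn || assumption); apply (L a); now apply (app_ap _ _ Hf).
  - intros ->; split; [apply is_fun_lam; dfn|]; intros a y'; rewrite app_lam by dfn; tauto. }
assert (F : is_fun (lam d (fun a => a)) d) by (apply is_fun_lam; dfn).
split.
- intros [d' [f [H1 [H2 H3]]]]; pose proof (Un_on_fun H1); subst d'.
  rewrite K in H2; subst f; apply val_inj; unfold ultid; rewrite val_cls by assumption.
  now apply collapse_coll.
- intros ->; exists d, (lam d (fun a => a)); rewrite K; repeat (split; [auto; fail|]).
  unfold ultid; rewrite val_cls by assumption; now apply collapse_coll.
Qed.

End Los.

(** * Absoluteness of the natural sum *)

Section Absolute.
Context {V : SetStr} {hV : ZFC V}.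
Variable M : V → Prop.
Hypothesis M_trans : ∀ x y : V, x ∈ y → M y → M x.
Context {hM : ZFC (sub M)}.
Implicit Types a b c d f x y z : sub M.

Lemma val_lift (u : V) a : u ∈ val a → ∃ x, u = val x.
Proof. intros H; now exists (exist M u (M_trans H (proj2_sig a))). Qed.

Lemma val_in x : M (val x).
Proof. exact (proj2_sig x). Qed.

Lemma val_mem x y : x ∈ y ↔ val x ∈ val y.
Proof. reflexivity. Qed.

Lemma val_iff (P : V → Prop) a : (∀ u, P u → M u) → (∀ x, x ∈ a ↔ P (val x)) →
  ∀ u, u ∈ val a ↔ P u.
Proof.
intros HP H u; split.
- intros Hu; destruct (val_lift Hu) as [x ->]; now apply H.
- intros Hu; apply (H (exist M u (HP u Hu))); exact Hu.
Qed.

Lemma val_emp : val (@emp (sub M) _) = emp.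
Proof.
apply ext; intros u; split; intros H; [|case (in_emp H)].
destruct (val_lift H) as [x ->]; case (in_emp (x := x) H).
Qed.

Lemma val_upair x y : val (upair x y) = upair (val x) (val y).
Proof.
apply ext; intros u; rewrite in_upair; revert u; apply val_iff.
- intros u [-> | ->]; apply val_in.
- intros z; rewrite in_upair; split; intros [H|H]; [left|right|left|right];
    try now apply val_inj; now subst.
  all: now subst.
Qed.

Lemma val_succ x : val (succ x) = succ (val x).
Proof.
apply ext; intros u; rewrite in_succ; revert u; apply val_iff.
- intros u [H | ->]; [eapply M_trans; [exact H|]|]; apply val_in.
- intros z; rewrite in_succ; split; (intros [H|H]; [now left|right]);
    [now subst|now apply val_inj].
Qed.

Lemma val_opair x y : val (opair x y) = opair (val x) (val y).
Proof. unfold opair, sing; now rewrite !val_upair. Qed.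

Lemma app_val f x y : app f x y ↔ app (val f) (val x) (val y).
Proof. rewrite !app_iff, <- val_opair; apply val_mem. Qed.

Lemma app_val_lift f (u v : V) : app (val f) u v → ∃ x y, u = val x ∧ v = val y ∧ app f x y.
Proof.
intros H; pose proof H as K; rewrite app_iff in K.
assert (L : M (upair u v)).
{ apply (@M_trans (upair u v) (opair u v)); [unfold opair; rewrite in_upair; auto|].
  apply (M_trans K), val_in. }
assert (Mu : M u) by (apply (@M_trans u (upair u v)); [rewrite in_upair; auto|assumption]).
assert (Mv : M v) by (apply (@M_trans v (upair u v)); [rewrite in_upair; auto|assumption]).
exists (exist M u Mu), (exist M v Mv); rewrite app_val; auto.
Qed.

Lemma is_fun_val f d : is_fun f d → is_fun (val f) (val d).
Proof.
intros [H1 [H2 H3]]; split; [|split].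
- intros p Hp; destruct (val_lift Hp) as [q ->]; destruct (H1 q Hp) as [x [y K]].
  rewrite is_opair_iff in K; exists (val x), (val y); rewrite is_opair_iff, K; apply val_opair.
- intros u; split.
  + intros Hu; destruct (val_lift Hu) as [x ->]; apply H2 in Hu; destruct Hu as [y Hy].
    exists (val y); now apply app_val.
  + intros [v Hv]; destruct (app_val_lift Hv) as [x [y [-> [_ K]]]]; apply val_mem, H2; eauto.
- intros u v w Hv Hw; destruct (app_val_lift Hv) as [x [y [-> [-> K]]]].
  destruct (app_val_lift Hw) as [x' [z [E [-> L]]]]; apply val_inj in E; subst x'.
  f_equal; eauto.
Qed.

Lemma ordinal_val x : ordinal x ↔ ordinal (val x).
Proof.
split; intros [T L]; split.
- intros u v Hv Hu; destruct (val_lift Hu) as [y ->]; destruct (val_lift Hv) as [z ->].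
  now apply (T y z).
- intros u v Hu Hv; destruct (val_lift Hu) as [y ->]; destruct (val_lift Hv) as [z ->].
  destruct (L y z Hu Hv) as [K|[K|K]]; [auto|subst; auto|auto].
- intros y z Hz Hy; now apply (T (val y) (val z)).
- intros y z Hy Hz; destruct (L (val y) (val z) Hy Hz) as [K|[K|K]];
    [auto|right; left; now apply val_inj|auto].
Qed.

Lemma is_empty_val x : is_empty x ↔ is_empty (val x).
Proof.
rewrite !is_empty_emp, <- val_emp; split; [now intros ->|apply val_inj].
Qed.

Lemma limit_ordinal_val x : limit_ordinal x ↔ limit_ordinal (val x).
Proof.
unfold limit_ordinal; rewrite <- ordinal_val, !nonempty_iff, <- val_emp.
split; intros [Ho [Hn H]]; (split; [assumption|]); split.
- intros E; apply Hn; now apply val_inj.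
- intros u Hu; destruct (val_lift Hu) as [y ->]; destruct (H y Hu) as [z [K L]].
  exists (val z); rewrite is_succ_iff in K; subst z; rewrite is_succ_iff; split; [apply val_succ|exact L].
- intros ->; now apply Hn.
- intros y Hy; exists (succ y); rewrite is_succ_iff; split; [reflexivity|].
  destruct (H (val y) Hy) as [v [K L]]; rewrite is_succ_iff in K; subst v.
  apply val_mem; now rewrite val_succ.
Qed.

Lemma val_omega : val (@omega (sub M) _) = omega.
Proof.
apply is_omega_iff; destruct (@omega_spec (sub M) _) as [H K]; split.
- now apply limit_ordinal_val.
- intros u Hu; destruct (val_lift Hu) as [y ->]; rewrite <- limit_ordinal_val; now apply K.
Qed.

Lemma ordrec_val z (step : sub M → sub M → Prop) (step' : V → V → Prop) b y :
  (∀ u v, step u v → step' (val u) (val v)) →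
  ordrec z step b y → ordrec (val z) step' (val b) (val y).
Proof.
intros S [d [f [H1 [H2 [H3 H4]]]]]; rewrite is_succ_iff in H1; subst d.
exists (val (succ b)), (val f); split; [rewrite is_succ_iff; apply val_succ|].
split; [now apply is_fun_val|]; split; [now apply app_val|].
intros u w Hw; destruct (app_val_lift Hw) as [x [v [-> [-> K]]]].
destruct (H4 x v K) as [K1 [K2 K3]]; split; [|split].
- rewrite <- is_empty_val; intros E; now rewrite (K1 E).
- intros u Hu; rewrite is_succ_iff in Hu.
  assert (L : u ∈ val x) by (rewrite Hu; apply in_succ_self).
  destruct (val_lift L) as [p ->]; destruct (K2 p) as [q [K4 K5]].
  + rewrite is_succ_iff; apply val_inj; now rewrite val_succ.
  + exists (val q); split; [now apply app_val|auto].
- rewrite <- limit_ordinal_val; intros L t; specialize (K3 L); split.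
  + intros Ht; destruct (val_lift Ht) as [t' ->].
    destruct (proj1 (K3 t') Ht) as [p [q [A [B C]]]]; exists (val p), (val q).
    rewrite <- app_val; auto.
  + intros [p [q [A [B C]]]]; destruct (app_val_lift B) as [p' [q' [-> [-> B']]]].
    destruct (val_lift C) as [t' ->]; apply val_mem, K3; exists p', q'.
    exact (conj A (conj B' C)).
Qed.

Lemma oadd_val a b c : oadd a b c → oadd (val a) (val b) (val c).
Proof.
apply ordrec_val; intros u v; rewrite !is_succ_iff; intros ->; apply val_succ.
Qed.

Lemma omul_val a b c : omul a b c → omul (val a) (val b) (val c).
Proof.
intros [z [Hz H]]; exists (val z); split; [now apply is_empty_val|].
revert H; apply ordrec_val; intros u v; apply oadd_val.
Qed.

Lemma oexp_val a b c : oexp a b c → oexp (val a) (val b) (val c).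
Proof.
intros [z [i [Hz [Hi H]]]]; exists (val z), (val i); split; [now apply is_empty_val|].
split; [rewrite is_succ_iff in Hi; subst i; rewrite is_succ_iff; apply val_succ|].
revert H; apply ordrec_val; intros u v; apply omul_val.
Qed.

Lemma cnf_val a n e c : cnf a n e c → cnf (val a) (val n) (val e) (val c).
Proof.
intros [w [s [n' [Hw [Hn [Hn' [He [Hc [Hs [H1 [H2 [H3 [H4 [H5 H6]]]]]]]]]]]]]].
exists (val w), (val s), (val n').
rewrite is_omega_iff in Hw; subst w; rewrite is_succ_iff in Hn'; subst n'.
split; [rewrite is_omega_iff; apply val_omega|]; split; [exact Hn|].
split; [rewrite is_succ_iff; apply val_succ|].
do 3 (split; [now apply is_fun_val|]).
split; [|split; [|split; [|split; [|split]]]].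
- intros u v Hu; destruct (app_val_lift Hu) as [i [g [-> [-> K]]]].
  rewrite <- ordinal_val; eauto.
- intros u v p q Hu Hv; destruct (app_val_lift Hu) as [i [x [-> [-> K]]]].
  destruct (app_val_lift Hv) as [j [y [-> [-> L]]]]; apply (H2 i j x y K L).
- intros u v Hu; destruct (app_val_lift Hu) as [i [k [-> [-> K]]]].
  destruct (H3 i k K) as [L [t Ht]]; split; [exact L|]; exists (val t); exact Ht.
- intros u v Hu Hv; destruct (app_val_lift Hv) as [z [x [-> [-> K]]]].
  rewrite <- is_empty_val in Hu |- *; eauto.
- intros u u' p q Hu Hu' Hp Hq; destruct (app_val_lift Hp) as [i [x [-> [-> K]]]].
  destruct (app_val_lift Hq) as [i' [y [-> [-> L]]]].
  destruct (H5 i i' x y Hu) as [g [k [r [t [A1 [A2 [A3 [A4 A5]]]]]]]]; auto.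
  { rewrite is_succ_iff in Hu'; rewrite is_succ_iff; apply val_inj; now rewrite val_succ. }
  exists (val g), (val k), (val r), (val t); rewrite <- !app_val.
  do 2 (split; [assumption|]); split; [now apply oexp_val|].
  split; [now apply omul_val|now apply oadd_val].
- now apply app_val.
Qed.

Lemma coefficient_val a g k : coefficient a g k → coefficient (val a) (val g) (val k).
Proof.
intros [n [e [c [H K]]]]; exists (val n), (val e), (val c); split; [now apply cnf_val|].
destruct K as [[i [K L]]|[K L]].
- left; exists (val i); now rewrite <- !app_val.
- right; split; [now apply is_empty_val|]; intros [u Hu].
  destruct (app_val_lift Hu) as [i [g' [-> [E Hi]]]]; apply val_inj in E; subst; eauto.
Qed.

Lemma coefficient_val_out a g k (u : V) : coefficient a g k → ¬ M u → coefficient (val a) u emp.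
Proof.
intros [n [e [c [H _]]]] Hu; exists (val n), (val e), (val c); split; [now apply cnf_val|].
right; split; [now apply is_empty_emp|]; intros [v Hv].
destruct (app_val_lift Hv) as [i [g' [_ [-> _]]]]; apply Hu, val_in.
Qed.

(** The definition of the sum of ultrafilters adds ordinals in [V], while Łoś's theorem computes the
    sum in the inner model. As natural sums are unique, this one direction of absoluteness makes the
    two agree. *)
Lemma natural_sum_val a b c : natural_sum a b c → natural_sum (val a) (val b) (val c).
Proof.
intros [Ha [Hb [Hc H]]]; do 3 (split; [now apply ordinal_val|]); intros u Hu.
destruct (classic (M u)) as [K|K].
- pose (g := exist M u K); destruct (H g) as [k [l [m [A1 [A2 [A3 A4]]]]]].
  { now apply ordinal_val. }
  exists (val k), (val l), (val m); change u with (val g).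
  repeat (split; [now apply coefficient_val|]); now apply oadd_val.
(* [M] is not assumed to contain all ordinals. At an exponent outside [M] the three coefficients
   vanish, since normal forms found in [M] have exponents in [M]. The exponent 0 is taken only to
   obtain such normal forms. *)
- destruct (H emp ordinal_emp) as [k [l [m [A1 [A2 [A3 A4]]]]]].
  exists emp, emp, emp.
  repeat (split; [eapply coefficient_val_out; eauto|]).
  rewrite oadd_iff by apply ordinal_emp; now rewrite add_emp.
Qed.

End Absolute.

(** * Constructions of ultrafilters *)

Section Constructions.
Context {V : SetStr} {hV : ZFC V}.
Implicit Types (a b c d f g h x y z : V).

Lemma uf_up U d x y : cc_ultrafilter U d → x ∈ U → x ⊆ y → y ⊆ d → y ∈ U.
Proof. intros [[_ [_ [_ [H _]]]] _]; apply H. Qed.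

Lemma uf_inter U d x y : cc_ultrafilter U d → x ∈ U → y ∈ U → inter x y ∈ U.
Proof.
intros [[_ [_ [_ [_ [H _]]]]] _] Hx Hy; apply (H x y _ Hx Hy); now apply is_inter_iff.
Qed.

Lemma uf_emp U d : cc_ultrafilter U d → ¬ emp ∈ U.
Proof. intros [[_ [_ [H _]]] _] K; destruct (H _ K) as [x Hx]; case (in_emp Hx). Qed.

Lemma uf_diff U d x : cc_ultrafilter U d → x ⊆ d → ¬ x ∈ U → diff d x ∈ U.
Proof.
intros [[_ [_ [_ [_ [_ H]]]]] _] Hx K.
destruct (H x (diff d x) Hx); [now apply is_diff_iff|contradiction|assumption].
Qed.

Lemma uf_count U d f : cc_ultrafilter U d → is_fun f omega → (∀ n, n ∈ omega → ap f n ∈ U) →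
  sep d (fun x => ∀ n, n ∈ omega → x ∈ ap f n) ∈ U.
Proof.
intros [_ H] Hf K; apply (H omega f); [apply omega_spec|assumption| |].
- intros n X; rewrite (app_ap _ _ Hf); intros [Hn ->]; auto.
- intros x; rewrite in_sep by dfn; split; (intros [Hx L]; split; [assumption|]).
  + intros n X; rewrite (app_ap _ _ Hf); intros [Hn ->]; auto.
  + intros n Hn; apply (L n); now apply (app_ap _ _ Hf).
Qed.

Lemma uf_union U d : cc_ultrafilter U d → union U = d.
Proof.
intros H; apply sub_antisym; intros z; rewrite in_union.
- intros [y [Hy Hz]]; eapply (uf_sub H); eauto.
- intros Hz; exists d; split; [apply (uf_space H)|assumption].
Qed.

Lemma aa_mem U d x : cc_ultrafilter U d → x ⊆ d → almost_all U d (fun a => a ∈ x) ↔ x ∈ U.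
Proof.
intros H Hx; unfold almost_all; replace (sep d (fun a => a ∈ x)) with x; [tauto|].
apply ext; intros z; rewrite in_sep by dfn; split; [auto|tauto].
Qed.

Lemma cc_intro d (P : V → Prop) : definable (fun e => P (e 0)) → P d → ¬ P emp →
  (∀ x y, P x → x ⊆ y → y ⊆ d → P y) →
  (∀ x y, P x → P y → P (inter x y)) →
  (∀ x, x ⊆ d → P x ∨ P (diff d x)) →
  (∀ f, is_fun f omega → (∀ n, n ∈ omega → P (ap f n)) →
    P (sep d (fun x => ∀ n, n ∈ omega → x ∈ ap f n))) →
  cc_ultrafilter (sep (pow d) P) d.
Proof.
intros HP H1 H2 H3 H4 H5 H6.
assert (K : ∀ x, x ∈ sep (pow d) P ↔ x ⊆ d ∧ P x).
{ intros x; rewrite in_sep, in_pow by dfn; tauto. }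
split; [split; [|split; [|split; [|split; [|split]]]]|].
- intros x; rewrite K; tauto.
- apply K; auto.
- intros x; rewrite K, nonempty_iff; intros [_ Hx] ->; contradiction.
- intros x y; rewrite !K; intros [Hx Px] Hxy Hy; split; [assumption|]; eapply H3; eauto.
- intros x y i; rewrite !K, is_inter_iff; intros [Hx Px] [Hy Py] ->; split; auto.
  intros z; rewrite in_inter; intros []; auto.
- intros x y Hx Hy; rewrite is_diff_iff in Hy; subst y; rewrite !K.
  destruct (H5 x Hx); [left; auto|right; split; [|assumption]].
  intros z; rewrite in_diff; tauto.
- intros w f i Hw Hf Hn Hi; rewrite is_omega_iff in Hw; subst w.
  replace i with (sep d (fun x => ∀ n, n ∈ omega → x ∈ ap f n)).
  + apply K; split; [intros z; rewrite in_sep by dfn; tauto|].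
    apply H6; [assumption|]; intros n Hn'; apply (K (ap f n)), (Hn n).
    now apply (app_ap _ _ Hf).
  + apply ext; intros x; rewrite Hi, in_sep by dfn.
    split; (intros [Hx L]; split; [assumption|]).
    * intros n X; rewrite (app_ap _ _ Hf); intros [Hn' ->]; auto.
    * intros n Hn'; apply (L n); now apply (app_ap _ _ Hf).
Qed.

Lemma cc_principal d x : x ∈ d → cc_ultrafilter (sep (pow d) (fun y => x ∈ y)) d.
Proof.
intros Hx; apply cc_intro; auto; [dfn|apply in_emp| | |].
- intros y z; rewrite in_inter; auto.
- intros y Hy; rewrite in_diff; destruct (classic (x ∈ y)); auto.
- intros f Hf H; rewrite in_sep by dfn; auto.
Qed.

(** Push-forwards, sums of ultrafilters and compositions of Ketonen witnesses are all instances of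
    this limit. Countable completeness is inherited because countably many large sets can be handled
    first at almost every [a] and then inside [g a]. *)
Lemma cc_limit U d (g e : V → V) c : cc_ultrafilter U d →
  definable_term (fun v => g (v 0)) → definable_term (fun v => e (v 0)) →
  almost_all U d (fun a => cc_ultrafilter (g a) (e a) ∧ e a ⊆ c) →
  cc_ultrafilter (sep (pow c) (fun x => almost_all U d (fun a => inter x (e a) ∈ g a))) c.
Proof.
intros H Hg He K; apply cc_intro; [dfn| | | | | |].
- apply (aa_mono H (P := fun a => cc_ultrafilter (g a) (e a) ∧ e a ⊆ c)); try dfn; auto.
  intros a _ [K1 K2]; replace (inter c (e a)) with (e a); [apply (uf_space K1)|].
  apply ext; intros z; rewrite in_inter; split; [auto|tauto].
- intros L; destruct (aa_ex H (P := fun a => (cc_ultrafilter (g a) (e a) ∧ e a ⊆ c) ∧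
    inter emp (e a) ∈ g a)) as [a [_ [[K1 _] K2]]]; [dfn|apply (aa_and H); (assumption || dfn)|].
  apply (uf_emp K1); replace emp with (inter emp (e a)); [assumption|].
  apply ext; intros z; rewrite in_inter; split; [tauto|intros Hz; case (in_emp Hz)].
- intros x y Hx Hxy Hy.
  apply (aa_mono2 H (P := fun a => cc_ultrafilter (g a) (e a) ∧ e a ⊆ c)
    (P' := fun a => inter x (e a) ∈ g a)); try dfn; auto.
  intros a _ [K1 _] K2; apply (uf_up K1 K2); intros z; rewrite !in_inter; intuition.
- intros x y Hx Hy.
  apply (aa_mono2 H (P := fun a => cc_ultrafilter (g a) (e a) ∧ e a ⊆ c)
    (P' := fun a => inter x (e a) ∈ g a ∧ inter y (e a) ∈ g a)); try dfn; auto.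
  { apply (aa_and H); auto; dfn. }
  intros a _ [K1 _] [K2 K3]; apply (uf_up K1 (uf_inter K1 K2 K3));
    intros z; rewrite !in_inter; tauto.
- intros x Hx; destruct (classic (almost_all U d (fun a => inter x (e a) ∈ g a))) as [L|L]; [auto|right].
  apply (aa_not H) in L; [|dfn].
  apply (aa_mono2 H (P := fun a => cc_ultrafilter (g a) (e a) ∧ e a ⊆ c)
    (P' := fun a => ¬ inter x (e a) ∈ g a)); try dfn; auto.
  intros a _ [K1 K2] K3; apply (uf_diff K1) in K3; [|intros z; rewrite in_inter; tauto].
  apply (uf_up K1 K3); intros z; rewrite ?in_inter, ?in_diff, ?in_inter; intuition.
- intros f Hf L; apply (aa_omega H (P := fun n a => inter (ap f n) (e a) ∈ g a)) in L; [|dfn].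
  apply (aa_mono2 H (P := fun a => cc_ultrafilter (g a) (e a) ∧ e a ⊆ c)
    (P' := fun a => ∀ n, n ∈ omega → inter (ap f n) (e a) ∈ g a)); try dfn; auto.
  intros a _ [K1 K2] K3.
  assert (D : definable_term (fun v : nat → V => inter (ap f (v 0)) (e a))) by dfn.
  assert (M : sep (e a) (fun x => ∀ n, n ∈ omega →
    x ∈ ap (lam omega (fun n => inter (ap f n) (e a))) n) ∈ g a).
  { apply (uf_count K1); [now apply is_fun_lam|].
    intros n Hn; rewrite ap_lam by assumption; auto. }
  apply (uf_up K1 M); intros z; rewrite ?in_inter, !in_sep by dfn; [|tauto].
  intros [Hz Hn]; split; [|assumption]; split; [auto|]; intros n Hn'.
  specialize (Hn n Hn'); rewrite ap_lam, in_inter in Hn by (dfn || assumption); tauto.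
Qed.

(** The push-forward is the limit of the principal ultrafilters at the points [h a]. *)
Lemma cc_push U d (h : V → V) c : cc_ultrafilter U d → definable_term (fun v => h (v 0)) →
  almost_all U d (fun a => h a ∈ c) →
  cc_ultrafilter (sep (pow c) (fun x => almost_all U d (fun a => h a ∈ x))) c.
Proof.
intros H Hh K.
assert (L : cc_ultrafilter (sep (pow c) (fun x => almost_all U d (fun a =>
  inter x c ∈ sep (pow c) (fun y => h a ∈ y)))) c).
{ apply (cc_limit (g := fun a => sep (pow c) (fun y => h a ∈ y)) (e := fun _ => c) H);
    [dfn|dfn|].
  apply (aa_mono H (P := fun a => h a ∈ c)); try dfn; auto.
  intros a _ Ha; split; [now apply cc_principal|auto]. }
match type of L with cc_ultrafilter ?A _ => replace (sep _ _) with A; [assumption|] end.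
apply ext; intros x; rewrite !in_sep, in_pow by dfn; split; intros [Hx M]; split; auto;
  revert M; apply (aa_imp H); try dfn; intros a _; rewrite in_sep, in_pow, in_inter by dfn; [tauto|].
intros Ha; repeat split; auto; intros z; rewrite in_inter; tauto.
Qed.

Definition uniformization U d := the (fun b => (ordinal b ∧ b ∈ U) ∧ ∀ c, c ∈ b → ¬ c ∈ U).

Lemma definable_uniformization (s t : (nat → V) → V) : definable_term s → definable_term t →
  definable_term (fun e => uniformization (s e) (t e)).
Proof. unfold uniformization; dfn. Qed.

(** Since [b] is the least ordinal in [U], no [c] below [b] is large, so its complement is; this is
    uniformity of the trace of [U] on [b]. *)
Lemma uniformization_spec U d b : cc_ultrafilter U d → ordinal d → b = uniformization U d →
  ordinal b ∧ b ∈ U ∧ b ⊆ d ∧ (∀ c, c ∈ b → ¬ c ∈ U) ∧ Un_on (sep U (fun x => x ⊆ b)) b.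
Proof.
intros H Hd Eb.
assert (K : (ordinal b ∧ b ∈ U) ∧ ∀ c, c ∈ b → ¬ c ∈ U).
{ rewrite Eb; apply (the_spec (P := fun b => (ordinal b ∧ b ∈ U) ∧ ∀ c, c ∈ b → ¬ c ∈ U)).
  destruct (@ordinal_min _ _ (fun b => b ∈ U)) as [x [Hx [Kx L]]]; [dfn| |].
  - exists d; split; [assumption|apply (uf_space H)].
  - exists x; split; [auto|]; intros y [[Hy Ky] L'].
    destruct (ordinal_total Hx Hy) as [M|[M|M]]; [|assumption|].
    + case (L' x M Kx).
    + case (L y M Ky). }
destruct K as [[Ob Hb] L]; assert (Sb : b ⊆ d) by now apply (uf_sub H).
do 4 (split; [assumption|]); split; [assumption|]; split.
- assert (M : cc_ultrafilter (sep (pow b) (fun x => almost_all U d (fun a => a ∈ x))) b).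
  { apply (cc_push (h := fun a => a) H); [dfn|now apply (aa_mem H Sb)]. }
  replace (sep U _) with (sep (pow b) (fun x => almost_all U d (fun a => a ∈ x))); [assumption|].
  apply ext; intros x; rewrite !in_sep, in_pow by dfn.
  assert (Q : x ⊆ b → almost_all U d (fun a => a ∈ x) ↔ x ∈ U) by (intros; apply (aa_mem H); auto).
  tauto.
- intros c y Hc Hy; rewrite is_diff_iff in Hy; subst y; rewrite in_sep by dfn.
  split; [|intros z; rewrite in_diff; tauto].
  assert (Sc : c ⊆ d).
  { intros z Hz; apply Sb; eauto using ordinal_trans. }
  apply (uf_up H (uf_inter H Hb (uf_diff H Sc (L c Hc)))); intros z;
    rewrite ?in_inter, ?in_diff; [tauto|intros [Hz _]; auto].
Qed.

(** * Wellfoundedness of the Ketonen order *)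

(* The space of [U] is [union U]. *)
Definition below U W := ∃ f,
  almost_all W (union W) (fun a => cc_ultrafilter (ap f a) a) ∧
  ∀ x, x ⊆ union U → x ∈ U ↔ almost_all W (union W) (fun a => inter x a ∈ ap f a).

Lemma definable_below s t : definable_term s → definable_term t →
  definable (fun e => below (s e) (t e)).
Proof. unfold below; dfn. Qed.
Hint Resolve definable_below : definable.

Lemma cc_ne_emp U d : cc_ultrafilter U d → d ≠ emp.
Proof. intros H ->; exact (uf_emp H (uf_space H)). Qed.

(** [below] keeps the Ketonen condition but forgets uniformity and asks for ultrafilters only at
    almost all indices. The wellfoundedness proof needs this generality, because the ultrafilters
    occurring in a witness are not uniform in general. *)
Lemma ketonen_iff U W : ketonen U W ↔ Un U ∧ Un W ∧ below U W.
Proof.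
split.
- intros [dU [dW [D [F [HU [HW [HD [HF [HC H]]]]]]]]].
  split; [now exists dU|]; split; [now exists dW|]; exists F.
  pose proof (Un_on_cc HW) as CW; rewrite (uf_union (Un_on_cc HU)), (uf_union CW).
  assert (L : ∀ x A, (∀ a, a ∈ A ↔ a ∈ dW ∧ ∃ Ua I, app F a Ua ∧ is_inter x a I ∧ I ∈ Ua) ↔
    A = sep dW (fun a => a ∈ D ∧ inter x a ∈ ap F a)).
  { intros x A; assert (K : ∀ a, (∃ Ua I, app F a Ua ∧ is_inter x a I ∧ I ∈ Ua) ↔
      (a ∈ D ∧ inter x a ∈ ap F a)).
    { intros a; split.
      - intros [Ua [I [K1 [K2 K3]]]]; rewrite (app_ap _ _ HF) in K1; destruct K1 as [K1 ->].
        rewrite is_inter_iff in K2; subst I; auto.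
      - intros [K1 K2]; exists (ap F a), (inter x a); rewrite (app_ap _ _ HF), is_inter_iff; auto. }
    split; [intros M; apply ext; intros a; now rewrite M, in_sep, K by dfn|].
    intros -> a; now rewrite in_sep, K by dfn. }
  assert (M : ∀ x, x ⊆ dU → x ∈ U ↔ almost_all W dW (fun a => a ∈ D ∧ inter x a ∈ ap F a)).
  { intros x Hx; rewrite (H x Hx); split.
    - intros [A [HA M]]; rewrite L in M; subst A; exact HA.
    - intros K; eexists; split; [exact K|now apply L]. }
  assert (AD : almost_all W dW (fun a => a ∈ D ∧ inter dU a ∈ ap F a))
    by (apply (M dU); [auto|exact (uf_space (Un_on_cc HU))]).
  split; [|intros x Hx; rewrite (M x Hx); split].
  + revert AD; apply (aa_imp CW); [dfn|dfn|]; intros a _ [Ha _].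
    apply (HC a (ap F a)), (app_ap _ _ HF); auto.
  + apply (aa_imp CW); [dfn|dfn|tauto].
  + revert AD; apply (aa_imp2 CW); [dfn|dfn|dfn|tauto].
- intros [[dU HU] [[dW HW] [F [HC H]]]].
  pose proof (Un_on_cc HW) as CW; rewrite (uf_union (Un_on_cc HU)), (uf_union CW) in *.
  (* At the negligible indices where [F] fails to give a countably complete ultrafilter, the
     principal ultrafilter at 0 is substituted. It exists because the index 0 is excluded from
     [D]. *)
  pose (G := fun a => sep (pow a) (fun x => (cc_ultrafilter (ap F a) a ∧ x ∈ ap F a) ∨
    (¬ cc_ultrafilter (ap F a) a ∧ emp ∈ x))).
  assert (HG : definable_term (fun e => G (e 0))) by (unfold G; dfn).
  assert (EG : ∀ a, cc_ultrafilter (ap F a) a → G a = ap F a).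
  { intros a Ca; apply ext; intros x; unfold G; rewrite in_sep, in_pow by dfn.
    split; [tauto|]; intros Hx; split; [exact (uf_sub Ca Hx)|auto]. }
  pose (D := sep dW (fun a => a ≠ emp)).
  assert (HD : ∀ a, a ∈ D ↔ a ∈ dW ∧ a ≠ emp) by (intros a; unfold D; now rewrite in_sep by dfn).
  exists dU, dW, D, (lam D G); do 2 (split; [assumption|]).
  split; [intros a; now rewrite HD, nonempty_iff|]; split; [apply is_fun_lam; dfn|]; split.
  + intros a Ga; rewrite app_lam, HD by dfn; intros [[Ha Ha0] ->].
    destruct (classic (cc_ultrafilter (ap F a) a)) as [C|C]; [now rewrite EG|].
    replace (G a) with (sep (pow a) (fun x => emp ∈ x)).
    * apply cc_principal, emp_in_ordinal; [exact (ordinal_mem (proj1 HW) Ha)|assumption].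
    * apply ext; intros x; unfold G; rewrite !in_sep by dfn; tauto.
  + assert (K : ∀ x a, cc_ultrafilter (ap F a) a → a ∈ dW →
      (∃ Ga I, app (lam D G) a Ga ∧ is_inter x a I ∧ I ∈ Ga) ↔ inter x a ∈ ap F a).
    { intros x a Ca Ha; rewrite <- (EG a Ca); split.
      - intros [Ga [I [K1 [K2 K3]]]]; rewrite app_lam in K1 by dfn; destruct K1 as [_ ->].
        rewrite is_inter_iff in K2; now subst I.
      - intros K; exists (G a), (inter x a); rewrite app_lam, is_inter_iff, HD by dfn.
        pose proof (cc_ne_emp Ca); auto. }
    intros x Hx; rewrite (H x Hx); split.
    * intros M; exists (sep dW (fun a => ∃ Ga I, app (lam D G) a Ga ∧ is_inter x a I ∧ I ∈ Ga)).
      split; [|intros a; rewrite in_sep by dfn; tauto].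
      revert HC M; apply (aa_imp2 CW); [dfn|dfn|dfn|]; intros a Ha Ca; now apply K.
    * intros [A [HA M]]; assert (HA' : almost_all W dW (fun a => a ∈ A))
        by (apply (aa_mem CW); [exact (uf_sub CW HA)|exact HA]).
      revert HC HA'; apply (aa_imp2 CW); [dfn|dfn|dfn|]; intros a Ha Ca; rewrite M, K; tauto.
Qed.

Definition ultrafilter_in c U := ordinal (union U) ∧ union U ∈ c ∧ cc_ultrafilter U (union U).

Definition witness f U W := almost_all W (union W) (fun a => cc_ultrafilter (ap f a) a) ∧
  ∀ x, x ⊆ union U → x ∈ U ↔ almost_all W (union W) (fun a => inter x a ∈ ap f a).

(* A [U]-limit of the [g(y)], where [U] is the [W]-limit of the [f(a)], is the
   [W]-limit of the [f(a)]-limits of the [g(y)]. *)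
Lemma below_limit c U W U' f : ultrafilter_in c W → ultrafilter_in c U →
  witness f U W → below U' U → ∃ f', witness f' U' W ∧
  almost_all W (union W) (fun a => below (ap f' a) (ap f a)).
Proof.
intros [OW [_ CW]] [OU [_ CU]] [Cf Lf] [g [Cg Lg]]; unfold witness.
set (w := union W) in *; set (u := union U) in *; set (u' := union U') in *.
pose (F := fun a => sep (pow a) (fun x => almost_all (ap f a) a (fun y => inter x y ∈ ap g y))).
assert (HF : definable_term (fun e => F (e 0))) by (unfold F; dfn).
pose (G := sep u (fun y => cc_ultrafilter (ap g y) y)).
assert (HG : ∀ y, y ∈ G ↔ y ∈ u ∧ cc_ultrafilter (ap g y) y)
  by (intros y; unfold G; rewrite in_sep by dfn; tauto).
pose (ok := fun a => cc_ultrafilter (ap f a) a ∧ inter G a ∈ ap f a).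
assert (Hok : definable (fun e => ok (e 0))) by (unfold ok; dfn).
assert (Aok : almost_all W w ok).
{ apply (aa_and CW); [dfn|dfn|assumption|]; apply Lf; [intros y; rewrite HG; tauto|exact Cg]. }
assert (AG : ∀ a, ok a → almost_all (ap f a) a (fun y => y ∈ G)).
{ intros a [Ca K]; revert K; rewrite <- (aa_mem Ca) by (intros y; rewrite in_inter; tauto).
  apply (aa_imp Ca); [dfn|dfn|]; intros y _; rewrite in_inter; tauto. }
assert (CF : ∀ a, a ∈ w → ok a → cc_ultrafilter (F a) a).
{ intros a Ha K; pose proof (proj1 K) as Ca.
  apply (cc_limit (g := fun y => ap g y) (e := fun y => y) Ca); [dfn|dfn|].
  generalize (AG a K); apply (aa_imp Ca); [dfn|dfn|]; intros y Hy; rewrite HG; intros [_ C].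
  split; [assumption|]; intros z Hz; exact (ordinal_trans (ordinal_mem OW Ha) Hz Hy). }
exists (lam w F); split; [split|].
- revert Aok; apply (aa_imp CW); [dfn|dfn|]; intros a Ha K.
  rewrite ap_lam by (dfn || assumption); auto.
- intros x Hx; rewrite (Lg x Hx); unfold almost_all at 1.
  rewrite Lf by (intros y; rewrite in_sep by dfn; tauto).
  assert (E : ∀ a, a ∈ w → ok a → inter (sep u (fun y => inter x y ∈ ap g y)) a ∈ ap f a ↔
    inter x a ∈ ap (lam w F) a).
  { intros a Ha K; pose proof (proj1 K) as Ca; rewrite ap_lam by (dfn || assumption); unfold F.
    rewrite in_sep, in_pow, <- (aa_mem Ca) by (dfn || (intros y; rewrite in_inter; tauto)).
    assert (Ey : ∀ y, y ∈ a → inter (inter x a) y = inter x y).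
    { intros y Hy; apply ext; intros z; rewrite !in_inter; split; [tauto|]; intros [Hz Hzy].
      repeat split; auto; exact (ordinal_trans (ordinal_mem OW Ha) Hzy Hy). }
    split; [intros L; split; [intros z; rewrite in_inter; tauto|]; revert L|intros [_ L]; revert L];
      generalize (AG a K); apply (aa_imp2 Ca); try dfn; intros y Hy; rewrite HG;
      rewrite in_inter, in_sep, Ey by (dfn || assumption); tauto. }
  split; revert Aok; apply (aa_imp2 CW); try dfn; intros a Ha K; now apply E.
- revert Aok; apply (aa_imp CW); [dfn|dfn|]; intros a Ha K; rewrite ap_lam by (dfn || assumption).
  pose proof (proj1 K) as Ca; exists g; rewrite (uf_union Ca), (uf_union (CF a Ha K)); split.
  + generalize (AG a K); apply (aa_imp Ca); [dfn|dfn|]; intros y _; rewrite HG; tauto.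
  + intros x Hx; unfold F; rewrite in_sep, in_pow by dfn; tauto.
Qed.

(** Induction on a bound [c] for the spaces. The ultrafilters in a witness below [W] live on
    ordinals less than the space of [W], so their ultraproduct by [W] is wellfounded by the
    induction hypothesis. Choose [U] in [s] below [W] with a minimal witness: by [below_limit], a
    member of [s] below [U] would have a smaller witness. *)
Lemma below_wf c : ordinal c → ∀ s, nonempty s → ∃ W, W ∈ s ∧
  ∀ U, U ∈ s → ¬ (ultrafilter_in c U ∧ ultrafilter_in c W ∧ below U W).
Proof.
apply (@ordinal_ind _ _ (fun c => ∀ s, nonempty s → ∃ W, W ∈ s ∧
  ∀ U, U ∈ s → ¬ (ultrafilter_in c U ∧ ultrafilter_in c W ∧ below U W)));
  [unfold ultrafilter_in; dfn|].
clear c; intros c Hc IH s [W HW].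
destruct (classic (∃ U, U ∈ s ∧ ultrafilter_in c U ∧ ultrafilter_in c W ∧ below U W))
  as [[U0 [HU0 [KU0 [KW B0]]]]|N].
2: { exists W; split; [assumption|]; intros U HU K; apply N; eauto. }
pose proof KW as [OW [Wc CW]]; set (w := union W) in *.
pose (R := fun x y => ultrafilter_in w x ∧ ultrafilter_in w y ∧ below x y).
pose (wit := fun f => ∃ U, U ∈ s ∧ ultrafilter_in c U ∧ witness f U W).
pose (T := cup (pow (pow w)) (sing emp)).
assert (HR : definable (fun e => R (e 0) (e 1))) by (unfold R, ultrafilter_in; dfn).
assert (Hw : definable (fun e => wit (e 0))) by (unfold wit, ultrafilter_in, witness; dfn).
(* Minimization takes place in a set of functions. A witness is therefore made empty wherever it is
   not an ultrafilter, which puts all its values into [T] and changes it on a negligible set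
   only. *)
assert (Clean : ∀ f U, U ∈ s → ultrafilter_in c U → witness f U W →
  ∃ f', f' ∈ fns w T ∧ wit f' ∧ almost_all W w (fun a => ap f' a = ap f a)).
{ intros f U HU KU [H3 H4]; fold w in H3, H4.
  pose (f' := lam w (fun a => sep (ap f a) (fun _ => cc_ultrafilter (ap f a) a))).
  assert (E : ∀ a, a ∈ w → cc_ultrafilter (ap f a) a → ap f' a = ap f a).
  { intros a Ha Ca; unfold f'; rewrite ap_lam by (dfn || assumption).
    apply ext; intros z; rewrite in_sep by dfn; tauto. }
  assert (A : almost_all W w (fun a => ap f' a = ap f a))
    by (revert H3; apply (aa_imp CW); [dfn|dfn|exact E]).
  exists f'; split; [|split; [|exact A]].
  - rewrite in_fns; split; [apply is_fun_lam; dfn|]; intros a Ha; unfold T; rewrite in_cup, in_sing.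
    destruct (classic (cc_ultrafilter (ap f a) a)) as [C|C].
    + left; rewrite E, in_pow by assumption; intros x Hx; rewrite in_pow; intros z Hz.
      exact (ordinal_trans OW (uf_sub C Hx Hz) Ha).
    + right; unfold f'; rewrite ap_lam by (dfn || assumption).
      apply ext; intros z; rewrite in_sep by dfn; split; [tauto|intros Hz; case (in_emp Hz)].
  - exists U; split; [assumption|]; split; [assumption|]; split; fold w.
    + revert A H3; apply (aa_imp2 CW); [dfn|dfn|dfn|]; intros a _ ->; auto.
    + intros x Hx; rewrite (H4 x Hx); split; revert A; apply (aa_imp2 CW); try dfn;
        intros a _ ->; auto. }
destruct (@ultraproduct_wf _ _ W w CW R HR (IH w Wc)) with (s := sep (fns w T) wit) as [f [Hf M]].
- destruct B0 as [f Hf]; destruct (Clean f U0 HU0 KU0 Hf) as [f' [K1 [K2 _]]].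
  exists f'; rewrite in_sep by dfn; auto.
- rewrite in_sep in Hf by dfn; destruct Hf as [Kf [U [KU [IU Wf]]]].
  exists U; split; [assumption|]; intros U' HU' [IU' [_ B]].
  destruct (below_limit KW IU Wf B) as [g [Wg Bg]].
  destruct (Clean g U' HU' IU' Wg) as [g' [K1 [K2 K3]]].
  apply (M g'); [rewrite in_sep by dfn; auto|].
  assert (Cfg : almost_all W w (fun a => cc_ultrafilter (ap f a) a ∧ cc_ultrafilter (ap g a) a))
    by (apply (aa_and CW); [dfn|dfn|apply Wf|apply Wg]).
  assert (Bg' : almost_all W w (fun a => below (ap g a) (ap f a) ∧ ap g' a = ap g a))
    by (apply (aa_and CW); (assumption || dfn)).
  revert Cfg Bg'; apply (aa_imp2 CW); [dfn|dfn|dfn|]; intros a Ha [Ca Ca'] [Hb ->].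
  assert (Oa : ordinal a) by exact (ordinal_mem OW Ha).
  unfold R, ultrafilter_in; now rewrite (uf_union Ca), (uf_union Ca').
Qed.

Lemma ketonen_wf (s : V) : nonempty s → ∃ W : V, W ∈ s ∧ ∀ U : V, U ∈ s → ¬ ketonen U W.
Proof.
intros Hs.
pose (c := union (repl (sep s (fun U : V => Un U)) (fun U : V => succ (union U)))).
assert (K : ∀ U : V, U ∈ s → Un U → ultrafilter_in (succ c) U).
{ intros U HU [d Hd]; unfold ultrafilter_in; rewrite (uf_union (Un_on_cc Hd)).
  split; [apply Hd|]; split; [|apply (Un_on_cc Hd)].
  rewrite in_succ; left; unfold c; rewrite in_union; exists (succ d).
  split; [|apply in_succ_self]; rewrite in_repl by dfn; exists U.
  rewrite in_sep, (uf_union (Un_on_cc Hd)) by dfn; split; [|reflexivity].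
  split; [assumption|now exists d]. }
assert (Oc : ordinal c).
{ apply ordinal_union; intros x; rewrite in_repl by dfn; intros [U [HU ->]].
  rewrite in_sep in HU by dfn; destruct HU as [HU [d Hd]].
  rewrite (uf_union (Un_on_cc Hd)); apply ordinal_succ, Hd. }
destruct (below_wf (ordinal_succ Oc) Hs) as [W [HW M]]; exists W; split; [assumption|].
intros U HU B; rewrite ketonen_iff in B; destruct B as [B1 [B2 B3]]; apply (M U HU); auto.
Qed.

Lemma ketonen_irrefl (U : V) : ¬ ketonen U U.
Proof.
intros H; destruct (@ketonen_wf (sing U)) as [W [HW K]]; [exists U; now apply in_sing|].
rewrite in_sing in HW; subst W; apply (K U); [now apply in_sing|assumption].
Qed.

Lemma ketonen_asym (U W : V) : ketonen U W → ¬ ketonen W U.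
Proof.
intros H H'; destruct (@ketonen_wf (upair U W)) as [X [HX K]]; [exists U; apply in_upair; auto|].
rewrite in_upair in HX; destruct HX as [-> | ->]; eapply K; eauto; apply in_upair; auto.
Qed.

End Constructions.
#[export] Hint Resolve definable_below definable_uniformization : definable.

(** * Limits, translations and sums in terms of representing functions *)

Section Natsum.
Context {V : SetStr} {hV : ZFC V}.
Implicit Types a b c : V.

Definition nsum a b := the (fun c => natural_sum a b c).
Lemma definable_nsum (s t : (nat → V) → V) : definable_term s → definable_term t →
  definable_term (fun e => nsum (s e) (t e)).
Proof. unfold nsum; dfn. Qed.

Lemma nsum_spec a b : ordinal a → ordinal b → natural_sum a b (nsum a b).
Proof.
intros Ha Hb; apply (the_spec (P := fun c => natural_sum a b c)).
destruct (ex_natural_sum Ha Hb) as [c Hc]; exists c; split; [assumption|].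
intros c' Hc'; eapply natural_sum_fun; eauto.
Qed.

Lemma ordinal_nsum a b : ordinal (nsum a b).
Proof.
unfold nsum; destruct (classic (exists! c, natural_sum a b c)) as [H|H].
- apply (the_spec (P := fun c => natural_sum a b c)) in H; apply H.
- unfold the; destruct (excluded_middle_informative _); [contradiction|apply ordinal_emp].
Qed.

Lemma least_imp (P Q : V → Prop) a : (∀ b, ordinal b → P b ↔ Q b) → least P a → least Q a.
Proof.
intros H [Ha [K L]]; split; [assumption|]; split; [now apply H|].
intros b Hb M; apply (L b Hb), H; eauto using ordinal_mem.
Qed.
End Natsum.
#[export] Hint Resolve definable_nsum : definable.

Section Representation.
Context {V : SetStr} {hV : ZFC V}.
Variables U d : V.
Hypothesis HU : Un_on U d.
Implicit Types (f g h : V).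
Notation aa := (almost_all U d).
Let HC := Un_on_cc HU.
Local Instance ZU : ZFC (Ult U) := ZFC_Ult HU.

(* [g] represents an ultrafilter of the ultrapower with limit [W]; [w] is the space of [W]. *)
Definition is_limit g W w :=
  aa (fun a => Un (ap g a) ∧ union (ap g a) ⊆ w) ∧
  ∀ x, x ⊆ w → x ∈ W ↔ aa (fun a => inter x (union (ap g a)) ∈ ap g a).

Lemma Un_cls g : Un (cls HU g) ↔ aa (fun a => Un (ap g a)).
Proof. exact (los1 HU (P := @Un) g uniform_Un). Qed.

Lemma ketonen_cls f g : ketonen (cls HU f) (cls HU g) ↔ aa (fun a => ketonen (ap f a) (ap g a)).
Proof. exact (los2 HU (P := @ketonen) f g uniform_ketonen). Qed.

Lemma Un_on_cls g : aa (fun a => Un (ap g a)) →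
  Un_on (cls HU g) (cls HU (lam d (fun a => union (ap g a)))).
Proof.
intros H; apply (los2 HU (P := @Un_on) _ _ uniform_Un_on).
revert H; apply (aa_imp HC); [dfn|dfn|]; intros a Ha [c Hc].
rewrite ap_lam by (dfn || assumption); now rewrite (uf_union (Un_on_cc Hc)).
Qed.

(** [is_limit] merely bounds the spaces by [w]. That [w] is the least possible bound follows from
    the uniformity of [W]: an ordinal below [w] bounding almost all the spaces would itself belong
    to [W]. *)
Lemma ult_limit_iff g (W w : V) : Un_on W w →
  Un (cls HU g) ∧ ult_limit (cls HU g) W ↔ is_limit g W w.
Proof.
intros HW; rewrite Un_cls.
set (e := lam d (fun a => union (ap g a))).
assert (E : ∀ a, a ∈ d → ap e a = union (ap g a)).
{ intros a Ha; unfold e; now rewrite ap_lam by (dfn || assumption). }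
assert (K : aa (fun a => Un (ap g a)) → ∀ Z, ult_limit (cls HU g) Z ↔
  ∃ c, least (fun b => aa (fun a => ole (union (ap g a)) b)) c ∧
  ∀ x, x ∈ Z ↔ x ⊆ c ∧ aa (fun a => inter x (union (ap g a)) ∈ ap g a)).
{ intros H Z; pose proof (Un_on_cls H) as He; fold e in He.
  assert (K1 : ∀ b, (∃ y, ult_embed b y ∧ ole (cls HU e) y) ↔ aa (fun a => ole (union (ap g a)) b)).
  { intros b; transitivity (ole (cls HU e) (ultj HU b)).
    - split; [intros [y [Hy L]]; rewrite (ult_embed_iff HU) in Hy; now subst|].
      intros L; exists (ultj HU b); split; [now rewrite (ult_embed_iff HU)|assumption].
    - unfold ultj; rewrite (los2 HU (P := @ole) _ _ uniform_ole).
      apply (aa_iff HC); [dfn|dfn|]; intros a Ha; rewrite E, ap_lam by (dfn || assumption); tauto. }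
  assert (K2 : ∀ x, (∃ y I : Ult U, ult_embed x y ∧ is_inter y (cls HU e) I ∧ I ∈ cls HU g) ↔
    aa (fun a => inter x (union (ap g a)) ∈ ap g a)).
  { intros x; transitivity (∃ I : Ult U, is_inter (ultj HU x) (cls HU e) I ∧ I ∈ cls HU g).
    - split; [intros [y [I [Hy L]]]; rewrite (ult_embed_iff HU) in Hy; subst; eauto|].
      intros [I L]; exists (ultj HU x), I; split; [now rewrite (ult_embed_iff HU)|assumption].
    - unfold ultj.
      rewrite (los3 HU (P := fun M x e W => ∃ I : M, is_inter x e I ∧ I ∈ W)) by uniform.
      apply (aa_iff HC); [dfn|dfn|]; intros a Ha; rewrite E, ap_lam by (dfn || assumption).
      split; [intros [I [L M]]; rewrite is_inter_iff in L; now subst|].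
      intros L; eexists; split; [now apply is_inter_iff|assumption]. }
  split.
  - intros [d' [c [L1 [L2 L3]]]]; exists c; rewrite (Un_on_fun He L1) in *; split.
    + revert L2; apply least_imp; intros b _; apply K1.
    + intros x; rewrite L3, K2; tauto.
  - intros [c [L2 L3]]; exists (cls HU e), c; split; [assumption|]; split.
    + revert L2; apply least_imp; intros b _; symmetry; apply K1.
    + intros x; rewrite L3, K2; tauto. }
pose proof (Un_on_cc HW) as CW.
assert (N : ∀ a c, ordinal c → Un (ap g a) → ole (union (ap g a)) c ↔ union (ap g a) ⊆ c).
{ intros a c Oc [s Hs]; rewrite (uf_union (Un_on_cc Hs)); split.
  - intros [L|L]; [|now subst]; intros z Hz; eauto using ordinal_trans.
  - intros L; destruct (ordinal_sub (proj1 Hs) Oc L); [now left|now right]. }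
assert (I : ∀ a c, Un (ap g a) → union (ap g a) ⊆ c → inter c (union (ap g a)) ∈ ap g a).
{ intros a c [s Hs] L; rewrite (uf_union (Un_on_cc Hs)) in *.
  replace (inter c s) with s; [apply (uf_space (Un_on_cc Hs))|].
  apply ext; intros z; rewrite in_inter; split; [auto|tauto]. }
split.
- intros [H L]; rewrite (K H) in L; destruct L as [c [[Oc [L1 L2]] L3]].
  assert (L1' : aa (fun a => union (ap g a) ⊆ c)).
  { revert L1 H; apply (aa_imp2 HC); [dfn|dfn|dfn|]; intros a _ La Ha; now apply N. }
  assert (Ec : c = w).
  { apply sub_antisym.
    - apply (uf_sub CW), L3; split; [auto|].
      apply (aa_mono2 HC (P := fun a => Un (ap g a)) (P' := fun a => union (ap g a) ⊆ c));
        [dfn|dfn|dfn|assumption|assumption|]; intros a _; apply I.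
    - apply L3, (uf_space CW). }
  subst c; split; [apply (aa_and HC); (assumption || dfn)|].
  intros x Hx; rewrite L3; tauto.
- intros [H L].
  assert (H1 : aa (fun a => Un (ap g a))).
  { revert H; apply (aa_imp HC); [dfn|dfn|tauto]. }
  split; [assumption|]; rewrite (K H1); exists w; split.
  + split; [apply HW|]; split.
    * revert H; apply (aa_imp HC); [dfn|dfn|]; intros a _ [Ha1 Ha2]; apply N; auto; apply HW.
    * intros b Hb M.
      assert (Sb : b ⊆ w) by (intros z Hz; eapply ordinal_trans; eauto; apply HW).
      assert (Ob : ordinal b) by (eapply ordinal_mem; eauto; apply HW).
      assert (Kb : b ∈ W).
      { apply (L b Sb).
        apply (aa_mono2 HC (P := fun a => Un (ap g a)) (P' := fun a => ole (union (ap g a)) b));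
          [dfn|dfn|dfn|assumption|assumption|]; intros a _ Ha; rewrite N by assumption; now apply I. }
      destruct HW as [_ [_ HW]].
      assert (Kc : diff w b ∈ W) by (apply (HW b); [assumption|now apply is_diff_iff]).
      apply (uf_emp CW); replace emp with (inter b (diff w b)); [now apply (uf_inter CW)|].
      apply ext; intros z; rewrite in_inter, in_diff; split; [tauto|intros Hz; case (in_emp Hz)].
  + intros x; split; [intros Hx; pose proof (uf_sub CW Hx); split; [assumption|now apply L]|].
    intros [Hx M]; now apply L.
Qed.

(** The image of [W] under the ultrapower embedding has limit [W], so the class that is minimized to
    define the translation is nonempty. *)
Lemma limit_const (W w : V) : Un_on W w → is_limit (lam d (fun _ => W)) W w.
Proof.
intros HW; pose proof (Un_on_cc HW) as CW; split.
- apply (aa_all HC); [dfn|]; intros a Ha; rewrite ap_lam by (dfn || assumption).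
  rewrite (uf_union CW); split; [now exists w|auto].
- intros x Hx.
  assert (E : inter x w = x) by (apply ext; intros z; rewrite in_inter; split; [tauto|auto]).
  transitivity (aa (fun _ => x ∈ W)); [symmetry; apply (aa_const HC (A := x ∈ W)); dfn|].
  apply (aa_iff HC); [dfn|dfn|]; intros a Ha; rewrite ap_lam by (dfn || assumption).
  rewrite (uf_union CW), E; tauto.
Qed.

(** The ultraproduct of the Ketonen order is wellfounded, so among functions representing
    ultrafilters with limit [W] there is a minimal one. It is the least one because linearity passes
    to the ultrapower by Łoś's theorem. *)
Lemma ex_translation (W w : V) : ketonen_linear V → Un_on W w → ∃ g, translation U W (cls HU g).
Proof.
intros Hlin HW.
assert (Lin : ketonen_linear (Ult U)).
{ refine (los_true HU (P := fun M _ => ketonen_linear M) _ _ (fun _ => cls HU d));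
    [unfold ketonen_linear; uniform|auto]. }
(* Almost all values of a function in question are ultrafilters on ordinals at most [w], hence
   families of subsets of [w]. Emptying the other values brings the minimization into a set of
   functions. *)
pose (T := cup (pow (pow w)) (sing emp)).
assert (Clean : ∀ g, is_limit g W w → ∃ g', g' ∈ fns d T ∧ is_limit g' W w ∧
  aa (fun a => ap g a = ap g' a)).
{ intros g [H1 H2].
  pose (g' := lam d (fun a => sep (ap g a) (fun _ => ap g a ∈ T))).
  assert (G : ∀ a, a ∈ d → Un (ap g a) ∧ union (ap g a) ⊆ w → ap g a = ap g' a).
  { intros a Ha [[c Hc] L]; unfold g'; rewrite ap_lam by (dfn || assumption).
    apply ext; intros z; rewrite in_sep by dfn; split; [|tauto].
    intros Hz; split; [assumption|]; unfold T; rewrite in_cup, in_pow; left.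
    rewrite (uf_union (Un_on_cc Hc)) in L; intros x Hx; rewrite in_pow; intros y Hy.
    apply L; eapply (uf_sub (Un_on_cc Hc)); eauto. }
  assert (E : aa (fun a => ap g a = ap g' a)).
  { revert H1; apply (aa_imp HC); [dfn|dfn|exact G]. }
  exists g'; split; [|split; [|exact E]].
  - rewrite in_fns; split; [apply is_fun_lam; dfn|]; intros a Ha; unfold g'.
    rewrite ap_lam by (dfn || assumption); destruct (classic (ap g a ∈ T)) as [K|K].
    + replace (sep _ _) with (ap g a); [assumption|].
      apply ext; intros z; rewrite in_sep by dfn; tauto.
    + replace (sep _ _) with (@emp V hV); [unfold T; rewrite in_cup, in_sing; auto|].
      apply ext; intros z; rewrite in_sep by dfn; split; [intros Hz; case (in_emp Hz)|tauto].
  - split.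
    + revert E H1; apply (aa_imp2 HC); [dfn|dfn|dfn|]; intros a _ <-; auto.
    + intros x Hx; rewrite (H2 x Hx); split; revert E; apply (aa_imp2 HC); try dfn;
        intros a _; [intros ->|intros <-]; auto. }
destruct (@ultraproduct_wf _ _ _ _ HC (fun x y => ketonen x y)) with
  (s := sep (fns d T) (fun g => is_limit g W w)) as [g [Hg M]]; [dfn|apply ketonen_wf| |].
- destruct (Clean _ (limit_const HW)) as [g [K1 [K2 _]]]; exists g.
  rewrite in_sep; [auto|unfold is_limit; dfn].
- rewrite in_sep in Hg by (unfold is_limit; dfn); destruct Hg as [_ Hg]; exists g.
  pose proof (proj2 (ult_limit_iff g HW) Hg) as [G1 G2].
  split; [assumption|]; split; [assumption|]; intros W'' H1 H2.
  destruct (Lin (cls HU g) W'' G1 H1) as [L|[L|L]]; [auto|auto|exfalso].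
  destruct (cls_surj HU W'') as [f [_ ->]].
  pose proof (proj1 (ult_limit_iff f HW) (conj H1 H2)) as Hf.
  destruct (Clean f Hf) as [f' [K1 [K2 K3]]]; rewrite ketonen_cls in L; apply (M f').
  + rewrite in_sep; [auto|unfold is_limit; dfn].
  + revert K3 L; apply (aa_imp2 HC); [dfn|dfn|dfn|]; intros a _ <-; auto.
Qed.

Lemma translation_unique (W : V) (X Y : Ult U) :
  translation U W X → translation U W Y → X = Y.
Proof.
intros [H1 [H2 H3]] [K1 [K2 K3]].
destruct (H3 Y K1 K2) as [L|L]; [assumption|].
destruct (K3 X H1 H2) as [M|M]; [auto|case (ketonen_asym L M)].
Qed.

Lemma translation_minimal (W w : V) g f : Un_on W w → translation U W (cls HU g) →
  is_limit f W w → ¬ aa (fun a => ketonen (ap f a) (ap g a)).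
Proof.
intros HW [H1 [H2 H3]] Hf L.
destruct (proj2 (ult_limit_iff f HW) Hf) as [F1 F2]; rewrite <- ketonen_cls in L.
destruct (H3 (cls HU f) F1 F2) as [K|K]; [|case (ketonen_asym L K)].
rewrite K in L; case (ketonen_irrefl L).
Qed.

(** * Sums *)

Definition sum_large g x :=
  aa (fun b => almost_all (ap g b) (union (ap g b)) (fun a => nsum a b ∈ x)).

Lemma definable_sum_large (s t : (nat → V) → V) : definable_term s → definable_term t →
  definable (fun e => sum_large (s e) (t e)).
Proof. unfold sum_large; dfn. Qed.
Hint Resolve definable_sum_large : definable.

Definition is_sum g Z := ∃ c, least (sum_large g) c ∧ ∀ x, x ∈ Z ↔ x ⊆ c ∧ sum_large g x.

Lemma is_sum_unique g Z Z' : is_sum g Z → is_sum g Z' → Z = Z'.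
Proof.
intros [c [[Hc [K L]] H]] [c' [[Hc' [K' L']] H']].
assert (c = c').
{ destruct (ordinal_total Hc Hc') as [M|[M|M]]; [|assumption|].
  - case (L' c M K).
  - case (L c' M K'). }
subst c'; apply ext; intros x; now rewrite H, H'.
Qed.

Lemma ex_is_sum g : aa (fun b => Un (ap g b)) → ∃ Z c, is_sum g Z ∧ Un_on Z c ∧
  ∀ x, x ⊆ c → x ∈ Z ↔ sum_large g x.
Proof.
intros Hg.
destruct (@ordinal_min _ _ (fun c => sum_large g c)) as [c [Oc [K L]]]; [dfn| |].
{ exists (bigcup d (fun b => bigcup (union (ap g b)) (fun a => succ (nsum a b)))); split.
  - apply ordinal_bigcup; [dfn|]; intros b _; apply ordinal_bigcup; [dfn|]; intros a _.
    apply ordinal_succ, ordinal_nsum.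
  - unfold sum_large; revert Hg; apply (aa_imp HC); [dfn|dfn|].
    intros b Hb [s Hs]; rewrite (uf_union (Un_on_cc Hs)).
    apply (aa_all (Un_on_cc Hs)); [dfn|]; intros a Ha.
    rewrite in_bigcup by dfn; exists b; split; [assumption|].
    rewrite in_bigcup by dfn; exists a; rewrite (uf_union (Un_on_cc Hs)).
    split; [assumption|apply in_succ_self]. }
exists (sep (pow c) (fun x => sum_large g x)), c.
assert (E : ∀ x, x ∈ sep (pow c) (fun x => sum_large g x) ↔ x ⊆ c ∧ sum_large g x).
{ intros x; rewrite in_sep, in_pow by dfn; tauto. }
split; [|split].
- exists c; split; [split; auto|exact E].
- assert (Q : ∀ x, x ⊆ c → inter x c = x)
    by (intros x Hx; apply ext; intros z; rewrite in_inter; split; [tauto|auto]).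
  assert (CZ : cc_ultrafilter (sep (pow c) (fun x => sum_large g x)) c).
  (* The sum is the [U]-limit of the push-forwards of the [g b] under [a ↦ a ⊕ b], all taken on the
     same space [c]; the minimality of [c] then gives uniformity. *)
  { assert (M : cc_ultrafilter (sep (pow c) (fun x => aa (fun b => inter x c ∈
      sep (pow c) (fun x => almost_all (ap g b) (union (ap g b)) (fun a => nsum a b ∈ x))))) c).
    { apply (cc_limit (g := fun b => sep (pow c) (fun x =>
        almost_all (ap g b) (union (ap g b)) (fun a => nsum a b ∈ x))) (e := fun _ => c) HC);
        [dfn|dfn|].
      revert Hg K; apply (aa_imp2 HC); [dfn|dfn|dfn|].
      intros b Hb [s Hs] Kb; rewrite (uf_union (Un_on_cc Hs)) in *; split; [|auto].
      apply (cc_push (h := fun a => nsum a b) (Un_on_cc Hs)); [dfn|assumption]. }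
    match type of M with cc_ultrafilter ?A _ => replace (sep _ _) with A; [assumption|] end.
    apply ext; intros x; rewrite E, in_sep, in_pow by dfn; unfold sum_large.
    split; intros [Hx N]; (split; [assumption|]); revert N; apply (aa_imp HC); try dfn;
      intros b _; rewrite in_sep, in_pow, Q by (dfn || assumption); tauto. }
  split; [assumption|]; split; [assumption|]; intros b y Hb Hy.
  rewrite is_diff_iff in Hy; subst y; apply (uf_diff CZ).
  + intros z Hz; eauto using ordinal_trans.
  + rewrite E; intros [_ M]; exact (L b Hb M).
- intros x Hx; rewrite E; tauto.
Qed.

Section Sum.
Variable g : V.
Hypothesis Hg : aa (fun b => Un (ap g b)).
Let e := cls HU (lam d (fun a => union (ap g a))).
Let HW : Un_on (cls HU g) e := Un_on_cls Hg.
Local Instance ZW : ZFC (Ult (cls HU g)) := ZFC_Ult HW.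

Lemma in_Ult_trans (M : SetStr) (hM : ZFC M) (X s : M) (HX : Un_on X s) (x y : M) :
  x ∈ y → in_Ult X y → in_Ult X x.
Proof.
intros Hxy [s' [f [H K]]]; pose proof (Un_on_fun HX H); subst s'.
assert (Hf : is_fun f s) by apply K; rewrite (collapse_coll (Un_on_cc H) Hf) in K; subst y.
rewrite (in_coll (Un_on_cc H)) in Hxy by assumption; destruct Hxy as [h [Hh [_ ->]]].
exists s, h; split; [assumption|]; now rewrite (collapse_coll (Un_on_cc H)).
Qed.

(** Łoś's theorem is applied twice. The function [A] represents, in the ultrapower of the
    ultrapower, the ordinal from which the sum is derived; whether it lies in the image of [x] is
    reduced first to the ultrapower by [U] and then to [V]. *)
Lemma ultrafilter_sum_iff Z : ultrafilter_sum U (cls HU g) Z ↔ is_sum g Z.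
Proof.
set (u := ultid HU); set (A := lam e (fun x => nsum x u)).
assert (Ou : ordinal u).
{ unfold u, ultid; apply (los1 HU (P := @ordinal) _ uniform_ordinal).
  apply (aa_all HC); [dfn|]; intros a Ha; rewrite ap_lam by (dfn || assumption).
  eapply ordinal_mem; [apply HU|assumption]. }
assert (Oe : ordinal e) by apply HW.
(* Absoluteness is used once for each of the two ultrapowers, the second being transitive in the
   first. *)
assert (N : natural_sum (val (val (ultid HW))) (val (val (ultj HW u)))
  (val (val (cls HW A)))).
{ apply (natural_sum_val (hM := ZU) (@in_Ult_trans V hV U d HU)).
  apply (natural_sum_val (hM := ZW) (@in_Ult_trans (Ult U) ZU (cls HU g) e HW)).
  apply (los3 HW (P := @natural_sum) _ _ _ uniform_natural_sum).
  apply (aa_all (Un_on_cc HW)); [dfn|]; intros x Hx; unfold A.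
  rewrite !ap_lam by (dfn || assumption).
  apply nsum_spec; [exact (ordinal_mem Oe Hx)|exact Ou]. }
assert (J : ∀ x (z : V), iter_embed (cls HU g) x z ↔ z = val (val (ultj HW (ultj HU x)))).
{ intros x z; split.
  - intros [y [t [H1 [H2 ->]]]]; rewrite (ult_embed_iff HU) in H1; subst y.
    rewrite (ult_embed_iff HW) in H2; now subst t.
  - intros ->; exists (ultj HU x), (ultj HW (ultj HU x)).
    rewrite (ult_embed_iff HU), (ult_embed_iff HW); auto. }
assert (K : ∀ x, (∃ y, iter_embed (cls HU g) x y ∧ val (val (cls HW A)) ∈ y) ↔ sum_large g x).
{ intros x; transitivity (cls HW A ∈ ultj HW (ultj HU x)).
  - split; [intros [y [Hy L]]; rewrite J in Hy; subst y; exact L|].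
    intros L; eexists; rewrite J; split; [reflexivity|exact L].
  - unfold ultj at 1; rewrite cls_mem.
    (* The large set is existentially quantified and the sum is described by the relation
       [natural_sum], so that the condition becomes a uniform notion, to which Łoś's theorem for [U]
       applies. *)
    transitivity (∃ Y : Ult U, Y ∈ cls HU g ∧ ∀ z : Ult U, z ∈ Y → ∃ c : Ult U,
      natural_sum z u c ∧ c ∈ ultj HU x).
    + split.
      * intros L; eexists; split; [exact L|]; intros z; rewrite in_sep by dfn.
        intros [Hz L']; unfold A in L'; rewrite !ap_lam in L' by (dfn || assumption).
        exists (nsum z u); split; [|exact L'].
        apply nsum_spec; [exact (ordinal_mem Oe Hz)|exact Ou].
      * intros [Y [HY L]]; apply (uf_up (Un_on_cc HW) HY); intros z; [|rewrite in_sep by dfn; tauto].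
        intros Hz; assert (Hze : z ∈ e) by exact (uf_sub (Un_on_cc HW) HY Hz).
        rewrite in_sep by dfn; split; [assumption|]; unfold A.
        rewrite !ap_lam by (dfn || assumption).
        destruct (L z Hz) as [c [Hc Hcx]].
        rewrite (natural_sum_fun (nsum_spec (ordinal_mem Oe Hze) Ou) Hc); assumption.
    + unfold u, ultid, ultj.
      rewrite (los3 HU (P := fun M W u x => ∃ Y : M, Y ∈ W ∧ ∀ z : M, z ∈ Y → ∃ c : M,
        natural_sum z u c ∧ c ∈ x)) by uniform.
      unfold sum_large; assert (Hg' := Hg).
      split; intros L; revert Hg' L; apply (aa_imp2 HC); try dfn; intros b Hb [s Hs];
        rewrite !ap_lam by (dfn || assumption); pose proof (Un_on_cc Hs) as Cs;
        rewrite (uf_union Cs);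
        assert (Ob : ordinal b) by (eapply ordinal_mem; [apply HU|assumption]).
      * intros [Y [HY L]]; apply (uf_up Cs HY); intros z; [|rewrite in_sep by dfn; tauto].
        intros Hz; assert (Hzs : z ∈ s) by exact (uf_sub Cs HY Hz).
        rewrite in_sep by dfn; split; [assumption|]; destruct (L z Hz) as [c [Hc Hcx]].
        rewrite (natural_sum_fun (nsum_spec (ordinal_mem (proj1 Hs) Hzs) Ob) Hc); assumption.
      * intros L; eexists; split; [exact L|]; intros z; rewrite in_sep by dfn; intros [Hz L'].
        eexists; split; [|exact L']; apply nsum_spec; [|assumption].
        eapply ordinal_mem; [apply Hs|assumption]. }
split.
- intros [u' [i [t [a [H1 [H2 [H3 [H4 [c [H5 H6]]]]]]]]]].
  rewrite (ult_id_iff HU) in H1; subst u'; rewrite (ult_id_iff HW) in H2; subst i.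
  rewrite (ult_embed_iff HW) in H3; subst t.
  rewrite (natural_sum_fun H4 N) in *.
  exists c; split; [revert H5; apply least_imp; intros b _; apply K|].
  intros x; rewrite H6, K; tauto.
- intros [c [H5 H6]]; exists u, (ultid HW), (ultj HW u), (val (val (cls HW A))).
  rewrite (ult_id_iff HU), (ult_id_iff HW), (ult_embed_iff HW).
  do 4 (split; [auto; fail|]); exists c.
  split; [revert H5; apply least_imp; intros b _; symmetry; apply K|].
  intros x; rewrite H6, K; tauto.
Qed.

End Sum.
End Representation.
#[export] Hint Extern 1 (definable (fun e => sum_large _ _ _ _)) => simple apply definable_sum_large : definable.

(** * Coordinates of natural sums *)

Section Coordinates.
Context {V : SetStr} {hV : ZFC V}.
Implicit Types (a b c d f g n x y z : V).

Definition is_summand c b := ∃ a, natural_sum a b c.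

(* The position of [b] among the right summands of [c]; it is a natural number
   because a larger right summand has a smaller left summand. *)
Definition summand_index c b :=
  memrec (fun b f => bigcup (sep b (fun x => is_summand c x)) (fun x => succ (ap f x))) b.

Lemma definable_summand_index (s t : (nat → V) → V) : definable_term s → definable_term t →
  definable_term (fun e => summand_index (s e) (t e)).
Proof. unfold summand_index, is_summand; dfn. Qed.
Hint Resolve definable_summand_index : definable.

Lemma in_summand_index z c b : z ∈ summand_index c b ↔
  ∃ x, x ∈ b ∧ is_summand c x ∧ z ∈ succ (summand_index c x).
Proof.
unfold summand_index at 1; rewrite memrec_eq by (unfold is_summand; dfn).
rewrite in_bigcup by (unfold is_summand; dfn); split.
- intros [x [Hx H]]; rewrite in_sep in Hx by (unfold is_summand; dfn); exists x.
  rewrite ap_lam in H by (tauto || (unfold is_summand; dfn)); tauto.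
- intros [x [Hx [K H]]]; exists x; rewrite in_sep by (unfold is_summand; dfn).
  rewrite ap_lam by (tauto || (unfold is_summand; dfn)); tauto.
Qed.

Lemma summand_index_lt c b b' : b ∈ b' → is_summand c b → summand_index c b ∈ summand_index c b'.
Proof. intros H K; apply in_summand_index; exists b; auto using in_succ_self. Qed.

(** Among the right summands of [c] below [b], the one with the least left summand is the greatest.
    So if there are any, the index of [b] is the successor of an index, and no limit stage
    occurs. *)
Lemma summand_index_nat c b : ordinal b → summand_index c b ∈ omega.
Proof.
apply (@ordinal_ind _ _ (fun b => summand_index c b ∈ omega)); [dfn|].
clear b; intros b Ob IH.
destruct (classic (∃ a, ordinal a ∧ ∃ x, x ∈ b ∧ natural_sum a x c)) as [N|N].
- apply ordinal_min in N; [|dfn]; destruct N as [a [Oa [[x [Hx Hs]] L]]].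
  replace (summand_index c b) with (succ (summand_index c x)); [now apply succ_in_omega, IH|].
  apply ext; intros z; rewrite in_summand_index; split; [intros Hz; exists x|].
  + split; [assumption|]; split; [now exists a|assumption].
  + intros [y [Hy [[a' Hs'] Hz]]].
    assert (Ox : ordinal x) by exact (ordinal_mem Ob Hx).
    assert (Oy : ordinal y) by exact (ordinal_mem Ob Hy).
    destruct (ordinal_total Oy Ox) as [D|[D|D]]; [|now subst|exfalso].
    * apply (summand_index_lt (c := c)) in D; [|now exists a'].
      pose proof (ordinal_nat (IH x Hx)) as On.
      rewrite in_succ in Hz |- *; left; destruct Hz as [Hz | ->]; [|assumption].
      eauto using ordinal_trans.
    * assert (Oa' : ordinal a') by apply Hs'.
      destruct (natural_sum_lt_inv (a := a) (b := x) (c := c) (a' := a) (b' := y)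
        (c' := nsum a y) Hs (nsum_spec Oa Oy)) as [E|E].
      -- eapply natural_sum_lt_r; [exact D|exact Hs|now apply nsum_spec].
      -- exact (mem_irrefl E).
      -- apply (L a'); [|eauto].
         destruct (ordinal_total Oa' Oa) as [F|[F|F]]; [assumption|exfalso|exfalso].
         ++ subst; pose proof (natural_sum_lt_r D Hs Hs') as M; exact (mem_irrefl M).
         ++ pose proof (natural_sum_lt_r D Hs (nsum_spec Oa Oy)) as M1.
            pose proof (natural_sum_lt_l F (nsum_spec Oa Oy) Hs') as M2.
            exact (mem_asym M1 M2).
- replace (summand_index c b) with (@emp V hV); [apply emp_in_omega|].
  apply ext; intros z; rewrite in_summand_index; split; [intros Hz; case (in_emp Hz)|].
  intros [x [Hx [[a Ha] _]]]; exfalso; apply N; exists a; split; [apply Ha|eauto].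
Qed.

Lemma summand_index_inj c b b' : is_summand c b → is_summand c b' →
  summand_index c b = summand_index c b' → b = b'.
Proof.
intros H H' E; destruct H as [a Ha], H' as [a' Ha'].
destruct (@ordinal_total _ _ b b') as [D|[D|D]]; [apply Ha|apply Ha'|exfalso|assumption|exfalso].
- apply (summand_index_lt (c := c)) in D; [|now exists a].
  rewrite E in D; exact (mem_irrefl D).
- apply (summand_index_lt (c := c)) in D; [|now exists a'].
  rewrite E in D; exact (mem_irrefl D).
Qed.

(** Otherwise every natural number is avoided almost everywhere, and by countable completeness all
    of them are avoided at once. *)
Lemma aa_nat_const U d (f : V → V) : cc_ultrafilter U d → definable_term (fun e => f (e 0)) →
  almost_all U d (fun a => f a ∈ omega) → ∃ n, n ∈ omega ∧ almost_all U d (fun a => f a = n).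
Proof.
intros H Hf K; apply NNPP; intros N.
destruct (aa_ex H (P := fun a => f a ∈ omega ∧ ∀ n, n ∈ omega → f a ≠ n)) as [a [_ [L1 L2]]];
  [dfn| |exact (L2 _ L1 eq_refl)].
apply (aa_and H); [dfn|dfn|assumption|].
apply (aa_omega H (P := fun n a => f a ≠ n)); [dfn|].
intros n Hn; apply (aa_not H); [dfn|]; intros M; apply N; eauto.
Qed.

(** The position of [b] among the right summands of [a ⊕ b] is a natural number, so it is constant
    on a large set, first in [a] for fixed [b] and then in [b]. With [n] this constant, [p] takes
    the right summand in position [n], and [q] takes its left partner. *)
Lemma ex_coordinates U d g : Un_on U d → almost_all U d (fun b => Un (ap g b)) →
  ∃ p q : V → V, definable_term (fun e => p (e 0)) ∧ definable_term (fun e => q (e 0)) ∧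
  almost_all U d (fun b => almost_all (ap g b) (union (ap g b)) (fun a =>
    ordinal a ∧ q (nsum a b) = a ∧ p (nsum a b) = b)).
Proof.
intros HU Hg; pose proof (Un_on_cc HU) as HC.
pose (Q := fun b n => almost_all (ap g b) (union (ap g b)) (fun a =>
  summand_index (nsum a b) b = n)).
assert (HQ : definable (fun e => Q (e 0) (e 1))) by (unfold Q; dfn).
pose (k := fun b => the (fun n => n ∈ omega ∧ Q b n)).
assert (Hk : definable_term (fun e => k (e 0))) by (unfold k; dfn).
assert (K : almost_all U d (fun b => k b ∈ omega ∧ Q b (k b))).
{ revert Hg; apply (aa_imp HC); [dfn|dfn|]; intros b Hb [s Hs].
  pose proof (Un_on_cc Hs) as Cs; assert (Ob : ordinal b) by exact (ordinal_mem (proj1 HU) Hb).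
  apply (the_spec (P := fun n => n ∈ omega ∧ Q b n)).
  destruct (aa_nat_const (f := fun a => summand_index (nsum a b) b) Cs) as [n [Hn L]]; [dfn| |].
  { apply (aa_all Cs); [dfn|]; intros a _; now apply summand_index_nat. }
  exists n; unfold Q; rewrite (uf_union Cs); split; [auto|]; intros n' [Hn' L'].
  destruct (aa_ex Cs (P := fun a => summand_index (nsum a b) b = n ∧
    summand_index (nsum a b) b = n')) as [a [_ [E E']]];
    [dfn|apply (aa_and Cs); (assumption || dfn)|congruence]. }
destruct (aa_nat_const (f := k) HC) as [n [Hn L]]; [dfn| |].
{ revert K; apply (aa_imp HC); [dfn|dfn|tauto]. }
pose (p := fun c => the (fun b => is_summand c b ∧ summand_index c b = n)).
pose (q := fun c => the (fun a => natural_sum a (p c) c)).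
assert (Hp : definable_term (fun e => p (e 0))) by (unfold p, is_summand; dfn).
assert (Hq : definable_term (fun e => q (e 0))) by (unfold q; dfn).
exists p, q; do 2 (split; [assumption|]).
apply (aa_mono2 HC (P := fun b => Un (ap g b)) (P' := fun b => Q b n)); [dfn|dfn|dfn|assumption| |].
{ revert K L; apply (aa_imp2 HC); [dfn|dfn|dfn|]; intros b _ [_ M] <-; exact M. }
intros b Hb [s Hs] M; unfold Q in M; pose proof (Un_on_cc Hs) as Cs; rewrite (uf_union Cs) in *.
assert (Ob : ordinal b) by exact (ordinal_mem (proj1 HU) Hb).
revert M; apply (aa_imp Cs); [dfn|dfn|]; intros a Ha E.
assert (Oa : ordinal a) by exact (ordinal_mem (proj1 Hs) Ha).
pose proof (nsum_spec Oa Ob) as S; split; [assumption|].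
assert (Ep : p (nsum a b) = b).
{ apply the_eq; [split; [now exists a|assumption]|]; intros b' [H1 H2].
  apply (summand_index_inj (c := nsum a b)); [assumption|now exists a|congruence]. }
split; [|assumption]; apply the_eq; [now rewrite Ep|]; rewrite Ep; intros a' H'.
assert (Oa' : ordinal a') by apply H'.
destruct (ordinal_total Oa' Oa) as [D|[D|D]]; [exfalso|assumption|exfalso].
- pose proof (natural_sum_lt_l D H' S) as M; exact (mem_irrefl M).
- pose proof (natural_sum_lt_l D S H') as M; exact (mem_irrefl M).
Qed.

End Coordinates.

(** * Comparing the two sums *)

Section Comparison.
Context {V : SetStr} {hV : ZFC V}.
Implicit Types (a b c d f g h x y z : V).

Lemma below_intro U u W w (F : V → V) : cc_ultrafilter U u → cc_ultrafilter W w →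
  definable_term (fun e => F (e 0)) → almost_all W w (fun a => cc_ultrafilter (F a) a) →
  (∀ x, x ⊆ u → x ∈ U ↔ almost_all W w (fun a => inter x a ∈ F a)) → below U W.
Proof.
intros CU CW HF A H; exists (lam w F); rewrite (uf_union CU), (uf_union CW); split.
- revert A; apply (aa_imp CW); [dfn|dfn|]; intros a Ha; now rewrite ap_lam by (dfn || assumption).
- intros x Hx; rewrite (H x Hx); apply (aa_iff CW); [dfn|dfn|]; intros a Ha.
  rewrite ap_lam by (dfn || assumption); tauto.
Qed.

Definition pushforward U d (h : V → V) c :=
  sep (pow c) (fun x => almost_all U d (fun a => h a ∈ x)).

Lemma in_pushforward U d (h : V → V) c x : definable_term (fun e => h (e 0)) →
  x ∈ pushforward U d h c ↔ x ⊆ c ∧ almost_all U d (fun a => h a ∈ x).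
Proof. intros Hh; unfold pushforward; rewrite in_sep, in_pow by dfn; tauto. Qed.

Lemma cc_pushforward U d (h : V → V) c : cc_ultrafilter U d →
  definable_term (fun v => h (v 0)) → almost_all U d (fun a => h a ∈ c) →
  cc_ultrafilter (pushforward U d h c) c.
Proof. exact (@cc_push V hV U d h c). Qed.

Lemma inter_in_pushforward U d (h : V → V) c x : cc_ultrafilter U d →
  definable_term (fun e => h (e 0)) → almost_all U d (fun a => h a ∈ c) →
  inter x c ∈ pushforward U d h c ↔ almost_all U d (fun a => h a ∈ x).
Proof.
intros C Hh H; rewrite in_pushforward by assumption; split.
- intros [_ K]; revert K; apply (aa_imp C); [dfn|dfn|]; intros a _; rewrite in_inter; tauto.
- intros K; split; [intros z; rewrite in_inter; tauto|]; revert H K.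
  apply (aa_imp2 C); [dfn|dfn|dfn|]; intros a _; rewrite in_inter; auto.
Qed.

Lemma definable_pushforward (s t : (nat → V) → V) (h : (nat → V) → V → V) (u : (nat → V) → V) :
  definable_term s → definable_term t → definable_term (fun e => h (fun n => e (S n)) (e 0)) →
  definable_term u → definable_term (fun e => pushforward (s e) (t e) (h e) (u e)).
Proof. intros; unfold pushforward; dfn. Qed.
Hint Resolve definable_pushforward : definable.

Lemma aa_forall_both U d (S : V → V) (P Q : V → V → Prop) : cc_ultrafilter U d →
  definable_term (fun e => S (e 0)) →
  definable (fun e => P (e 0) (e 1)) → definable (fun e => Q (e 0) (e 1)) →
  almost_all U d (fun b => cc_ultrafilter (S b) (union (S b))) →
  (almost_all U d (fun b => almost_all (S b) (union (S b)) (fun a => P b a ∨ Q b a))) →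
  almost_all U d (fun b => almost_all (S b) (union (S b)) (fun a => P b a)) ∨
  almost_all U d (fun b => almost_all (S b) (union (S b)) (fun a => Q b a)).
Proof.
intros C HS HP HQ HC H; apply (aa_or C); [dfn|dfn|]; revert HC H.
apply (aa_imp2 C); [dfn|dfn|dfn|]; intros b _ Cb; apply (aa_or Cb); dfn.
Qed.

(** * Two sums, a Ketonen witness between them, and its images under the coordinates *)

Section Sums.
Variables (U d W w g h Z0 c0 Z1 c1 : V).
Hypothesis HU : Un_on U d.
Hypothesis HW : Un_on W w.
Hypothesis Hg : is_limit U d g W w.
Hypothesis Hh : is_limit W w h U d.
Hypothesis HZ1 : Un_on Z1 c1.
Hypothesis S0 : ∀ x, x ⊆ c0 → x ∈ Z0 ↔ sum_large U d g x.
Hypothesis S1 : ∀ x, x ⊆ c1 → x ∈ Z1 ↔ sum_large W w h x.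

Let CU := Un_on_cc HU.
Let CW := Un_on_cc HW.
Let C1 := Un_on_cc HZ1.

(* The quantifier "for almost all b with respect to U, for almost all a with
   respect to the ultrafilter g(b)". *)
Notation aag P := (almost_all U d (fun b => almost_all (ap g b) (union (ap g b)) (P b))).

Lemma aag_imp2 (P P' Q : V → V → Prop) : definable (fun e => P (e 0) (e 1)) →
  definable (fun e => P' (e 0) (e 1)) → definable (fun e => Q (e 0) (e 1)) →
  (∀ b a, b ∈ d → a ∈ union (ap g b) → ordinal a → ordinal b → P b a → P' b a → Q b a) →
  aag P → aag P' → aag Q.
Proof.
intros HP HP' HQ H K K'.
assert (L : almost_all U d (fun b => Un (ap g b))).
{ destruct Hg as [L _]; revert L; apply (aa_imp CU); [dfn|dfn|tauto]. }
apply (aa_mono2 CU (P := fun b => Un (ap g b)) (P' := fun b =>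
  almost_all (ap g b) (union (ap g b)) (P b) ∧ almost_all (ap g b) (union (ap g b)) (P' b)));
  [dfn|dfn|dfn|assumption|apply (aa_and CU); (assumption || dfn)|].
intros b Hb [s Hs] [M M']; pose proof (Un_on_cc Hs) as Cs.
assert (E : union (ap g b) = s) by exact (uf_union Cs); rewrite E in *.
revert M M'; apply (aa_imp2 Cs); [dfn|dfn|dfn|]; intros a Ha.
apply H; [assumption|now rewrite E|exact (ordinal_mem (proj1 Hs) Ha)|exact (ordinal_mem (proj1 HU) Hb)].
Qed.

Lemma aag_iff (P Q R : V → V → Prop) : definable (fun e => P (e 0) (e 1)) →
  definable (fun e => Q (e 0) (e 1)) → definable (fun e => R (e 0) (e 1)) →
  aag P → (∀ b a, b ∈ d → a ∈ union (ap g b) → ordinal a → ordinal b → P b a → Q b a ↔ R b a) →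
  aag Q ↔ aag R.
Proof.
intros HP HQ HR K H; split; revert K; apply aag_imp2; try assumption;
  intros b a Hb Ha Oa Ob Hp; now apply H.
Qed.

Variable F : V.
Hypothesis F_cc : almost_all Z0 c0 (fun c => cc_ultrafilter (ap F c) c).
Hypothesis F_limit : ∀ x, x ⊆ c1 → x ∈ Z1 ↔ almost_all Z0 c0 (fun c => inter x c ∈ ap F c).

Lemma sum_aag (P : V → Prop) : definable (fun e => P (e 0)) →
  almost_all Z0 c0 P ↔ aag (fun b a => nsum a b ∈ sep c0 P).
Proof. intros HP; apply S0; intros z; rewrite in_sep by dfn; tauto. Qed.

Variables p q : V → V.
Hypothesis p_def : definable_term (fun e => p (e 0)).
Hypothesis q_def : definable_term (fun e => q (e 0)).
Hypothesis pq : almost_all W w (fun b => almost_all (ap h b) (union (ap h b)) (fun a =>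
  ordinal a ∧ q (nsum a b) = a ∧ p (nsum a b) = b)).

(** Membership in [Z1] may be tested only at sums whose coordinates [p] and [q] recover, where a
    condition on the sum becomes a condition on its two summands. *)
Lemma sum_large_h (x : V) (P : V → V → Prop) : x ⊆ c1 → definable (fun e => P (e 0) (e 1)) →
  (∀ a b, ordinal a → ordinal b → nsum a b ∈ c1 → q (nsum a b) = a → p (nsum a b) = b →
    nsum a b ∈ x ↔ P b a) →
  x ∈ Z1 ↔ almost_all W w (fun b => almost_all (ap h b) (union (ap h b)) (P b)).
Proof.
intros Hx HP H; rewrite (S1 Hx); unfold sum_large.
assert (L : almost_all W w (fun b => almost_all (ap h b) (union (ap h b)) (fun a => nsum a b ∈ c1))).
{ apply (proj1 (S1 (fun z Hz => Hz))), (uf_space C1). }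
assert (K : almost_all W w (fun b => Un (ap h b) ∧
  almost_all (ap h b) (union (ap h b)) (fun a =>
    ordinal a ∧ q (nsum a b) = a ∧ p (nsum a b) = b) ∧
  almost_all (ap h b) (union (ap h b)) (fun a => nsum a b ∈ c1))).
{ repeat (apply (aa_and CW); [dfn|dfn| |]); try assumption.
  destruct Hh as [M _]; revert M; apply (aa_imp CW); [dfn|dfn|tauto]. }
split; revert K; apply (aa_imp2 CW); try dfn; intros b Hb [[s Hs] [K1 K2]];
  pose proof (Un_on_cc Hs) as Cs; rewrite (uf_union Cs) in *;
  assert (K : almost_all (ap h b) s (fun a => (ordinal a ∧ q (nsum a b) = a ∧ p (nsum a b) = b) ∧
    nsum a b ∈ c1)) by (apply (aa_and Cs); (assumption || dfn));
  revert K; apply (aa_imp2 Cs); try dfn; intros a Ha [[Oa [E1 E2]] E3]; apply H; auto;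
  exact (ordinal_mem (proj1 HW) Hb).
Qed.

Lemma push_p x : x ⊆ w → x ∈ W ↔ sep c1 (fun c => p c ∈ x) ∈ Z1.
Proof.
intros Hx; rewrite (@sum_large_h _ (fun b a => b ∈ x)).
- rewrite <- (aa_mem CW Hx); destruct Hh as [M _].
  split; revert M; apply (aa_imp2 CW); try dfn; intros b _ [[s Hs] _];
    pose proof (Un_on_cc Hs) as Cs; rewrite (uf_union Cs); [intros K|].
  + apply (aa_all Cs); [dfn|auto].
  + intros K; apply (aa_ex Cs) in K; [|dfn]; destruct K as [_ [_ K]]; exact K.
- intros z; rewrite in_sep by dfn; tauto.
- dfn.
- intros a b _ _ Hc Eq Ep; rewrite in_sep, Ep by dfn; tauto.
Qed.

(** The left summands are distributed by the [W]-limit of the [h b], and this limit is [U]. *)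
Lemma push_q x : x ⊆ d → x ∈ U ↔ sep c1 (fun c => q c ∈ x) ∈ Z1.
Proof.
intros Hx; rewrite (@sum_large_h _ (fun b a => a ∈ x)).
- destruct Hh as [M K]; rewrite (K x Hx).
  assert (Q : ∀ b, Un (ap h b) → inter x (union (ap h b)) ∈ ap h b ↔
    almost_all (ap h b) (union (ap h b)) (fun a => a ∈ x)).
  { intros b [s Hs]; pose proof (Un_on_cc Hs) as Cs; rewrite (uf_union Cs).
    rewrite <- (aa_mem Cs) by (intros z; rewrite in_inter; tauto).
    apply (aa_iff Cs); [dfn|dfn|]; intros a Ha; rewrite in_inter; tauto. }
  split; revert M; apply (aa_imp2 CW); try dfn; intros b _ [L _]; now apply Q.
- intros z; rewrite in_sep by dfn; tauto.
- dfn.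
- intros a b _ _ Hc Eq Ep; rewrite in_sep, Eq by dfn; tauto.
Qed.

(** The last conjunct, which holds almost everywhere because [c1] belongs to [Z1], allows a preimage
    under a coordinate function to be cut down to [c1] without losing largeness. *)
Definition good b a := natural_sum a b (nsum a b) ∧
  cc_ultrafilter (ap F (nsum a b)) (nsum a b) ∧ inter c1 (nsum a b) ∈ ap F (nsum a b).

Lemma definable_good : definable (fun e => good (e 0) (e 1)).
Proof. unfold good; dfn. Qed.
Let good_def := definable_good.

Lemma aag_good : aag good.
Proof.
assert (K : c1 ∈ Z1) by apply (uf_space C1).
apply F_limit, sum_aag in K; [|dfn|auto]; pose proof F_cc as K'; apply sum_aag in K'; [|dfn].
revert K K'; apply aag_imp2; [dfn|dfn|dfn|]; intros b a _ _ Oa Ob; rewrite !in_sep by dfn.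
pose proof (nsum_spec Oa Ob); unfold good; tauto.
Qed.

Lemma limit_aag x : x ⊆ c1 → x ∈ Z1 ↔ aag (fun b a => inter x (nsum a b) ∈ ap F (nsum a b)).
Proof.
intros Hx; rewrite (F_limit Hx), sum_aag by dfn.
assert (K : aag (fun b a => nsum a b ∈ c0)).
{ generalize F_cc; rewrite sum_aag by dfn; intros K; generalize K; revert K.
  apply aag_imp2; [dfn|dfn|dfn|]; intros b a _ _ _ _; rewrite in_sep by dfn; tauto. }
apply (aag_iff (P := fun b a => nsum a b ∈ c0)); [dfn|dfn|dfn|assumption|].
intros b a _ _ _ _ L; rewrite in_sep by dfn; tauto.
Qed.

Lemma preimage_aag (r : V → V) x : definable_term (fun e => r (e 0)) →
  sep c1 (fun c => r c ∈ x) ∈ Z1 ↔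
  aag (fun b a => almost_all (ap F (nsum a b)) (nsum a b) (fun c => r c ∈ x)).
Proof.
intros Hr; rewrite limit_aag by (intros z; rewrite in_sep by dfn; tauto).
apply (aag_iff (P := good)); [dfn|dfn|dfn|exact aag_good|].
intros b a _ _ _ _ [_ [C I]]; split; intros K.
- apply (uf_up C K); intros z; rewrite ?in_inter, !in_sep by dfn; tauto.
- apply (uf_up C (uf_inter C I K)); intros z; rewrite ?in_inter, !in_sep by dfn;
    rewrite ?in_inter; tauto.
Qed.

(* Each [c] below [a ⊕ b] with [c = q c ⊕ p c] has [p c < a] or [q c < b]. *)
Lemma coordinate_cases :
  aag (fun b a => almost_all (ap F (nsum a b)) (nsum a b) (fun c => p c ∈ a)) ∨
  aag (fun b a => almost_all (ap F (nsum a b)) (nsum a b) (fun c => q c ∈ b)).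
Proof.
apply (@aa_forall_both U d (fun b => ap g b)
  (fun b a => almost_all (ap F (nsum a b)) (nsum a b) (fun c => p c ∈ a))
  (fun b a => almost_all (ap F (nsum a b)) (nsum a b) (fun c => q c ∈ b))); [assumption|dfn|dfn|dfn| |].
{ destruct Hg as [L _]; revert L; apply (aa_imp CU); [dfn|dfn|]; intros b _ [[s Hs] _].
  rewrite (uf_union (Un_on_cc Hs)); exact (Un_on_cc Hs). }
pose (x := sep c1 (fun c => natural_sum (q c) (p c) c)).
assert (Hx : x ⊆ c1) by (intros z; unfold x; rewrite in_sep by dfn; tauto).
assert (K : x ∈ Z1).
{ rewrite (@sum_large_h x (fun b a => nsum a b = nsum a b)); [|assumption|dfn|].
  - destruct Hh as [M _]; revert M; apply (aa_imp CW); [dfn|dfn|]; intros b _ [[s Hs] _].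
    rewrite (uf_union (Un_on_cc Hs)); apply (aa_all (Un_on_cc Hs)); [dfn|auto].
  - intros a b Oa Ob Hc Eq Ep; unfold x; rewrite in_sep, Eq, Ep by dfn.
    split; [auto|]; intros _; split; [assumption|now apply nsum_spec]. }
apply (limit_aag Hx) in K; revert K; generalize aag_good.
apply aag_imp2; [dfn|dfn|dfn|]; intros b a Hb Ha Oa Ob [N [G _]] I.
apply (aa_or G); [dfn|dfn|]; apply (uf_up G I); intros z; rewrite in_sep by dfn; [|tauto].
unfold x; rewrite in_inter, in_sep by dfn; intros [[_ M] Hz]; split; [assumption|].
apply (natural_sum_lt_inv (natural_sum_comm M) N Hz).
Qed.

(** When [q c] lies below [b], the push-forwards under [q] are ultrafilters on [b]. For each [b],
    their limit over [a] with respect to [g b] is a single ultrafilter [H b] on [b]. As [q] pushes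
    [Z1] forward to [U], the [H b] witness that [U] is below itself. *)
Lemma q_case : aag (fun b a => almost_all (ap F (nsum a b)) (nsum a b) (fun c => q c ∈ b)) →
  below U U.
Proof.
intros HQ.
pose (G := fun b a => pushforward (ap F (nsum a b)) (nsum a b) q b).
assert (HG : definable_term (fun e => G (e 0) (e 1))) by (unfold G; dfn).
pose (H := fun b => sep (pow b) (fun x =>
  almost_all (ap g b) (union (ap g b)) (fun a => inter x b ∈ G b a))).
assert (HH : definable_term (fun e => H (e 0))) by (unfold H; dfn).
assert (GQ : aag (fun b a => good b a ∧
  almost_all (ap F (nsum a b)) (nsum a b) (fun c => q c ∈ b))).
{ revert HQ; generalize aag_good; apply aag_imp2; [dfn|dfn|dfn|auto]. }
pose (ok := fun b => Un (ap g b) ∧ almost_all (ap g b) (union (ap g b)) (fun a => good b a ∧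
  almost_all (ap F (nsum a b)) (nsum a b) (fun c => q c ∈ b))).
assert (Hok : definable (fun e => ok (e 0))) by (unfold ok; dfn).
assert (Aok : almost_all U d ok).
{ apply (aa_and CU); [dfn|dfn| |assumption].
  destruct Hg as [L _]; revert L; apply (aa_imp CU); [dfn|dfn|tauto]. }
assert (HC : ∀ b, b ∈ d → ok b → cc_ultrafilter (H b) b).
{ intros b Hb [[s Hs] L]; pose proof (Un_on_cc Hs) as Cs; unfold H; rewrite (uf_union Cs) in *.
  apply (cc_limit (g := fun a => G b a) (e := fun _ => b) Cs); [dfn|dfn|].
  revert L; apply (aa_imp Cs); [dfn|dfn|]; intros a _ [[_ [Ga _]] Ka]; split; [|auto].
  now apply cc_pushforward. }
apply (below_intro (F := H) CU CU); [assumption|revert Aok; apply (aa_imp CU); [dfn|dfn|exact HC]|].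
intros x Hx; rewrite (push_q Hx), preimage_aag by assumption.
transitivity (aag (fun b a => inter (inter x b) b ∈ G b a)).
- apply (aag_iff (P := fun b a => good b a ∧
    almost_all (ap F (nsum a b)) (nsum a b) (fun c => q c ∈ b))); [dfn|dfn|dfn|assumption|].
  intros b a Hb Ha Oa Ob [[_ [Ga _]] Ka].
  replace (inter (inter x b) b) with (inter x b)
    by (apply ext; intros z; rewrite !in_inter; tauto).
  unfold G; rewrite (inter_in_pushforward x Ga) by assumption; tauto.
- apply (aa_iff CU); [dfn|dfn|]; intros b Hb; unfold H; rewrite in_sep, in_pow by dfn.
  split; [|tauto]; intros K; split; [intros z; rewrite in_inter; tauto|assumption].
Qed.

(** When [p c] lies below [a], the push-forwards [G b a] under [p] are ultrafilters on [a]. Their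
    limit [H b] with respect to [g b] is thus below [g b], with [G b] as witness, and the [U]-limit
    of the [H b] is [W] because [p] pushes [Z1] forward to [W]. *)
Lemma p_case : aag (fun b a => almost_all (ap F (nsum a b)) (nsum a b) (fun c => p c ∈ a)) →
  ∃ f, is_limit U d f W w ∧ almost_all U d (fun b => ketonen (ap f b) (ap g b)).
Proof.
intros HP.
pose (G := fun b a => pushforward (ap F (nsum a b)) (nsum a b) p a).
assert (HG : definable_term (fun e => G (e 0) (e 1))) by (unfold G; dfn).
pose (H := fun b => sep (pow (union (ap g b))) (fun x =>
  almost_all (ap g b) (union (ap g b)) (fun a => inter x a ∈ G b a))).
assert (HH : definable_term (fun e => H (e 0))) by (unfold H; dfn).
(* [H b] need not be uniform, as an ultrafilter in [Un] must be. Restricting it to the least ordinal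
   that it contains changes neither its [U]-limit nor the witness. *)
pose (B := fun b => uniformization (H b) (union (ap g b))).
assert (HB : definable_term (fun e => B (e 0))) by (unfold B; dfn).
pose (T := fun b => sep (H b) (fun x => x ⊆ B b)).
assert (HT : definable_term (fun e => T (e 0))) by (unfold T; dfn).
pose (gp := fun b a => good b a ∧ almost_all (ap F (nsum a b)) (nsum a b) (fun c => p c ∈ a)).
assert (Hgp : definable (fun e => gp (e 0) (e 1))) by (unfold gp; dfn).
assert (GP : aag gp).
{ revert HP; generalize aag_good; apply aag_imp2; [dfn|dfn|dfn|unfold gp; auto]. }
pose (ok := fun b => Un (ap g b) ∧ almost_all (ap g b) (union (ap g b)) (gp b)).
assert (Hok : definable (fun e => ok (e 0))) by (unfold ok; dfn).
assert (Aok : almost_all U d ok).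
{ apply (aa_and CU); [dfn|dfn| |assumption].
  destruct Hg as [L _]; revert L; apply (aa_imp CU); [dfn|dfn|tauto]. }
assert (Eg : ∀ b s, Un_on (ap g b) s → union (ap g b) = s).
{ intros b s Hs; exact (uf_union (Un_on_cc Hs)). }
assert (Cgp : ∀ b a, gp b a → cc_ultrafilter (G b a) a).
{ intros b a [[_ [Ga _]] Ka]; now apply cc_pushforward. }
assert (HC : ∀ b, ok b → cc_ultrafilter (H b) (union (ap g b))).
{ intros b [[s Hs] L]; pose proof (Un_on_cc Hs) as Cs; unfold H; rewrite (Eg b s Hs) in *.
  apply (cc_limit (g := fun a => G b a) (e := fun a => a) Cs); [dfn|dfn|].
  revert L; apply (aa_imp Cs); [dfn|dfn|]; intros a Ha Ka; split; [now apply Cgp|].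
  intros z Hz; exact (ordinal_trans (proj1 Hs) Hz Ha). }
assert (US : ∀ b, ok b → ordinal (B b) ∧ B b ∈ H b ∧ B b ⊆ union (ap g b) ∧
  (∀ c, c ∈ B b → ¬ c ∈ H b) ∧ Un_on (T b) (B b)).
{ intros b K; refine (uniformization_spec (HC b K) _ eq_refl); destruct K as [[s Hs] _].
  rewrite (Eg b s Hs); apply Hs. }
assert (inH : ∀ b x, ok b → inter x (union (ap g b)) ∈ H b ↔
  almost_all (ap g b) (union (ap g b)) (fun a =>
    almost_all (ap F (nsum a b)) (nsum a b) (fun c => p c ∈ x))).
{ intros b x [[s Hs] L]; pose proof (Un_on_cc Hs) as Cs; unfold H.
  rewrite in_sep, in_pow by dfn; rewrite (Eg b s Hs) in *.
  transitivity (almost_all (ap g b) s (fun a => inter (inter x s) a ∈ G b a)).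
  { split; [tauto|]; intros K; split; [intros z; rewrite in_inter; tauto|assumption]. }
  split; revert L; apply (aa_imp2 Cs); try dfn; intros a Ha [[_ [Ga _]] Ka];
    (assert (E : inter (inter x s) a = inter x a)
      by (apply ext; intros z; rewrite !in_inter; split; [tauto|];
          intros [Hx Hz]; repeat split; auto; exact (ordinal_trans (proj1 Hs) Hz Ha)));
    rewrite E; unfold G; now rewrite (inter_in_pushforward x Ga). }
assert (inT : ∀ b x, ok b → inter x (B b) ∈ T b ↔ inter x (union (ap g b)) ∈ H b).
{ intros b x K; destruct (US b K) as [_ [K1 [K2 _]]]; pose proof (HC b K) as C.
  unfold T; rewrite in_sep by dfn; split.
  - intros [L _]; apply (uf_up C L); intros z; rewrite !in_inter; [intros []; auto|tauto].
  - intros L; split; [|intros z; rewrite in_inter; tauto].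
    apply (uf_up C (uf_inter C K1 L)); intros z; rewrite ?in_inter; [tauto|].
    intros []; auto. }
assert (lim : ∀ x, x ⊆ w → x ∈ W ↔ almost_all U d (fun b => inter x (B b) ∈ T b)).
{ intros x Hx; rewrite (push_p Hx), preimage_aag by assumption.
  split; revert Aok; apply (aa_imp2 CU); try dfn; intros b _ K; rewrite (inT b x K), (inH b x K); auto. }
assert (Eu : ∀ b, ok b → union (T b) = B b).
{ intros b K; destruct (US b K) as [_ [_ [_ [_ K5]]]]; exact (uf_union (Un_on_cc K5)). }
exists (lam d T); split; [split|].
- assert (K : w ∈ W) by apply (uf_space CW).
  apply (lim w (fun z Hz => Hz)) in K; revert Aok K; apply (aa_imp2 CU); [dfn|dfn|dfn|].
  intros b Hb K L; rewrite ap_lam, (Eu b K) by (dfn || assumption).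
  destruct (US b K) as [K1 [K2 [K3 [K4 K5]]]]; split; [now exists (B b)|].
  (* If [w] were below [B b], then [w] would belong to [H b], against the choice of [B b] as the
     least ordinal in [H b]. *)
  apply ordinal_le; [assumption|apply HW|]; intros M; apply (K4 w M).
  rewrite (inT b w K) in L; replace (inter w (union (ap g b))) with w in L; [assumption|].
  apply ext; intros z; rewrite in_inter; split; [|tauto]; intros Hz; split; [assumption|].
  apply K3; exact (ordinal_trans K1 Hz M).
- intros x Hx; rewrite (lim x Hx); split; revert Aok; apply (aa_imp2 CU); try dfn;
    intros b Hb K; rewrite ap_lam, (Eu b K) by (dfn || assumption); auto.
- revert Aok; apply (aa_imp CU); [dfn|dfn|]; intros b Hb K.
  rewrite ap_lam by (dfn || assumption); destruct (US b K) as [K1 [K2 [K3 [K4 K5]]]].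
  destruct K as [[s Hs] L]; rewrite ketonen_iff; split; [now exists (B b)|].
  split; [now exists s|].
  assert (Hgb : definable (fun e => gp b (e 0))) by dfn.
  assert (HGb : definable_term (fun e => G b (e 0))) by dfn.
  pose proof (Un_on_cc Hs) as Cs; rewrite (Eg b s Hs) in *.
  apply (below_intro (F := G b) (Un_on_cc K5) Cs); [assumption| |].
  + revert L; apply (aa_imp Cs); [assumption|dfn|]; intros a _; apply Cgp.
  + intros x Hx; unfold T, H; rewrite !in_sep, in_pow, (Eg b s Hs) by dfn.
    split; [tauto|]; intros M; repeat split; auto.
Qed.

End Sums.

Lemma not_ketonen_sums (U d W w g h Z0 Z1 : V) (HU : Un_on U d) (HW : Un_on W w) :
  translation U W (cls HU g) → translation W U (cls HW h) →
  is_sum U d g Z0 → is_sum W w h Z1 → ¬ ketonen Z1 Z0.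
Proof.
intros Tg Th H0 H1 K.
assert (Lg : is_limit U d g W w)
  by (apply (ult_limit_iff HU g HW); split; [apply Tg|apply Tg]).
assert (Lh : is_limit W w h U d)
  by (apply (ult_limit_iff HW h HU); split; [apply Th|apply Th]).
assert (Ug : almost_all U d (fun b => Un (ap g b))) by (rewrite <- (Un_cls HU); apply Tg).
assert (Uh : almost_all W w (fun b => Un (ap h b))) by (rewrite <- (Un_cls HW); apply Th).
destruct (ex_is_sum HU Ug) as [Z [c0 [E [HZ0 S0]]]].
rewrite (is_sum_unique E H0) in *; clear Z E.
destruct (ex_is_sum HW Uh) as [Z [c1 [E [HZ1 S1]]]].
rewrite (is_sum_unique E H1) in *; clear Z E.
rewrite ketonen_iff in K; destruct K as [_ [_ [F [HF LF]]]].
rewrite (uf_union (Un_on_cc HZ0)), (uf_union (Un_on_cc HZ1)) in *.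
destruct (ex_coordinates HW Uh) as [p [q [Hp [Hq pq]]]].
destruct (coordinate_cases HU HW Lg Lh HZ1 S0 S1 HF LF Hp Hq pq) as [C|C].
- destruct (p_case HU HW Lg Lh HZ1 S0 S1 HF LF Hp Hq pq C) as [f [Lf Kf]].
  exact (translation_minimal HW Tg Lf Kf).
- pose proof (q_case HU HW Lg Lh HZ1 S0 S1 HF LF Hp Hq pq C) as B.
  apply (@ketonen_irrefl V hV U); rewrite ketonen_iff.
  assert (Un U) by now exists d.
  auto.
Qed.

End Comparison.

(* Each "the" in t_U(W), t_W(U) and in the two sums is rendered by [unique]. *)
Theorem theorem5p15 (V : SetStr) (hV : ZFC V) (hlin : ketonen_linear V)
    (U W : V) (hU : Un U) (hW : Un W) :
  exists (WU : Ult U) (UW : Ult W) (Z : V),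
    unique (translation U W) WU /\
    unique (translation W U) UW /\
    unique (ultrafilter_sum U WU) Z /\
    unique (ultrafilter_sum W UW) Z.
Proof.
destruct hU as [d HU], hW as [w HW].
destruct (ex_translation HU hlin HW) as [g Tg].
destruct (ex_translation HW hlin HU) as [h Th].
assert (Ug : almost_all U d (fun b => Un (ap g b))) by (rewrite <- (Un_cls HU); apply Tg).
assert (Uh : almost_all W w (fun b => Un (ap h b))) by (rewrite <- (Un_cls HW); apply Th).
destruct (ex_is_sum HU Ug) as [Z0 [c0 [S0 [HZ0 _]]]].
destruct (ex_is_sum HW Uh) as [Z1 [c1 [S1 [HZ1 _]]]].
assert (E : Z0 = Z1).
{ destruct (hlin Z0 Z1) as [E|[E|E]]; [now exists c0|now exists c1|assumption|exfalso|exfalso].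
  - exact (not_ketonen_sums Th Tg S1 S0 E).
  - exact (not_ketonen_sums Tg Th S0 S1 E). }
subst Z1; exists (cls HU g), (cls HW h), Z0; split; [|split; [|split]]; split.
- exact Tg.
- intros X; exact (translation_unique HU Tg).
- exact Th.
- intros X; exact (translation_unique HW Th).
- now apply ultrafilter_sum_iff.
- intros Z HZ; rewrite (ultrafilter_sum_iff HU Ug) in HZ; exact (is_sum_unique S0 HZ).
- now apply ultrafilter_sum_iff.
- intros Z HZ; rewrite (ultrafilter_sum_iff HW Uh) in HZ; exact (is_sum_unique S1 HZ).
Qed.
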